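(* Suppose that $\frac73<p<5$. There exist $C_1,C_2>0$ independent of $e$, $\rho$, $\lambda$ such that the following estimate holds: for any $u\in H^1(\mathbb{R}^3,\mathbb{C})$ and any $\lambda\in[\delta^*,1]$, where $\delta^*\in(0,1)$ is the specific constant described in the context (the lower bound for the zero $\lambda^*$ of $\lambda\mapsto J(u^\lambda)$), the function $f(\lambda)=I(u^\lambda)-\frac{\lambda^2}{2}Q(u)$ satisfies $$f(\lambda)-f(1)\le-C_1(1-\lambda)^2\|u\|_{p+1}^{p+1}+C_2(1-\lambda)^2e^2\left(\|\rho\|_{6/5}+\|x\cdot\nabla\rho\|_{6/5}+\|x\cdot(D^2\rho\,x)\|_{6/5}\right)\|u\|^2 .$$
   Context: Parameters: $\omega>0$, $e>0$. Notation: $\|\cdot\|_q=\|\cdot\|_{L^q(\mathbb{R}^3)}$, $\|u\|^2=\|\nabla u\|_2^2+\|u\|_2^2$, and $u^\lambda(x)=\lambda^{3/2}u(\lambda x)$ for $\lambda>0$. Assumptions on $\rho:\mathbb{R}^3\to\mathbb{R}$: (A1) $\rho\in L^{6/5}(\mathbb{R}^3)\cap L^q_{loc}(\mathbb{R}^3)$ for some $q>3$, $x\cdot\nabla\rho\in L^{6/5}(\mathbb{R}^3)$, $x\cdot(D^2\rho(x)x)\in L^{6/5}(\mathbb{R}^3)$, where $D^2\rho$ is the Hessian matrix of $\rho$. (A2) $\rho\ge0$, $\rho\not\equiv0$. Functionals: $S_0(u)=\frac1{8\pi|x|}*|u|^2$, $D(u)=\frac14\int_{\mathbb{R}^3}S_0(u)|u|^2\,dx$,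 $E_1(u)=-\frac14\int_{\mathbb{R}^3}S_0(u)\rho\,dx$, $E_2(u)=\frac12\int_{\mathbb{R}^3}S_0(u)\,x\cdot\nabla\rho\,dx$, $$I(u)=\tfrac12\|\nabla u\|_2^2+\tfrac\omega2\|u\|_2^2-\tfrac1{p+1}\|u\|_{p+1}^{p+1}+e^2D(u)+2e^2E_1(u),$$ $$Q(u)=\|\nabla u\|_2^2-\tfrac{3(p-1)}{2(p+1)}\|u\|_{p+1}^{p+1}+e^2D(u)-4e^2E_1(u)+e^2E_2(u),$$ $$J(u)=\tfrac32\|\nabla u\|_2^2+\tfrac\omega2\|u\|_2^2-\tfrac{2p-1}{p+1}\|u\|_{p+1}^{p+1}+3e^2D(u)-2e^2E_1(u)+e^2E_2(u).$$ The constant $\delta^*$: it is the constant provided by the following lemma, proved beforehand. Suppose $\frac73<p<5$ and let $u\in H^1(\mathbb{R}^3,\mathbb{C})\setminus\{0\}$ satisfy $J(u)\le0$. Then there exists $\lambda^*=\lambda^*_{e,\rho}\in(0,1]$ such that $J(u^{\lambda^*})=0$. Moreover there exist $\rho_0>0$ and $\delta^*\in(0,1)$ independent of $e$, $\rho$ such that if $e^2\left(\|\rho\|_{6/5}+\|x\cdot\nabla\rho\|_{6/5}\right)\le\rho_0$, it holds that $\lambda^*\ge\delta^*$. *)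

(* Defs.v *)
From HB Require Import structures.
From mathcomp Require Import all_boot all_order all_algebra.
From mathcomp Require Import complex.
From mathcomp Require Import all_classical all_reals all_analysis.

Set Implicit Arguments.
Unset Strict Implicit.
Unset Printing Implicit Defensive.
Import Order.TTheory GRing.Theory Num.Theory.
Import numFieldNormedType.Exports.

Local Open Scope classical_set_scope.
Local Open Scope ring_scope.
Local Open Scope complex_scope.

(* [measurableTypeR R] is [R] with its Borel sigma-algebra; the product carries
   both the product sigma-algebra and the product normed-module structure. *)
Notation R3 R :=
  (measurableTypeR R * measurableTypeR R * measurableTypeR R)%type.

Section Space.
Context {R : realType}.
Implicit Types (x : R3 R) (f g phi rho : R3 R -> R) (i j : 'I_3).

Definition leb3 : {measure set (R3 R) -> \bar R} :=
  ((@lebesgue_measure R \x @lebesgue_measure R) \x @lebesgue_measure R)%E.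

Definition xcoord i x : R :=
  match val i with 0%N => x.1.1 | 1%N => x.1.2 | _ => x.2 end.

Definition basis i : R3 R :=
  ((val i == 0%N)%:R, (val i == 1%N)%:R, (val i == 2%N)%:R).

(* The library norm `|x| on a product is the maximum norm, hence: *)
Definition eucl x : R := Num.sqrt (\sum_(i < 3) xcoord i x ^+ 2).

Definition Lnormr (q : R) f : R := fine ('N[leb3]_(q%:E)[EFin \o f])%E.

Definition Lq (q : R) f : Prop := f \in Lfun leb3 q%:E.

Definition Lq_loc (q : R) f : Prop :=
  measurable_fun setT f /\
  forall K : set (R3 R), compact K -> Lq q (f \* \1_K).

Definition pd i phi : R3 R -> R := 'D_(basis i) phi.

(* C^oo: every iterated partial derivative is (Frechet) differentiable
   everywhere. *)
Definition smooth phi : Prop :=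
  forall (s : seq 'I_3) x, differentiable (foldr pd phi s) x.

Definition test_function phi : Prop :=
  smooth phi /\ compact (closure [set x | phi x != 0]).

(* Distributions, as functionals on test functions. *)
Definition distr : Type := (R3 R -> R) -> R.

Definition distr_of f : distr := fun phi => \int[leb3]_x (f x * phi x).

Definition distr_pd i (T : distr) : distr := fun phi => - T (pd i phi).

Definition distr_mulx i (T : distr) : distr :=
  fun phi => T (fun x => xcoord i x * phi x).

Definition represents f (T : distr) : Prop :=
  forall phi, test_function phi -> T phi = distr_of f phi.

Definition xgrad_distr rho : distr := fun phi =>
  \sum_(i < 3) distr_mulx i (distr_pd i (distr_of rho)) phi.

Definition xHessx_distr rho : distr := fun phi =>
  \sum_(i < 3) \sum_(j < 3)
    distr_mulx i (distr_mulx j (distr_pd i (distr_pd j (distr_of rho)))) phi.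

Definition is_xgrad rho g : Prop :=
  Lq (6 / 5) g /\ represents g (xgrad_distr rho).
Definition is_xHessx rho g : Prop :=
  Lq (6 / 5) g /\ represents g (xHessx_distr rho).

(* Unique up to a null set when they exist in L^(6/5), and the zero function
   otherwise. *)
Definition xgrad rho : R3 R -> R := xget (fun=> 0) [set g | is_xgrad rho g].
Definition xHessx rho : R3 R -> R := xget (fun=> 0) [set g | is_xHessx rho g].

Definition A1 rho : Prop :=
  [/\ Lq (6 / 5) rho,
      exists2 q, 3 < q & Lq_loc q rho,
      exists g, is_xgrad rho g &
      exists g, is_xHessx rho g].

Definition A2 rho : Prop :=
  {ae leb3, forall x, 0 <= rho x} /\ ~ {ae leb3, forall x, rho x = 0}.

End Space.

Section Sobolev.
Context {R : realType}.
Implicit Types (u g : R3 R -> R[i]) (i : 'I_3).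

Definition cabs u : R3 R -> R := fun x => Normc.normc (u x).

Definition reC u : R3 R -> R := fun x => complex.Re (u x).
Definition imC u : R3 R -> R := fun x => complex.Im (u x).

Definition L2C u : Prop := Lq 2 (reC u) /\ Lq 2 (imC u).

Definition ae_zero u : Prop := {ae leb3, forall x, u x = 0}.

(* Real and imaginary parts suffice: complex test functions split likewise. *)
Definition is_wpd i u g : Prop :=
  [/\ L2C g,
      represents (reC g) (distr_pd i (distr_of (reC u))) &
      represents (imC g) (distr_pd i (distr_of (imC u)))].

Definition wpd i u : R3 R -> R[i] := xget (fun=> 0) [set g | is_wpd i u g].

Definition H1 u : Prop := L2C u /\ forall i, exists g, is_wpd i u g.

Definition grad_abs u : R3 R -> R :=
  fun x => Num.sqrt (\sum_(i < 3) cabs (wpd i u) x ^+ 2).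

Definition LnormC (q : R) u : R := Lnormr q (cabs u).
Definition grad2 u : R := Lnormr 2 (grad_abs u).
Definition H1norm2 u : R := grad2 u ^+ 2 + LnormC 2 u ^+ 2.

Definition scale (l : R) u : R3 R -> R[i] :=
  fun x => (l `^ (3 / 2))%:C * u (l *: x).

End Sobolev.

Section Functionals.
Context {R : realType}.
Variables (p omega e : R) (rho : R3 R -> R).
Implicit Types (u : R3 R -> R[i]) (l : R).

Definition S0 u (x : R3 R) : R :=
  \int[leb3]_y (cabs u y ^+ 2 / (8 * pi * eucl (x - y))).

Definition Dfun u : R := 4^-1 * \int[leb3]_x (S0 u x * cabs u x ^+ 2).
Definition E1 u : R := - 4^-1 * \int[leb3]_x (S0 u x * rho x).
Definition E2 u : R := 2^-1 * \int[leb3]_x (S0 u x * xgrad rho x).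

Definition Ifun u : R :=
  2^-1 * grad2 u ^+ 2 + omega / 2 * LnormC 2 u ^+ 2
  - (p + 1)^-1 * LnormC (p + 1) u `^ (p + 1)
  + e ^+ 2 * Dfun u + 2 * e ^+ 2 * E1 u.

Definition Qfun u : R :=
  grad2 u ^+ 2
  - 3 * (p - 1) / (2 * (p + 1)) * LnormC (p + 1) u `^ (p + 1)
  + e ^+ 2 * Dfun u - 4 * e ^+ 2 * E1 u + e ^+ 2 * E2 u.

Definition Jfun u : R :=
  3 / 2 * grad2 u ^+ 2 + omega / 2 * LnormC 2 u ^+ 2
  - (2 * p - 1) / (p + 1) * LnormC (p + 1) u `^ (p + 1)
  + 3 * e ^+ 2 * Dfun u - 2 * e ^+ 2 * E1 u + e ^+ 2 * E2 u.

Definition flambda u l : R := Ifun (scale l u) - l ^+ 2 / 2 * Qfun u.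

End Functionals.

(* [delta] bounds from below the zero in ]0, 1] of [l |-> J(u^l)], uniformly in
   [e] and [rho] with a small datum. It depends on [u]: a common value for all
   [u] does not exist (let t tend to infinity in t u, with e = 1 / t^2). *)
Definition is_delta_star {R : realType} (p omega : R) (u : R3 R -> R[i])
    (delta : R) : Prop :=
  0 < delta < 1 /\
  exists2 rho0 : R, 0 < rho0 &
  forall (e : R) (rho : R3 R -> R),
    0 < e -> A1 rho -> A2 rho -> Jfun p omega e rho u <= 0 ->
    exists l : R,
      [/\ 0 < l <= 1, Jfun p omega e rho (scale l u) = 0 &
          e ^+ 2 * (Lnormr (6 / 5) rho + Lnormr (6 / 5) (xgrad rho)) <= rho0 ->
          delta <= l].

(* Main.v *)
From HB Require Import structures.
Require Import Defs.
From mathcomp Require Import all_boot all_order all_algebra.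
From mathcomp Require Import complex ring lra.
From mathcomp Require Import all_classical all_reals all_analysis.
From mathcomp Require Import measurable_realfun.

(** With [t = 1/l], [W = S_0(u)], [a], [b] the integrals of [W] against [rho]
    and [x . grad rho], and [r] the integral of [W(y)] against
    [rho(t y) - rho(y) - (t - 1) (y . grad rho)(y)], scaling gives
    [f(l) - f(1) = - [(l^2)^k - 1 - k (l^2 - 1)] |u|_{p+1}^{p+1} / (p + 1)
      - e^2 (1 - l)^2 D(u) / 2 + e^2 X] with [k = 3 (p - 1) / 4] in [(1, 3)] and
    [X = - a/2 (t - l)^2 - b/2 (t^2 (t - 1) + (l^2 - 1)/2) - t^2/2 r].
    The bracket is at least a multiple of [(1 - l)^2] by a Bernoulli inequality.

    To see that [r = O((t - 1)^2)], integrate along dilations: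
    [rho(t y) - rho(y)] is the integral over [s] in [[1, t]] of
    [(x . grad rho)(s y) / s] for almost every [y], and the same holds for
    [x . grad rho], whose radial derivative is
    [x . grad rho + x . (D^2 rho x)]. As the derivatives are distributional,
    both are obtained by testing and the du Bois-Reymond lemma.

    All integrals are controlled by
    [int S_0(u) |psi| <= C |psi|_{6/5} |u|_{H^1}^2]. Here
    [|u|^2 <= 2 int_line (|u|^2 + |grad u|^2)] on almost every line, so the
    Loomis-Whitney inequality bounds [|u|^2] in [L^{3/2}], and
    [1/|x| = k_1 + k_2] with [k_1] in [L^2] and [k_2] in [L^6]; Young's
    inequality for three functions then gives the pairing after
    normalization. *)

Set Implicit Arguments.
Unset Strict Implicit.
Unset Printing Implicit Defensive.
Import Order.TTheory GRing.Theory Num.Theory.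
Import numFieldNormedType.Exports.
Local Open Scope classical_set_scope.
Local Open Scope ring_scope.

(** * Lebesgue measure on R^3 *)

(** [Q(u)] is the derivative of [I(u^l)] at [l = 1], so subtracting [l^2 Q(u) / 2] removes the
    first-order part there: the gradient terms cancel, and each coefficient that remains has a
    double zero at [l = 1]. The only use of [l >= delta] is [1/l <= 1/delta], which bounds the
    powers of [t] and puts [delta^-4] into [C2]. The obstacle is that [rho] has no pointwise
    derivatives: [x . grad rho] and [x . (D^2 rho x)] are functions known only through test
    functions, so the integral of [S_0(u)] against [rho(t y)] has no immediate Taylor formula in
    [t]. After a change of variables the dilation acts on the test function as [s^-3 phi(y/s)],
    where ordinary calculus applies. The second order comes from using the same first-order identity
    twice, the second time for [x . grad rho], so that no Hessian is ever evaluated. Integrals that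
    may be infinite have the default value 0. The scaling laws of the [L^(p+1)] norm and of [D(u)]
    hold with this convention, and [D(u)] enters the final estimate by its sign only; finiteness is
    proved for the pairings with [rho], where integrals are split. *)

Section ProductSigmaFinite.
Context d1 d2 (T1 : measurableType d1) (T2 : measurableType d2) (R : realType).
Local Open Scope ereal_scope.

Lemma product_sigma_finite (m1 : {sigma_finite_measure set T1 -> \bar R})
    (m2 : {sigma_finite_measure set T2 -> \bar R}) :
  sigma_finite setT (m1 \x m2).
Proof.
have /sigma_finiteP[F [TF ndF Foo]] := sigma_finiteT m1.
have /sigma_finiteP[G [TG ndG Goo]] := sigma_finiteT m2.
exists (fun n => F n `*` G n); last first.
  move=> k; have [? ?] := Foo k; have [? ?] := Goo k.
  split; first exact: measurableX.
  by rewrite product_measure1E// lte_mul_pinfty// ge0_fin_numE.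
rewrite eqEsubset; split => // -[x y] _.
have [n _ Fnx] : (\bigcup_i F i) x by rewrite -TF.
have [k _ Gky] : (\bigcup_i G i) y by rewrite -TG.
exists (maxn n k) => //; split => /=.
- by move: x Fnx; exact/subsetPset/ndF/leq_maxl.
- by move: y Gky; exact/subsetPset/ndG/leq_maxr.
Qed.
End ProductSigmaFinite.

Section Lebesgue23.
Context {R : realType}.
Local Open Scope ereal_scope.
Local Notation mu := (@lebesgue_measure R).
Local Notation M := (measurableTypeR R).

(** Named copies of the product measures, to which the sigma-finiteness required by Tonelli's
    theorem can be attached; [lebp3] is convertible with [leb3]. *)
Definition lebp2 : set (M * M)%type -> \bar R := mu \x mu.
HB.instance Definition _ := Measure.on lebp2.
HB.instance Definition _ := Measure_isSigmaFinite.Build _ _ _ lebp2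
  (product_sigma_finite mu mu).

Definition lebp3 : set (R3 R) -> \bar R := lebp2 \x mu.
HB.instance Definition _ := Measure.on lebp3.
HB.instance Definition _ := Measure_isSigmaFinite.Build _ _ _ lebp3
  (product_sigma_finite lebp2 mu).

Lemma integral_leb3 D (f : R3 R -> \bar R) :
  \int[leb3]_(x in D) f x = \int[lebp3]_(x in D) f x.
Proof. by []. Qed.

Lemma measurable_R3 d (T : measurableType d) (f g h : T -> M) :
  measurable_fun setT f -> measurable_fun setT g -> measurable_fun setT h ->
  measurable_fun setT (fun t => (f t, g t, h t) : R3 R).
Proof.
by move=> mf mg mh; do 2 (apply/measurable_fun_pairP; split => //).
Qed.

Lemma measurable_x0 : measurable_fun setT (fun x : R3 R => x.1.1 : M).
Proof. exact: (measurableT_comp measurable_fst measurable_fst). Qed.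
Lemma measurable_x1 : measurable_fun setT (fun x : R3 R => x.1.2 : M).
Proof. exact: (measurableT_comp measurable_snd measurable_fst). Qed.
Lemma measurable_x2 : measurable_fun setT (fun x : R3 R => x.2 : M).
Proof. exact: measurable_snd. Qed.

Lemma measurable_R3Z (c : R) : measurable_fun setT (fun x : R3 R => (c *: x)%R : R3 R).
Proof.
apply: measurable_R3; apply: measurable_funM => //.
- exact: measurable_x0.
- exact: measurable_x1.
Qed.

Lemma measurable_R3_comb d (T : measurableType d) (c : T -> R) (f g : T -> R3 R) :
  measurable_fun setT c -> measurable_fun setT f -> measurable_fun setT g ->
  measurable_fun setT (fun t => (c t *: f t + g t)%R : R3 R).
Proof.
move=> mc mf mg.
apply: measurable_R3; apply: measurable_funD; try apply: measurable_funM => //.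
- exact: (measurableT_comp measurable_x0 mf).
- exact: (measurableT_comp measurable_x0 mg).
- exact: (measurableT_comp measurable_x1 mf).
- exact: (measurableT_comp measurable_x1 mg).
- exact: (measurableT_comp measurable_x2 mf).
- exact: (measurableT_comp measurable_x2 mg).
Qed.

(** The image of [mu] under [x -> c x + d], multiplied by [c], agrees with [mu] on half-open
    intervals and is therefore [mu]; the rest is the transfer formula for image measures. *)
Lemma ge0_integral_affine1 (c d : R) (f : R -> \bar R) : (0 < c)%R ->
  measurable_fun setT f -> (forall x, 0 <= f x) ->
  \int[mu]_x f (c * x + d)%R = (c^-1)%:E * \int[mu]_x f x.
Proof.
move=> c0 mf f0.
pose phi : M -> M := fun x => (c * x + d)%R.
have mphi : measurable_fun setT phi.
  by apply: measurable_funD => //; apply: measurable_funM.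
have c0' : (0 <= c^-1)%R by rewrite invr_ge0 ltW.
have H A : measurable A ->
    mscale (NngNum (ltW c0)) (pushforward mu phi) A = mu A.
  move=> mA; apply/esym/lebesgue_measure_unique => //= _ [[a b]] _ <-.
  rewrite /mscale/= /pushforward/=.
  have -> : phi @^-1` `]a, b]%classic = `]((a - d) / c)%R, ((b - d) / c)%R]%classic.
    apply/seteqP; split => x /=; rewrite !in_itv/= /phi ltr_pdivrMr // ler_pdivlMr // -lerBrDr -ltrBlDr; by rewrite (mulrC c).
  rewrite !lebesgue_measure_itv/= !lte_fin ltr_pM2r ?invr_gt0// ltrD2r.
  case: ifP => _; last by rewrite mule0.
  rewrite -!EFinB -EFinM; congr (_%:E); field; lra.
rewrite -[in RHS](@eq_measure_integral _ _ _ setT mu (mscale (NngNum (ltW c0)) (pushforward mu phi))); last first.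
  by move=> A mA _; exact: H.
rewrite ge0_integral_mscale// ge0_integral_pushforward //=.
by rewrite muleA -EFinM mulVf ?gt_eqF// mul1e.
Qed.

Lemma tonelli3 (f : R3 R -> \bar R) : measurable_fun setT f ->
  (forall x, 0 <= f x) ->
  \int[leb3]_x f x = \int[mu]_x0 \int[mu]_x1 \int[mu]_x2 f (x0, x1, x2).
Proof.
move=> mf f0; rewrite integral_leb3 (@fubini_tonelli1 _ _ _ _ _ lebp2 mu) //.
rewrite (@fubini_tonelli1 _ _ _ _ _ mu mu) //.
- exact: measurable_fun_fubini_tonelli_F.
- by move=> x; apply: integral_ge0.
Qed.

Lemma ge0_integral_affine3 (c : R) (d : R3 R) (f : R3 R -> \bar R) : (0 < c)%R ->
  measurable_fun setT f -> (forall x, 0 <= f x) ->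
  \int[leb3]_x f (c *: x + d)%R = ((c ^+ 3)^-1)%:E * \int[leb3]_x f x.
Proof.
move=> c0 mf f0.
have mA : measurable_fun setT (fun x : R3 R => (c *: x + d)%R : R3 R).
  exact: measurable_R3_comb.
rewrite !tonelli3//; last exact: (measurableT_comp mf mA).
have mf2 : measurable_fun setT (fun z : M * M => \int[mu]_x2 f (z.1, z.2, x2)).
  apply: (@measurable_fun_fubini_tonelli_F _ _ _ _ _ mu (fun z : (M * M) * M => f (z.1.1, z.1.2, z.2))) => //.
  apply: (measurableT_comp mf); apply: measurable_R3; [exact: measurable_x0|exact: measurable_x1|exact: measurable_x2].
have mf1 : measurable_fun setT (fun z : M => \int[mu]_x1 \int[mu]_x2 f (z, x1, x2)).
  apply: (@measurable_fun_fubini_tonelli_F _ _ _ _ _ mu (fun z : (M * M) =>  \int[mu]_x2 f (z.1, z.2, x2))) => //.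
  by move=> x; apply: integral_ge0.
have c1 : 0 <= (c^-1)%:E by rewrite lee_fin invr_ge0 ltW.
have cN0 : (c != 0)%R by rewrite gt_eqF.
transitivity (\int[mu]_x0 ((c^-1)%:E * \int[mu]_x1 ((c^-1)%:E *
    \int[mu]_x2 f (c * x0 + d.1.1, x1, x2)%R))).
  apply: eq_integral => x0 _.
  transitivity (\int[mu]_x1 ((c^-1)%:E * \int[mu]_x2 f (c * x0 + d.1.1, c * x1 + d.1.2, x2)%R)).
    apply: eq_integral => x1 _.
    rewrite -(@ge0_integral_affine1 c d.2 (fun x2 => f (_, _, x2))) //.
    exact: (measurable_fun_pair2).
  rewrite -(@ge0_integral_affine1 c d.1.2 (fun x1 => (c^-1)%:E * \int[mu]_x2 f ((c * x0 + d.1.1)%R, x1, x2))) //.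
    apply: measurable_funeM.
    exact: (@measurable_fun_pair2 _ _ _ _ _ _ (fun z : M * M => \int[mu]_x2 f (z.1, z.2, x2))).
  by move=> x; rewrite mule_ge0// integral_ge0.
pose g x0 := \int[mu]_x1 \int[mu]_x2 f (x0, x1, x2).
have g0 x : 0 <= g x by do 2! apply: integral_ge0 => *.
transitivity (\int[mu]_x0 ((c^-1 * c^-1)%:E * g (c * x0 + d.1.1)%R)).
  apply: eq_integral => x0 _.
  rewrite ge0_integralZl_EFin ?EFinM ?muleA//; first last.
  - exact: (@measurable_fun_pair2 _ _ _ _ _ _ (fun z : M * M => \int[mu]_x2 f (z.1, z.2, x2))).
  - by move=> x _; rewrite integral_ge0.
rewrite ge0_integralZl_EFin; first last.
- by rewrite mulr_ge0// invr_ge0 ltW.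
- have mh : measurable_fun setT (fun x : M => (c * x + d.1.1)%R : M).
    by apply: measurable_funD => //; apply: measurable_funM.
  exact: (measurableT_comp mf1 mh).
- by move=> x _; exact: g0.
- exact: measurableT.
rewrite ge0_integral_affine1// muleA -!EFinM; congr (_%:E * _).
by field.
Qed.

End Lebesgue23.

(** * Smooth functions and test functions *)

Section Smooth.
Context {R : realType}.
Local Notation M := (measurableTypeR R).
Implicit Types (f g : R3 R -> R) (x y d : R3 R) (c : R) (i j : 'I_3) (p : {poly R}).

Lemma is_diff_xcoord i x : is_diff x (xcoord i : R3 R -> R) (xcoord i).
Proof.
case: i => -[|[|[|//]]] hi.
- have -> : xcoord (Ordinal hi) = (fst : R * R -> R) \o (fst : (R * R) * R -> R * R) by [].
  by apply: is_diff_comp; apply: DiffDef; [apply: linear_differentiable|apply: diff_lin| apply: linear_differentiable|apply: diff_lin]; move=> z; exact: cvg_fst.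
- have -> : xcoord (Ordinal hi) = (snd : R * R -> R) \o (fst : (R * R) * R -> R * R) by [].
  by apply: is_diff_comp; apply: DiffDef; [apply: linear_differentiable|apply: diff_lin| apply: linear_differentiable|apply: diff_lin]; move=> z; try exact: cvg_fst; exact: cvg_snd.
- have -> : xcoord (Ordinal hi) = (snd : (R * R) * R -> R) by [].
  by apply: DiffDef; [apply: linear_differentiable|apply: diff_lin]; move=> z; exact: cvg_snd.
Qed.

Lemma xcoord_basis i j : xcoord i (Defs.basis j) = (i == j)%:R :> R.
Proof. by case: i => -[|[|[|//]]] hi; case: j => -[|[|[|//]]] hj. Qed.

Lemma pd_diff i f x : differentiable f x -> pd i f x = 'd f x (Defs.basis i).
Proof. exact: deriveE. Qed.

Lemma pdD i f g x : differentiable f x -> differentiable g x ->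
  pd i (fun y => f y + g y) x = pd i f x + pd i g x.
Proof. by move=> df dg; rewrite /pd deriveD//; exact: diff_derivable. Qed.

Lemma pdM i f g x : differentiable f x -> differentiable g x ->
  pd i (fun y => f y * g y) x = f x * pd i g x + g x * pd i f x.
Proof. by move=> df dg; rewrite /pd deriveM//; exact: diff_derivable. Qed.

Lemma pdC i c x : pd i (fun=> c) x = 0.
Proof. exact: derive_cst. Qed.

Lemma pd_xcoord i j x : pd i (xcoord j) x = (j == i)%:R.
Proof.
have H := is_diff_xcoord j x.
by rewrite pd_diff// diff_val xcoord_basis.
Qed.

Lemma is_diff_affine c d x : is_diff x (fun y => c *: y + d) (fun y => c *: y).
Proof.
have -> : (fun y => c *: y + d) = ( *:%R c) \+ cst d by [].
apply: is_diff_eq; by rewrite addr0.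
Qed.

Lemma differentiable_affine f c d x : differentiable f (c *: x + d) ->
  differentiable (fun y => f (c *: y + d)) x.
Proof.
move=> df; have H := is_diff_affine c d x.
exact: (differentiable_comp (f := fun y => c *: y + d) ex_diff df).
Qed.

Lemma pd_affine i f c d x : differentiable f (c *: x + d) ->
  pd i (fun y => f (c *: y + d)) x = c * pd i f (c *: x + d).
Proof.
move=> df; have H := is_diff_affine c d x.
rewrite !pd_diff//; last exact: differentiable_affine.
have dA : differentiable (fun y => c *: y + d) x by exact: ex_diff.
have E := diff_comp dA df.
apply: etrans (congr1 (fun F : R3 R -> R => F (Defs.basis i)) E) _.
by rewrite /= diff_val linearZ.
Qed.

Lemma differentiable_ridge (h : R -> R) i x : derivable h (xcoord i x) 1 ->
  differentiable (fun y => h (xcoord i y)) x.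
Proof.
move=> /derivable1_diffP dh; have H := is_diff_xcoord i x.
exact: (differentiable_comp (f := xcoord i) ex_diff dh).
Qed.

Lemma pd_ridge (h : R -> R) i j x : derivable h (xcoord i x) 1 ->
  pd j (fun y => h (xcoord i y)) x = (i == j)%:R * h^`()%classic (xcoord i x).
Proof.
move=> dh; have H := is_diff_xcoord i x.
rewrite pd_diff; last exact: differentiable_ridge.
have dA : differentiable (xcoord i : R3 R -> R) x by exact: ex_diff.
have E := diff_comp dA (iffLR (derivable1_diffP _ _) dh).
apply: etrans (congr1 (fun F : R3 R -> R => F (Defs.basis j)) E) _.
by rewrite /= diff_val xcoord_basis deriv1E.
Qed.

(** Monomial by monomial, [t^i <= i! e^t] for [t >= 0]. *)
Lemma horner_expR_bound p : exists2 C : R, 0 <= C & forall t : R, 0 <= t -> `|p.[t]| <= C * expR t.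
Proof.
exists (\sum_(i < size p) `|p`_i| * i`!%:R).
  by apply: sumr_ge0 => i _; rewrite mulr_ge0.
move=> y y0; rewrite horner_coef (le_trans (ler_norm_sum _ _ _))//.
rewrite mulr_suml ler_sum// => i _; rewrite normrM -mulrA ler_wpM2l//.
rewrite ger0_norm ?exprn_ge0//.
rewrite -ler_pdivrMl ?ltr0n ?fact_gt0// mulrC.
case: i => -[|i] /= _; first by rewrite expr0 divr1; apply: le_trans (expR_ge1Dx _); rewrite lerDl.
by apply: le_trans (expR_ge1Dxn i _) => //; rewrite lerDr.
Qed.

(* [p = 1] is the standard flat function; polynomials in [1/t] close the family
   under differentiation. *)
Definition flat p (t : R) : R := if 0 < t then p.[t^-1] * expR (- t^-1) else 0.

(** With [s = 1/t] and [ds/dt = - s^2], the derivative of [p(s) e^(-s)] in [t] is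
    [s^2 (p - p')(s) e^(-s)]. *)
Definition flat_deriv p : {poly R} := 'X^2 * (p - p^`()).

(** The exponential bound for [p * 'X^2] at [1/t]. Quadratic decay makes the difference quotient at
    0 at most [C |h|], hence the derivative 0 there. *)
Lemma flat_quadratic p : exists2 C : R, 0 <= C & forall t : R, `|flat p t| <= C * t ^+ 2.
Proof.
have [C C0 HC] := horner_expR_bound (p * 'X^2); exists C => // t.
rewrite /flat; case: ifPn => t0; last by rewrite normr0 mulr_ge0// sqr_ge0.
have ti0 : 0 <= t^-1 by rewrite invr_ge0 ltW.
have := HC _ ti0; rewrite hornerM hornerXn normrM (@ger0_norm _ (_ ^+ 2)) ?exprn_ge0//.
move=> H; rewrite normrM (@ger0_norm _ (expR _)) ?expR_ge0// expRN.
rewrite ler_pdivrMr ?expR_gt0// mulrAC -ler_pdivrMr ?exprn_gt0//.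
by rewrite -exprVn.
Qed.

Lemma is_derive_flat p (t : R) : is_derive t (1:R) (flat p) (flat (flat_deriv p) t).
Proof.
have [t0|t0|t0] := ltgtP t 0.
- apply: (@near_eq_is_derive R R R (cst 0)).
    near=> s; rewrite /flat ifF//; apply/negbTE; rewrite -leNgt ltW//.
    by near: s; exact: lt_nbhsl.
  by rewrite /flat ifF; [exact: is_derive_cst|rewrite ltNge ltW].
- apply: (@near_eq_is_derive R R R (fun s => p.[s^-1] * expR (- s^-1))).
    near=> s; rewrite /flat ifT//.
    by near: s; exact: lt_nbhsr.
  have tN0 : t != 0 by rewrite gt_eqF.
  have dV : is_derive t 1 (fun s : R => s^-1) (- t ^- 2 *: 1).
    exact: (@is_deriveV _ id).
  have d1 := @is_derive1_comp _ (horner p) (fun s : R => s^-1) t _ _ _ dV.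
  have dN : is_derive t 1 (fun s : R => - s^-1) (- (- t ^- 2 *: 1)).
    exact: is_deriveN.
  have d2 := @is_derive1_comp _ expR (fun s : R => - s^-1) t _ _ _ dN.
  have d3 := @is_deriveM _ _ _ _ _ _ _ _ (d1 _ _) (d2 _ _).
  apply: is_derive_eq (d3 _ _ _ _) _.
  rewrite /flat t0 /flat_deriv hornerM hornerXn hornerD hornerN /=.
  rewrite -exprVn.
  rewrite /GRing.scale/=; ring.
- rewrite t0 (_ : flat _ 0 = 0); last by rewrite /flat ltxx.
  have [C C0 HC] := flat_quadratic p.
  have H : (fun h : R => h^-1 *: ((flat p \o shift 0) (h *: 1) - flat p 0)) @ 0^' --> (0 : R).
    apply/cvgr0Pnorm_le => e e0; near=> h.
    have hN0 : h != 0 by near: h; exact: nbhs_dnbhs_neq.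
    rewrite /= addr0 [h *: 1]mulr1 (_ : flat p 0 = 0) ?subr0; last by rewrite /flat ltxx.
    rewrite normrZ normfV mulrC ler_pdivrMr ?normr_gt0//.
    rewrite (le_trans (HC h))// -real_normK ?num_real// expr2 mulrA ler_wpM2r//.
    have He : `|h| <= e / (C + 1).
      near: h; apply: dnbhs0_le; rewrite divr_gt0//; lra.
    rewrite (le_trans (ler_wpM2l C0 He))// mulrCA -[leRHS]mulr1 ler_wpM2l ?(ltW e0)//.
    rewrite ler_pdivrMr; lra.
  apply: DeriveDef; first by apply/cvg_ex; exists 0.
  exact/cvg_lim.
Unshelve. all: by end_near. Qed.

Lemma derive1_flat p : (flat p)^`()%classic = flat (flat_deriv p).
Proof. by apply/funext => t; rewrite derive1E; apply: derive_val; exact: is_derive_flat. Qed.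

(** A class of differentiable functions that is stable under partial derivatives. As [smooth] ranges
    over all sequences of partial derivatives, membership yields smoothness by induction on the
    sequence, without a Leibniz formula of higher order. *)
Inductive smooth_alg : (R3 R -> R) -> Prop :=
| sa_smooth f : smooth f -> smooth_alg f
| sa_cst c : smooth_alg (fun=> c)
| sa_xcoord i : smooth_alg (xcoord i)
| sa_flat p i : smooth_alg (fun x => flat p (xcoord i x))
| sa_add f g : smooth_alg f -> smooth_alg g -> smooth_alg (fun x => f x + g x)
| sa_mul f g : smooth_alg f -> smooth_alg g -> smooth_alg (fun x => f x * g x)
| sa_affine f c d : smooth_alg f -> smooth_alg (fun x => f (c *: x + d)).

Lemma smooth_pd i f : smooth f -> smooth (pd i f).
Proof. by move=> sf s x; have := sf (rcons s i) x; rewrite foldr_rcons. Qed.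

Lemma smooth_differentiable f : smooth f -> forall x, differentiable f x.
Proof. by move=> sf x; exact: (sf [::] x). Qed.

Lemma smooth_alg_pd f : smooth_alg f ->
  (forall x, differentiable f x) /\ (forall i, smooth_alg (pd i f)).
Proof.
elim=> {f} [f sf|c|i|p i|f g _ [df Hf] _ [dg Hg]|f g sf [df Hf] sg [dg Hg]|f c d _ [df Hf]].
- split; first exact: smooth_differentiable.
  by move=> i; apply: sa_smooth; exact: smooth_pd.
- split=> [x|i]; first exact: differentiable_cst.
  rewrite (_ : pd i _ = fun=> 0); first exact: sa_cst.
  by apply/funext => x; rewrite pdC.
- split=> [x|j]; first by have H := is_diff_xcoord i x; exact: ex_diff.
  rewrite (_ : pd j _ = fun=> (i == j)%:R); first exact: sa_cst.
  by apply/funext => x; rewrite pd_xcoord.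
- have dp (t : R) : derivable (flat p) t 1 by apply: ex_derive; exact: is_derive_flat.
  split=> [x|j]; first exact: differentiable_ridge.
  rewrite (_ : pd j _ = fun x => (i == j)%:R * flat (flat_deriv p) (xcoord i x)).
    by apply: sa_mul; [exact: sa_cst|exact: sa_flat].
  by apply/funext => x; rewrite pd_ridge// derive1_flat.
- split=> [x|i]; first exact: differentiableD.
  rewrite (_ : pd i _ = fun x => pd i f x + pd i g x); first exact: sa_add.
  by apply/funext => x; rewrite pdD.
- split=> [x|i]; first exact: differentiableM.
  rewrite (_ : pd i _ = fun x => f x * pd i g x + g x * pd i f x).
    by apply: sa_add; exact: sa_mul.
  by apply/funext => x; rewrite pdM.
- split=> [x|i]; first exact: differentiable_affine.
  rewrite (_ : pd i _ = fun x => c * pd i f (c *: x + d)).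
    by apply: sa_mul; [exact: sa_cst|exact: sa_affine].
  by apply/funext => x; rewrite pd_affine.
Qed.

Lemma smooth_algP f : smooth_alg f -> smooth f.
Proof.
move=> sf s; elim/last_ind: s f sf => [|s i IH] f sf x.
  exact: (smooth_alg_pd sf).1.
by rewrite foldr_rcons; apply: IH; exact: (smooth_alg_pd sf).2.
Qed.

End Smooth.

(** * Cubes, test functions and measurability of continuous functions *)

Section TestFunctions.
Context {R : realType}.
Local Notation mu := (@lebesgue_measure R).
Local Notation M := (measurableTypeR R).
Implicit Types (f g phi : R3 R -> R) (x y d : R3 R) (c K B t : R) (i j : 'I_3).

Lemma R3_normE x : `|x| = Num.max (Num.max `|x.1.1| `|x.1.2|) `|x.2|.
Proof. by rewrite !prod_normE. Qed.

Lemma R3_norm_le x K :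
  (`|x| <= K) = [&& `|x.1.1| <= K, `|x.1.2| <= K & `|x.2| <= K].
Proof. by rewrite R3_normE !ge_max andbA. Qed.

Lemma xcoord_norm_le i x : `|xcoord i x| <= `|x|.
Proof.
have := lexx `|x|; rewrite {1}R3_norm_le => /and3P[h0 h1 h2].
by case: i => -[|[|[|//]]] hi.
Qed.

Definition cube K : set (R3 R) := [set x | `|x| <= K].

Lemma cubeE K : cube K = `[-K, K]%classic `*` `[-K, K]%classic `*` `[-K, K]%classic.
Proof.
apply/seteqP; split => [x|x]; rewrite /cube/= R3_norm_le !in_itv/= !ler_norml.
  by case/and3P.
by case=> -[-> ->] ->.
Qed.

Lemma measurable_cube K : measurable (cube K).
Proof. by rewrite cubeE; do 2 apply: measurableX => //; exact: measurable_itv. Qed.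

Lemma leb3_cube_lty K : (leb3 (cube K) < +oo)%E.
Proof.
rewrite cubeE.
set I : set M := `[-K, K]%classic.
have mI : measurable I by exact: measurable_itv.
have -> : leb3 (I `*` I `*` I) = (mu I * mu I * mu I)%E.
  transitivity (lebp2 (I `*` I) * mu I)%E.
    by apply: (@product_measure1E _ _ _ _ _ lebp2 mu) => //; exact: measurableX.
  by congr (_ * _)%E; exact: product_measure1E.
rewrite lebesgue_measure_itv/=; case: ifP => _; last by rewrite mule0 ltry.
by rewrite -EFinB -!EFinM ltry.
Qed.

Lemma compact_cube K : compact (cube K).
Proof.
rewrite cubeE; apply: (@compact_setX (R * R)%type R); last exact: segment_compact.
by apply: (@compact_setX R R); exact: segment_compact.
Qed.

Lemma closed_cube K : closed (cube K).
Proof. apply: compact_closed; [exact: norm_hausdorff|exact: compact_cube]. Qed.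

Lemma test_functionP f : test_function f <->
  smooth f /\ exists K, forall x, K < `|x| -> f x = 0.
Proof.
split=> -[sf].
  move=> /compact_bounded[N [_ HN]]; split=> //; exists (N + 1) => x xN.
  apply/eqP; apply: contraTT xN => fx0; rewrite -leNgt.
  by apply: HN; [rewrite ltrDl|exact: subset_closure].
move=> [K HK]; split => //.
apply: (subclosed_compact _ (compact_cube (K := K))); first exact: closed_closure.
rewrite (closure_id (cube K)).1; last exact: closed_cube.
apply: closureS => x /= fx0.
by rewrite /cube/= leNgt; apply: contra fx0 => /HK ->.
Qed.

Lemma test_bounded f : test_function f ->
  exists K B, [/\ 0 <= K, 0 <= B & forall x, `|f x| <= B * \1_(cube K) x].
Proof.
move=> /test_functionP[sf [K HK]].
have cf : continuous f.
  by move=> x; apply: differentiable_continuous; exact: smooth_differentiable.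
have /compact_bounded[N [_ HN]] : compact (f @` cube `|K|).
  by apply: continuous_compact; [exact: continuous_subspaceT|exact: compact_cube].
exists `|K|, (`|N| + 1); split => // x.
rewrite indicE; have [xK|xK] := boolP (x \in cube `|K|).
  rewrite mulr1; apply: HN; last by exists x => //; exact/set_mem.
  by rewrite (le_lt_trans (ler_norm N))// ltrDl.
rewrite HK ?normr0 ?mulr0//.
rewrite (le_lt_trans (ler_norm K))// ltNge; apply: contra xK => h.
exact/mem_set.
Qed.

(** The source carries the product sigma-algebra, while continuity speaks of open sets. Rounding the
    coordinates down to the grid of step [1/(n+1)] gives functions that are constant on countably
    many measurable cells and converge to [f] pointwise. *)
Lemma continuous_measurable_R3 f : continuous f -> measurable_fun setT f.
Proof.
move=> cf.
pose e n (t : R) : R := n.+1%:R^-1 * (Num.floor (n.+1%:R * t))%:~R.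
have eP n t : `|t - e n t| <= n.+1%:R^-1.
  have n0 : (0 : R) < n.+1%:R by rewrite ltr0n.
  have -> : t - e n t = n.+1%:R^-1 * (n.+1%:R * t - (Num.floor (n.+1%:R * t))%:~R).
    by rewrite /e mulrBr mulKf// gt_eqF.
  have /andP[h1] := floor_itv (n.+1%:R * t); rewrite intrD mulr1z => h2.
  have ni : (0 : R) <= n.+1%:R^-1 by rewrite invr_ge0 ltW.
  rewrite normrM (ger0_norm ni) -[leRHS]mulr1 ler_wpM2l//.
  by rewrite ler_norml; apply/andP; split; lra.
apply: (@measurable_fun_cvg _ _ _ _ (fun n x => f (e n x.1.1, e n x.1.2, e n x.2))).
  move=> n _ Y mY; rewrite setTI.
  (* The grid cell with integer label [abc], kept when the value at its corner lies in [Y]. *)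
  pose F (abc : int * int * int) : set (R3 R) :=
    if f (n.+1%:R^-1 * abc.1.1%:~R, n.+1%:R^-1 * abc.1.2%:~R, n.+1%:R^-1 * abc.2%:~R) \in Y then
    [set x | Num.floor (n.+1%:R * x.1.1) = abc.1.1] `&`
    [set x | Num.floor (n.+1%:R * x.1.2) = abc.1.2] `&`
    [set x | Num.floor (n.+1%:R * x.2) = abc.2] else set0.
  have -> : (fun x => f (e n x.1.1, e n x.1.2, e n x.2)) @^-1` Y = \bigcup_abc F abc.
    apply/seteqP; split => [x /= Yx|x [[[a b] k] _]]; rewrite /F/=.
      exists (Num.floor (n.+1%:R * x.1.1), Num.floor (n.+1%:R * x.1.2), Num.floor (n.+1%:R * x.2)) => //=.
      by rewrite ifT//; exact/mem_set.
    by case: ifPn => [/set_mem + [[/= h1 h2] h3]|//]; rewrite /= /e h1 h2 h3.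
  apply: countable_bigcupT_measurable => // -[[a b] k].
  rewrite /F/=; case: ifPn => // _.
  have mfl (z : int) : measurable ([set t | Num.floor (n.+1%:R * t) = z] : set M).
    pose h (t : R) : R := n.+1%:R * t.
    have E : [set t | Num.floor (h t) = z] = h @^-1` `[z%:~R, (z + 1)%:~R[%classic.
      apply/seteqP; split => t /=; rewrite in_itv/= => H; first by rewrite -H floor_itv.
      by apply/eqP; rewrite floor_eq.
    rewrite -[X in measurable X]setTI; have := @mulrl_measurable R setT n.+1%:R measurableT
      _ (measurable_itv `[z%:~R, (z + 1)%:~R[).
    by rewrite -E.
  apply: measurableI; [apply: measurableI|].
  - by have := measurable_x0 measurableT (mfl a); rewrite setTI.
  - by have := measurable_x1 measurableT (mfl b); rewrite setTI.
  - by have := measurable_x2 measurableT (mfl k); rewrite setTI.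
move=> x _.
apply: (@cvg_comp _ _ _ (fun n => (e n x.1.1, e n x.1.2, e n x.2) : R3 R) f _ (nbhs x)); last exact: cf.
apply/cvgrPdist_le => eps eps0; near=> n.
rewrite R3_norm_le/=.
have hn : n.+1%:R^-1 <= eps.
  by apply: ltW; near: n; exact: (near_infty_natSinv_lt (PosNum eps0)).
by rewrite !(le_trans (eP _ _) hn).
Unshelve. all: by end_near. Qed.

End TestFunctions.

(** * Products and sums of test functions; local integrability *)

Section LocallyIntegrable.
Context {R : realType}.
Local Notation mu := (@lebesgue_measure R).
Local Notation M := (measurableTypeR R).
Implicit Types (f g phi : R3 R -> R) (x y d a b : R3 R) (c K B : R) (i j : 'I_3).

Lemma smooth_continuous f : smooth f -> continuous f.
Proof. by move=> sf x; apply: differentiable_continuous; exact: smooth_differentiable. Qed.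

Lemma test_measurable f : test_function f -> measurable_fun setT f.
Proof. by move=> [sf _]; apply: continuous_measurable_R3; exact: smooth_continuous. Qed.

Lemma test_mul f g : smooth f -> test_function g -> test_function (fun x => f x * g x).
Proof.
move=> sf /test_functionP[sg [K HK]]; apply/test_functionP; split.
  by apply: smooth_algP; apply: sa_mul; exact: sa_smooth.
by exists K => x /HK ->; rewrite mulr0.
Qed.

Lemma test_mulx i g : test_function g -> test_function (fun x => xcoord i x * g x).
Proof. by apply: test_mul; apply: smooth_algP; exact: sa_xcoord. Qed.

Lemma test_scale c g : test_function g -> test_function (fun x => c * g x).
Proof. by apply: test_mul; apply: smooth_algP; exact: sa_cst. Qed.

Lemma test_add f g : test_function f -> test_function g -> test_function (fun x => f x + g x).
Proof.
move=> /test_functionP[sf [K HK]] /test_functionP[sg [L HL]]; apply/test_functionP; split.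
  by apply: smooth_algP; apply: sa_add; exact: sa_smooth.
by exists (Num.max K L) => x; rewrite gt_max => /andP[/HK -> /HL ->]; rewrite addr0.
Qed.

Lemma test0 : test_function (fun=> 0 : R).
Proof.
apply/test_functionP; split; first by apply: smooth_algP; exact: sa_cst.
by exists 0.
Qed.

Lemma test_sum n (F : 'I_n -> R3 R -> R) : (forall k, test_function (F k)) ->
  test_function (fun x => \sum_(k < n) F k x).
Proof.
elim: n F => [|n IH] F HF.
  by under eq_fun do rewrite big_ord0; exact: test0.
under eq_fun do rewrite big_ord_recr/=.
by apply: test_add => //; exact: IH.
Qed.

Lemma test_pd i f : test_function f -> test_function (pd i f).
Proof.
move=> /test_functionP[sf [K HK]]; apply/test_functionP; split.
  exact: smooth_pd.
exists K => x xK.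
have oK : open (~` cube K) by rewrite openC; exact: closed_cube.
rewrite -(@pdC _ i 0 x) /pd.
apply: near_eq_derive.
have : nbhs x (~` cube K).
  by apply: open_nbhs_nbhs; split => //; rewrite /cube/= => /(lt_le_trans xK); rewrite ltxx.
apply: filterS => y Hy; apply: HK; rewrite ltNge; apply/negP; exact: Hy.
Qed.

Lemma test_affine f c d : 0 < c -> test_function f -> test_function (fun x => f (c *: x + d)).
Proof.
move=> c0 /test_functionP[sf [K HK]]; apply/test_functionP; split.
  by apply: smooth_algP; apply: sa_affine; exact: sa_smooth.
exists ((K + `|d|) / c) => x; rewrite ltr_pdivrMr// => h; apply: HK.
rewrite -(ltrD2r `|d|); apply: (lt_le_trans h); rewrite mulrC.
rewrite -[c in leLHS](ger0_norm (ltW c0)) -normrZ -{1}(addrK d (c *: x)).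
exact: ler_normB.
Qed.

Definition locint f : Prop :=
  measurable_fun setT f /\ forall K, leb3.-integrable (cube K) (EFin \o f).

Lemma locint_integrable f g K B : locint f -> measurable_fun setT g ->
  (forall x, `|g x| <= B * \1_(cube K) x) ->
  leb3.-integrable setT (EFin \o (fun x => f x * g x)).
Proof.
move=> [mf If] mg Hg.
have : leb3.-integrable setT (fun x => B%:E * ((EFin \o f) \_ (cube K)) x)%E.
  apply: integrableZl => //; apply/integrable_restrict => //.
    exact: measurable_cube.
  by rewrite setTI.
apply: le_integrable => //=.
  by apply/measurable_EFinP; exact: measurable_funM.
move=> x _; rewrite /patch; have := Hg x; rewrite indicE.
case: ifPn => _ /=; rewrite ?mulr1 ?mulr0 => H; last first.
  by rewrite lee_fin (_ : g x = 0) ?mulr0 ?mule0 ?normr0//; apply/eqP; rewrite -normr_le0.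
rewrite lee_fin !normrM mulrC ler_wpM2r//.
by rewrite (le_trans H)// ler_norm.
Qed.

Lemma locint_test f phi : locint f -> test_function phi ->
  leb3.-integrable setT (EFin \o (fun x => f x * phi x)).
Proof.
move=> lf tphi; have [K [B [_ _ H]]] := test_bounded tphi.
exact: locint_integrable (test_measurable tphi) H.
Qed.

Lemma locintD f g : locint f -> locint g -> locint (fun x => f x + g x).
Proof.
move=> [mf If] [mg Ig]; split; first exact: measurable_funD.
move=> K; have mK := measurable_cube K.
by apply: eq_integrable (integrableD mK (If K) (Ig K)).
Qed.

Lemma locintZ c f : locint f -> locint (fun x => c * f x).
Proof.
move=> [mf If]; split; first exact: measurable_funM.
move=> K; have mK := measurable_cube K.
by apply: eq_integrable (integrableZl mK c (If K)).
Qed.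

Lemma locintB f g : locint f -> locint g -> locint (fun x => f x - g x).
Proof.
move=> lf lg; have := locintD lf (locintZ (-1) lg).
by congr locint; apply/funext => x; rewrite mulN1r.
Qed.

Lemma Lq_measurable q f : Lq q f -> measurable_fun setT f.
Proof. by rewrite /Lq inE => /andP[/[!inE]]. Qed.

Lemma Lq_integrable q f : 1 <= q -> Lq q f ->
  leb3.-integrable setT (fun x => (`|f x| `^ q)%:E).
Proof. exact: Lfun_integrable. Qed.

(** Cubes have finite measure and [|f| <= 1 + |f|^q]. *)
Lemma Lq_locint q f : 1 <= q -> Lq q f -> locint f.
Proof.
move=> q1 lf; have mf := Lq_measurable lf; split => // K.
have mK := measurable_cube K.
have I1 : leb3.-integrable (cube K) (cst 1%:E).
  apply/integrableP; split; first exact: measurable_cst.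
  under eq_integral do rewrite /= normr1.
  by rewrite integral_cst// mul1e leb3_cube_lty.
have I2 : leb3.-integrable (cube K) (fun x => (`|f x| `^ q)%:E).
  by apply: (@integrableS _ _ _ _ setT) => //; exact: Lq_integrable.
apply: le_integrable (integrableD mK I1 I2) => //.
  by apply/measurable_EFinP; exact: measurable_funTS.
move=> x _; rewrite -[leRHS]/((`|1 + `|f x| `^ q|)%:E) lee_fin [leRHS]ger0_norm ?addr_ge0 ?powR_ge0//.
have [f1|f1] := leP `|f x| 1; first by rewrite (le_trans f1)// lerDl powR_ge0.
rewrite (le_trans (le1r_powR (ltW f1) q1))//.
by rewrite lerDr.
Qed.

End LocallyIntegrable.

(** * The du Bois-Reymond lemma *)

Section DuBoisReymond.
Context {R : realType}.
Local Notation mu := (@lebesgue_measure R).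
Local Notation M := (measurableTypeR R).
Implicit Types (f g phi : R3 R -> R) (x y d a b : R3 R) (c K B : R) (i j : 'I_3).

Definition box a b : set (R3 R) :=
  [set x | forall i, xcoord i a < xcoord i x <= xcoord i b].

Lemma forall_ord3 (P : 'I_3 -> Prop) :
  P ord0 -> P (lift ord0 ord0) -> P ord_max -> forall i, P i.
Proof.
move=> P0 P1 P2 [[|[|[|//]]] hi].
- by rewrite (_ : Ordinal hi = ord0)//; exact: val_inj.
- by rewrite (_ : Ordinal hi = lift ord0 ord0)//; exact: val_inj.
- by rewrite (_ : Ordinal hi = ord_max)//; exact: val_inj.
Qed.

Lemma boxE a b : box a b = `]a.1.1, b.1.1]%classic `*` `]a.1.2, b.1.2]%classic `*` `]a.2, b.2]%classic.
Proof.
apply/seteqP; split => x /=; rewrite /box/= !in_itv/=.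
  by move=> H; split; [split|]; [exact: (H ord0)|exact: (H (lift ord0 ord0))|exact: (H ord_max)].
by move=> [[H0 H1] H2]; apply: forall_ord3.
Qed.

Lemma measurable_box a b : measurable (box a b).
Proof. by rewrite boxE; do 2 apply: measurableX => //; exact: measurable_itv. Qed.

Definition boxes : set (set (R3 R)) := [set B | exists a b, B = box a b].

Lemma boxI a b a' b' : box a b `&` box a' b' =
  box (Num.max a.1.1 a'.1.1, Num.max a.1.2 a'.1.2, Num.max a.2 a'.2)
      (Num.min b.1.1 b'.1.1, Num.min b.1.2 b'.1.2, Num.min b.2 b'.2).
Proof.
apply/seteqP; split => x.
  move=> [H H'] i; move: (H i) (H' i) => /andP[h1 h2] /andP[h3 h4].
  by move: i h1 h2 h3 h4; apply: forall_ord3 => h1 h2 h3 h4; apply/andP; rewrite gt_max le_min;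
    split; apply/andP.
move=> H; split=> i; move: (H i); move: i; apply: forall_ord3;
  by rewrite /xcoord/= gt_max le_min => /andP[/andP[h1 h2] /andP[h3 h4]]; rewrite ?h1 ?h2 ?h3 ?h4.
Qed.

(** For the sigma-algebra generated by boxes each coordinate is measurable, because the slab
    [u < x_i <= v] is the union of the boxes whose other sides are []-n, n]]; hence the identity
    into the product is measurable. *)
Lemma R3_measurable_boxes : @measurable _ (R3 R) = <<s boxes>>.
Proof.
apply/seteqP; split; last first.
  apply: smallest_sub; first exact: sigma_algebra_measurable.
  by move=> _ [a [b ->]]; exact: measurable_box.
pose T := g_sigma_algebraType boxes.
have mx i : measurable_fun setT (xcoord i : T -> M).
  apply: (@measurability _ _ T M setT _ (R.-ocitv).-measurable) => // _ [_ [[u v] _ <-] <-].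
  rewrite setTI.
  (* The point with [i]-th coordinate [w] and the two other coordinates [z]. *)
  pose e w z : R3 R := (if i == ord0 then w else z,
    if i == lift ord0 ord0 then w else z, if i == ord_max then w else z).
  have eE w z j : xcoord j (e w z) = if i == j then w else z.
    by move: j; apply: forall_ord3.
  pose F n := box (e u (- n%:R)) (e v n%:R).
  have -> : xcoord i @^-1` [set` `]u, v]] = \bigcup_n F n.
    apply/seteqP; split => [x|x [n _]]; rewrite /= in_itv/=.
      move=> Hx; exists (Num.truncn `|x|).+1 => // j; rewrite !eE.
      case: eqP => [<-//|_].
      have : `|xcoord j x| < (Num.truncn `|x|).+1%:R.
        by rewrite (le_lt_trans (xcoord_norm_le j x))// truncnS_gt.
      by rewrite ltr_norml => /andP[-> /ltW ->].
    by move=> /(_ i); rewrite !eE eqxx.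
  apply: bigcup_measurable => n _; apply: sub_sigma_algebra; rewrite /F.
  by do 2 eexists.
have mid : measurable_fun setT (fun x : T => x : R3 R).
  have := measurable_R3 (mx ord0) (mx (lift ord0 ord0)) (mx ord_max).
  by congr measurable_fun; apply/funext => -[[]].
by move=> A mA; have := mid measurableT A mA; rewrite setTI.
Qed.

Lemma flat1_ge0 (t : R) : 0 <= flat 1 t.
Proof. by rewrite /flat; case: ifP => // _; rewrite hornerC mul1r expR_ge0. Qed.

Lemma flat1_le1 (t : R) : flat 1 t <= 1.
Proof.
rewrite /flat; case: ifP => // t0; rewrite hornerC mul1r -expR0 ler_expR oppr_le0 invr_ge0.
exact: ltW.
Qed.

Lemma flat1_cvg (u : R^nat) : u @ \oo --> +oo -> flat 1 (u n) @[n --> \oo] --> (1 : R).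
Proof.
move=> uoo.
have H : expR (- (u n)^-1) @[n --> \oo] --> (1 : R).
  rewrite -expR0; apply: continuous_cvg; first exact: continuous_expR.
  rewrite -oppr0; apply: cvgN.
  by apply: (iffRL (gtr0_cvgV0 _)) => //; exact: cvgry_gt uoo 0.
apply: cvg_trans H; apply: near_eq_cvg; near=> n.
rewrite /flat ifT ?hornerC ?mul1r//.
by near: n; exact: cvgry_gt uoo 0.
Unshelve. all: by end_near. Qed.

(* Smooth functions in [0, 1] that tend to the indicator of ]s, t]. *)
Definition bump (s t : R) n (r : R) : R :=
  flat 1 (n%:R * (r - s)) * flat 1 (n%:R ^+ 2 * (t - r) + n%:R).

Lemma bump_ge0 s t n r : 0 <= bump s t n r.
Proof. by rewrite mulr_ge0// flat1_ge0. Qed.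

Lemma bump_le1 s t n r : bump s t n r <= 1.
Proof. by rewrite -[leRHS]mulr1 ler_pM// ?flat1_ge0// flat1_le1. Qed.

(** The second factor requires [n (t - r) + 1 > 0], that is [r < t + 1/n]. For [n = 0] both
    arguments are 0 and the function vanishes identically. *)
Lemma bump_supp s t n r : bump s t n r != 0 -> s < r < t + 1.
Proof.
rewrite mulf_eq0 negb_or => /andP[].
rewrite /flat; case: ifPn => [h1 _|]; last by rewrite eqxx.
case: ifPn => [h2 _|]; last by rewrite eqxx.
have n0 : (0 : R) <= n%:R by [].
have n1 : n%:R = 0 :> R \/ (1 : R) <= n%:R.
  by case: n {h1 h2 n0} => [|n]; [left|right; rewrite ler1n].
by case: n1 => [n1|n1]; [move: h1; rewrite n1 mul0r ltxx|apply/andP; split; nra].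
Qed.

(** The summand [n] keeps the second argument at least [n] for all [r <= t], the closed endpoint
    included, whereas the term [n^2 (t - r)] prevails when [r > t]. *)
Lemma bump_cvg s t r : bump s t n r @[n --> \oo] --> ((s < r <= t)%R%:R : R).
Proof.
have noo : (n%:R : R) @[n --> \oo] --> +oo by exact: cvgr_idn.
have Moo (k : R) : 0 < k -> (n%:R * k : R) @[n --> \oo] --> +oo.
  move=> k0; apply/cvgryPge => A; have /cvgryPge/(_ (A / k)) := noo.
  by apply: filterS => n; rewrite ler_pdivrMr.
have Z : (fun=> 0 : R) @ \oo --> (0 : R) by exact: cvg_cst.
have [sr|rs] := ltP s r; last first.
  apply: cvg_trans Z; apply: near_eq_cvg; near=> n.
  by rewrite /bump {1}/flat ifF ?mul0r//; apply/negbTE; rewrite -leNgt mulr_ge0_le0// subr_le0.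
have H1 : flat 1 (n%:R * (r - s)) @[n --> \oo] --> (1 : R).
  by apply: flat1_cvg; apply: Moo; rewrite subr_gt0.
have [rt|tr] := leP r t; last first.
  apply: cvg_trans Z; apply: near_eq_cvg; near=> n.
  rewrite /bump [X in _ * X]/flat ifF ?mulr0//; apply/negbTE; rewrite -leNgt.
  have h : 1 < n%:R * (r - t) by near: n; apply: cvgry_gt; apply: Moo; rewrite subr_gt0.
  have n0 : (0 : R) <= n%:R by [].
  nra.
rewrite -[X in _ --> X]mulr1; apply: cvgM => //.
apply: flat1_cvg; apply: ger_cvgy noo; near=> n.
by rewrite lerDr mulr_ge0// subr_ge0.
Unshelve. all: by end_near. Qed.

Definition bump3 a b n x : R :=
  bump a.1.1 b.1.1 n x.1.1 * bump a.1.2 b.1.2 n x.1.2 * bump a.2 b.2 n x.2.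

Lemma xcoord_affine i c x d : xcoord i (c *: x + d) = c * xcoord i x + xcoord i d.
Proof. by move: i; apply: forall_ord3. Qed.

Lemma xcoord_diag i (s : R) : xcoord i ((s, s, s) : R3 R) = s.
Proof. by move: i; apply: forall_ord3. Qed.

Lemma smooth_bump i (s t : R) n : smooth_alg (fun x => bump s t n (xcoord i x)).
Proof.
apply: sa_mul.
  (* The translation vector lies on the diagonal, so its [i]-th coordinate is the same for every
     [i]. *)
  have := sa_affine n%:R (- (n%:R * s), - (n%:R * s), - (n%:R * s)) (sa_flat 1 i).
  congr smooth_alg; apply/funext => x; congr flat.
  by rewrite xcoord_affine xcoord_diag mulrBr.
pose k : R := n%:R ^+ 2 * t + n%:R.
have := sa_affine (- n%:R ^+ 2) (k, k, k) (sa_flat 1 i).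
congr smooth_alg; apply/funext => x; congr flat.
by rewrite xcoord_affine xcoord_diag /k; ring.
Qed.

Lemma bump3_ge0 a b n x : 0 <= bump3 a b n x.
Proof. by apply: mulr_ge0; [apply: mulr_ge0|]; exact: bump_ge0. Qed.

Lemma bump3_le a b n x : bump3 a b n x <= \1_(cube (`|a| + `|b| + 1)) x.
Proof.
rewrite indicE; have [_|xK] := boolP (x \in _).
  have h (u v : R) : 0 <= u <= 1 -> 0 <= v <= 1 -> 0 <= u * v <= 1.
    by move=> /andP[? ?] /andP[? ?]; rewrite mulr_ge0//= mulr_ile1.
  have hb s t r : 0 <= bump s t n r <= 1 by rewrite bump_ge0 bump_le1.
  by have /andP[] := h _ _ (h _ _ (hb a.1.1 b.1.1 x.1.1) (hb a.1.2 b.1.2 x.1.2)) (hb a.2 b.2 x.2).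
rewrite le_eqVlt; apply/orP; left; apply: contraR xK.
rewrite /bump3 mulf_eq0 negb_or => /andP[+ /bump_supp h2].
rewrite mulf_eq0 negb_or => /andP[/bump_supp h0 /bump_supp h1].
apply/mem_set; rewrite /cube/= R3_norm_le.
have Ha := lexx `|a|; have Hb := lexx `|b|.
move: Ha Hb; rewrite {1}R3_norm_le {1}(R3_norm_le b) !ler_norml.
move=> /and3P[/andP[a0 a0'] /andP[a1 a1'] /andP[a2 a2']].
move=> /and3P[/andP[b0 b0'] /andP[b1 b1'] /andP[b2 b2']].
have na := normr_ge0 a; have nb := normr_ge0 b.
by apply/and3P; split; apply/andP; split; lra.
Qed.

Lemma test_bump3 a b n : test_function (bump3 a b n).
Proof.
apply/test_functionP; split.
  apply: smooth_algP; apply: sa_mul; first apply: sa_mul.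
  - exact: (smooth_bump ord0).
  - exact: (smooth_bump (lift ord0 ord0)).
  - exact: (smooth_bump ord_max).
exists (`|a| + `|b| + 1) => x xK; apply/eqP; rewrite eq_le bump3_ge0 andbT.
rewrite (le_trans (bump3_le _ _ _ _))// indicE memNset//.
by rewrite /cube/= => /(lt_le_trans xK); rewrite ltxx.
Qed.

Lemma bump3_cvg a b x : bump3 a b n x @[n --> \oo] --> (\1_(box a b) x : R).
Proof.
have -> : \1_(box a b) x = (a.1.1 < x.1.1 <= b.1.1)%R%:R * (a.1.2 < x.1.2 <= b.1.2)%R%:R * (a.2 < x.2 <= b.2)%R%:R :> R.
  rewrite boxE -!natrM !mulnb indicE; congr (_%:R); congr nat_of_bool.
  by apply/idP/idP => [/set_mem/= [[]]|H]; rewrite ?in_itv/=; [move=> -> -> ->|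
    apply/mem_set => /=; rewrite !in_itv/=; case/andP: H => /andP[]].
by apply: cvgM; [apply: cvgM|]; exact: bump_cvg.
Qed.

(** Dominated convergence along [bump3]: all these test functions lie below the indicator of one
    cube, on which [f] is integrable. *)
Lemma box_integral0 f : locint f ->
  (forall phi, test_function phi -> \int[leb3]_x (f x * phi x) = 0) ->
  forall a b, (\int[leb3]_(x in box a b) (f x)%:E = 0)%E.
Proof.
move=> lf Hf a b; have [mf _] := lf.
pose g x := (`|f x * \1_(cube (`|a| + `|b| + 1)) x|)%:E.
pose F n x := (f x * bump3 a b n x)%:E.
have mI (A : set (R3 R)) : measurable A -> measurable_fun setT (\1_A : R3 R -> R) by exact: measurable_indic.
have [_ _] : [/\ leb3.-integrable setT (fun x => (f x * \1_(box a b) x)%:E),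
   [sequence (\int[leb3]_x (`|F n x - (f x * \1_(box a b) x)%:E|))%E]_n @ \oo --> 0%E &
   [sequence (\int[leb3]_x F n x)%E]_n @ \oo --> (\int[leb3]_x (f x * \1_(box a b) x)%:E)%E].
  apply: (@dominated_convergence _ _ _ leb3 setT measurableT F _ g).
  - move=> n; apply/measurable_EFinP; apply: measurable_funM => //.
    exact: test_measurable (test_bump3 a b n).
  - by apply/measurable_EFinP; apply: measurable_funM => //; apply: mI; exact: measurable_box.
  - apply: aeW => x _; apply: cvg_EFin; first exact: nearW.
    by apply: cvgM; [exact: cvg_cst|exact: bump3_cvg].
  - apply: integrable_norm; apply: (@locint_integrable _ f _ (`|a| + `|b| + 1) 1) => //.
      by apply: mI; exact: measurable_cube.
    by move=> x; rewrite mul1r ger0_norm.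
  - apply: aeW => x n _; rewrite /F /g /= lee_fin normrM [leRHS]normrM ler_wpM2l//.
    by rewrite (ger0_norm (bump3_ge0 _ _ _ _)) (@ger0_norm _ (\1_ _ _))// bump3_le.
have -> : [sequence (\int[leb3]_x F n x)%E]_n = cst 0%E.
  apply/funext => n /=.
  have := Hf _ (test_bump3 a b n); rewrite /Rintegral.
  move/(congr1 (@EFin R)); rewrite fineK//.
  by apply: integrable_fin_num => //; exact: locint_test (test_bump3 a b n).
move=> /(cvg_unique _ (cvg_cst _)) => /(_ (@ereal_hausdorff R)) => E.
rewrite integral_mkcond [RHS]E; apply: eq_integral => x _.
by rewrite /patch indicE; case: ifP; rewrite ?mulr1 ?mulr0.
Qed.

(** On the cube [Q n], [f] integrates to 0 over every box. The measurable sets with this property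
    form a Dynkin class, complements being allowed because the truncated function is integrable with
    total integral 0; as boxes are stable under intersection and generate, it contains every
    measurable set. Thus [f = 0] almost everywhere on each [Q n]. *)
Lemma du_bois_reymond f : locint f ->
  (forall phi, test_function phi -> \int[leb3]_x (f x * phi x) = 0) ->
  {ae leb3, forall x, f x = 0}.
Proof.
move=> lf Hf; have [mf _] := lf.
pose Q n : set (R3 R) := box (- n%:R, - n%:R, - n%:R) (n%:R, n%:R, n%:R).
pose g n x := (f x * \1_(Q n) x)%:E.
have mQ n : measurable (Q n) by exact: measurable_box.
have Ig n : leb3.-integrable setT (g n).
  have mI : measurable_fun setT (\1_(Q n) : R3 R -> R) by exact: measurable_indic.
  apply: (@locint_integrable _ f _ n%:R 1) => //.
  move=> x; rewrite mul1r ger0_norm// !indicE ler_nat.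
  case: (boolP (x \in Q n)) => //= /set_mem; rewrite /Q boxE/= !in_itv/= => -[[h0 h1] h2].
  rewrite mem_set// /cube/= R3_norm_le !ler_norml.
  by move: h0 h1 h2 => /andP[/ltW-> ->] /andP[/ltW-> ->] /andP[/ltW-> ->].
have gA n A : measurable A -> (\int[leb3]_(x in A) g n x = 0)%E.
  have gT : (\int[leb3]_x g n x = 0)%E.
    transitivity (\int[leb3]_(x in Q n) (f x)%:E)%E; last exact: box_integral0.
    rewrite [RHS]integral_mkcond; apply: eq_integral => x _.
    by rewrite /g /patch indicE; case: ifP; rewrite ?mulr1 ?mulr0.
  rewrite R3_measurable_boxes; move: A.
  apply: (dynkin_induction R3_measurable_boxes).
  - by move=> _ _ [a [b ->]] [a' [b' ->]]; rewrite boxI; do 2 eexists.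
  - exact: gT.
  - move=> _ [a [b ->]].
    transitivity (\int[leb3]_(x in box a b `&` Q n) (f x)%:E)%E; last by rewrite boxI box_integral0.
    rewrite [RHS]integral_mkcondr; apply: eq_integral => x _.
    by rewrite /g /patch indicE; case: ifP; rewrite ?mulr1 ?mulr0.
  - move=> S mS S0; have := gT; rewrite -(setUv S) integral_setU//.
    + by rewrite S0 add0e.
    + exact: measurableC.
    + by rewrite setUv; exact: measurable_int (Ig n).
    + exact/disj_setPCl.
  - move=> F mF tF F0; rewrite integral_bigcup//; last first.
      by apply: integrableS (Ig n) => //; exact: bigcupT_measurable.

    by rewrite eseries0.
have ae0 n : {ae leb3, forall x, g n x = 0%E}.
  have := integral_ae_eq measurableT (Ig n) (measurable_cst (0 : \bar R)%E).
  move=> H; have {H} := H _.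
  suff HE E : E `<=` setT -> measurable E -> (\int[leb3]_(x in E) g n x = \int[leb3]_(x in E) cst 0%R x)%E.
    by move=> /(_ HE); apply: filterS => x; exact.
  by move=> _ mE; rewrite gA// integral0.
have := ae_foralln ae0.
apply: filterS => x H; have := H (Num.truncn `|x|).+1.
rewrite /g indicE mem_set ?mulr1; first by case.
rewrite /Q boxE/= !in_itv/=.
have := truncnS_gt `|x|; set N : R := _%:R => hN.
have hc i : - N < xcoord i x <= N.
  have : `|xcoord i x| < N by rewrite (le_lt_trans (xcoord_norm_le i x)).
  by rewrite ltr_norml => /andP[-> /ltW ->].
by split; [split|]; [exact: (hc ord0)|exact: (hc (lift ord0 ord0))|exact: (hc ord_max)].
Qed.

End DuBoisReymond.

(** * Integration along dilations and translations *)

Section FubiniRintegral.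
Context d1 d2 (T1 : measurableType d1) (T2 : measurableType d2) (R : realType).
Variable m1 : {sigma_finite_measure set T1 -> \bar R}.
Variable m2 : {sigma_finite_measure set T2 -> \bar R}.
Variable f : T1 * T2 -> R.
Hypothesis If : (m1 \x m2)%E.-integrable setT (EFin \o f).

(** Real-valued inner integrals are 0 where the section is not integrable, which happens only on a
    null set; this is what carries Fubini's theorem over to real-valued integrals. *)
Lemma Fubini_fine1 : ae_eq m1 setT (fun x => (\int[m2]_y f (x, y))%:E)
  (fun x => \int[m2]_y (f (x, y))%:E)%E.
Proof.
have := ae_integrable1 If; apply: filterS => x /= Ix _.
by rewrite /Rintegral fineK//; exact: integrable_fin_num.
Qed.

Lemma Fubini_fine2 : ae_eq m2 setT (fun y => (\int[m1]_x f (x, y))%:E)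
  (fun y => \int[m1]_x (f (x, y))%:E)%E.
Proof.
have := ae_integrable2 If; apply: filterS => x /= Ix _.
by rewrite /Rintegral fineK//; exact: integrable_fin_num.
Qed.

Lemma measurable_fine_F : measurable_fun setT (fun x => \int[m2]_y f (x, y)).
Proof.
apply: (measurableT_comp (@fine_measurable R setT measurableT)).
exact: (measurable_fubini_F If).
Qed.

Lemma measurable_fine_G : measurable_fun setT (fun y => \int[m1]_x f (x, y)).
Proof.
apply: (measurableT_comp (@fine_measurable R setT measurableT)).
exact: (measurable_fubini_G If).
Qed.

Lemma integrable_fine_G : m2.-integrable setT (EFin \o (fun y => \int[m1]_x f (x, y))).
Proof.
apply/integrableP; split; first by apply/measurable_EFinP; exact: measurable_fine_G.
have mf : measurable_fun setT (EFin \o f) := measurable_int _ If.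
have := (integrable21ltyP m1 m2 mf).1 If; apply: le_lt_trans.
apply: ae_ge0_le_integral => //.
- by apply: measurableT_comp => //; apply/measurable_EFinP; exact: measurable_fine_G.
- by move=> y _; exact: integral_ge0.
- apply: (@measurable_fun_fubini_tonelli_G _ _ _ _ _ m1 (abse \o (EFin \o f))) => //.
    exact: measurableT_comp.
  by move=> z; exact: abse_ge0.
have := Fubini_fine2; have := ae_integrable2 If; apply: filterS2 => y Iy H _ /=.
rewrite -[leLHS]/(`|(\int[m1]_x f (x, y))%:E|)%E H//.
by apply: le_abse_integral => //; exact: measurable_int Iy.
Qed.

Lemma Fubini_Rintegral :
  \int[m1]_x \int[m2]_y f (x, y) = \int[m2]_y \int[m1]_x f (x, y).
Proof.
rewrite /Rintegral; congr fine.
transitivity (\int[m1]_x \int[m2]_y (f (x, y))%:E)%E.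
  apply: ae_eq_integral => //.
  - by apply/measurable_EFinP; exact: measurable_fine_F.
  - exact: (measurable_fubini_F If).
  - exact: Fubini_fine1.
rewrite [LHS](Fubini If); apply/esym; apply: ae_eq_integral => //.
- by apply/measurable_EFinP; exact: measurable_fine_G.
- exact: (measurable_fubini_G If).
- exact: Fubini_fine2.
Qed.

End FubiniRintegral.

Section RintegralZ.
Context d (T : measurableType d) (R : realType) (m : {measure set T -> \bar R}).

(* No integrability is needed: [fine] sends the infinite and undefined cases
   to [0] on both sides. *)
Lemma RintegralN (f : T -> R) : \int[m]_x (- f x) = - \int[m]_x f x.
Proof.
rewrite /Rintegral.
have -> : (\int[m]_x (- f x)%:E = \int[m]_x ((EFin \o f)^\- x) - \int[m]_x ((EFin \o f)^\+ x))%E.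
  rewrite integralE; congr (_ - _)%E; apply: eq_integral => x _.
    by rewrite funeposE funenegE.
  by rewrite funeposE funenegE /= opprK.
rewrite [in RHS]integralE.
have P0 : (0 <= \int[m]_x ((EFin \o f)^\+ x))%E.
  by apply: integral_ge0 => x _; exact: funepos_ge0.
have N0 : (0 <= \int[m]_x ((EFin \o f)^\- x))%E.
  by apply: integral_ge0 => x _; exact: funeneg_ge0.
move: P0 N0; move: (\int[_]_x _)%E (\int[_]_x _)%E => [p| |] [q| |] //= _ _;
  by rewrite ?oppr0 ?opprB.
Qed.

Lemma RintegralZ (k : R) (f : T -> R) : measurable_fun setT f ->
  \int[m]_x (k * f x) = k * \int[m]_x f x.
Proof.
have pos c (g : T -> R) : 0 < c -> measurable_fun setT g ->
    \int[m]_x (c * g x) = c * \int[m]_x g x.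
  move=> c0 mg; rewrite /Rintegral [in LHS]integralE [in RHS]integralE.
  have mgE : measurable_fun setT (EFin \o g) by exact/measurable_EFinP.
  have -> : (\int[m]_x ((fun x => (c * g x)%:E)^\+ x) = c%:E * \int[m]_x ((EFin \o g)^\+ x))%E.
    rewrite -ge0_integralZl_EFin ?ltW//; last exact: measurable_funepos.
    apply: eq_integral => x _; rewrite !funeposE/= -!EFin_max -EFinM.
    by rewrite (maxr_pMr _ _ (ltW c0)) mulr0.
  have -> : (\int[m]_x ((fun x => (c * g x)%:E)^\- x) = c%:E * \int[m]_x ((EFin \o g)^\- x))%E.
    rewrite -ge0_integralZl_EFin ?ltW//; last exact: measurable_funeneg.
    apply: eq_integral => x _; rewrite !funenegE/= -!EFin_max -EFinM.
    by rewrite (maxr_pMr _ _ (ltW c0)) mulr0 mulrN.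
  have P0 : (0 <= \int[m]_x ((EFin \o g)^\+ x))%E.
    by apply: integral_ge0 => x _; exact: funepos_ge0.
  have N0 : (0 <= \int[m]_x ((EFin \o g)^\- x))%E.
    by apply: integral_ge0 => x _; exact: funeneg_ge0.
  move: P0 N0; move: (\int[_]_x _)%E (\int[_]_x _)%E => [p| |] [q| |] //= _ _.
  - by rewrite mulrBr.
  - by rewrite gt0_muley ?lte_fin//= mulr0.
  - by rewrite gt0_muley ?lte_fin//= mulr0.
  - by rewrite gt0_muley ?lte_fin//= mulr0.
move=> mf; have [k0|k0|->] := ltgtP k 0.
- have := pos (- k) f; rewrite oppr_gt0 => /(_ k0 mf) H.
  apply: oppr_inj; rewrite -RintegralN -mulNr -H.
  by apply: eq_Rintegral => x _; rewrite mulNr.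
- exact: pos.
- rewrite mul0r; transitivity (\int[m]_x cst (0 : R) x).
    by apply: eq_Rintegral => x _; rewrite mul0r.
  by rewrite /Rintegral integral0.
Qed.

End RintegralZ.

Section Averages.
Context {R : realType}.
Local Notation mu := (@lebesgue_measure R).
Local Notation M := (measurableTypeR R).
Implicit Types (r f g phi : R3 R -> R) (x y a b : R3 R) (K B : R) (i j : 'I_3).

(** Positive and negative parts are transformed separately, so an infinite part produces the default
    value 0 on both sides. *)
Lemma integral_affine3 (c : R) (d : R3 R) f : 0 < c -> measurable_fun setT f ->
  \int[leb3]_x f (c *: x + d) = (c ^+ 3)^-1 * \int[leb3]_x f x.
Proof.
move=> c0 mf; rewrite /Rintegral.
have c30 : 0 < (c ^+ 3)^-1 by rewrite invr_gt0 exprn_gt0.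
have mA : measurable_fun setT (fun x : R3 R => (c *: x + d) : R3 R).
  exact: measurable_R3_comb.
have mfE : measurable_fun setT (EFin \o f) by exact/measurable_EFinP.
rewrite [in LHS]integralE [in RHS]integralE.
have mP := measurable_funepos mfE.
have mN := measurable_funeneg mfE.
have -> : (\int[leb3]_x ((fun x => (f (c *: x + d)%R)%:E)^\+ x) =
    ((c ^+ 3)^-1)%:E * \int[leb3]_x ((EFin \o f)^\+ x))%E.
  rewrite -(ge0_integral_affine3 d c0 mP)//.
  by apply: eq_integral => x _; rewrite !funeposE.
have -> : (\int[leb3]_x ((fun x => (f (c *: x + d)%R)%:E)^\- x) =
    ((c ^+ 3)^-1)%:E * \int[leb3]_x ((EFin \o f)^\- x))%E.
  rewrite -(ge0_integral_affine3 d c0 mN)//.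
  by apply: eq_integral => x _; rewrite !funenegE.
have P0 : (0 <= \int[leb3]_x ((EFin \o f)^\+ x))%E by exact: integral_ge0.
have N0 : (0 <= \int[leb3]_x ((EFin \o f)^\- x))%E by exact: integral_ge0.
move: P0 N0; move: (\int[_]_x _)%E (\int[_]_x _)%E => [p| |] [q| |] //= _ _.
- by rewrite mulrBr.
- by rewrite gt0_muley ?lte_fin//= mulr0.
- by rewrite gt0_muley ?lte_fin//= mulr0.
- by rewrite gt0_muley ?lte_fin//= mulr0.
Qed.

Section Flow.
Variables (r : R3 R -> R) (w c : R -> R) (d : R -> R3 R) (C D : R).
Hypothesis lr : locint r.
Hypothesis Iw : mu.-integrable setT (EFin \o w).
Hypothesis mc : measurable_fun setT c.
Hypothesis md : measurable_fun setT d.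
Hypothesis supp_w : forall s, w s != 0 -> [/\ 1 <= c s, c s <= C & `|d s| <= D].

Let mw : measurable_fun setT w.
Proof. by apply/measurable_EFinP; exact: measurable_int Iw. Qed.

Lemma measurable_flow :
  measurable_fun setT (fun z : M * R3 R => c z.1 *: z.2 + d z.1 : R3 R).
Proof.
apply: (@measurable_R3_comb R _ (M * R3 R)%type (fun z => c z.1) snd (fun z => d z.1)) => //.
- exact: (measurableT_comp mc measurable_fst).
- exact: (measurableT_comp md measurable_fst).
Qed.

(** Where [w] does not vanish, the affine map sends [cube K] into the fixed cube
    [cube (C * |K| + D)], and since [c s >= 1] the Jacobian factor [c(s)^-3] is at most 1. The inner
    integral is therefore bounded by a multiple of [|w s|] uniformly in [s]. *)
Lemma flow_integrable (psi : M * R3 R -> R) K B : measurable_fun setT psi ->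
  (forall s y, w s != 0 -> `|psi (s, y)| <= B * \1_(cube K) y) ->
  (mu \x lebp3)%E.-integrable setT
    (EFin \o (fun z : M * R3 R => w z.1 * (r (c z.1 *: z.2 + d z.1) * psi z))).
Proof.
move=> mpsi Hpsi; have [mr Ir] := lr.
have mz : measurable_fun setT (fun z : M * R3 R => w z.1 * (r (c z.1 *: z.2 + d z.1) * psi z)).
  apply: measurable_funM; first exact: (measurableT_comp mw measurable_fst).
  by apply: measurable_funM => //; exact: (measurableT_comp mr measurable_flow).
apply/integrableP; split; first exact/measurable_EFinP.
rewrite (@fubini_tonelli1 _ _ _ _ _ mu lebp3) //; last first.
  by apply: measurableT_comp => //; exact/measurable_EFinP.
set K' := C * `|K| + D.
pose N := (\int[leb3]_(x in cube K') `|(r x)%:E|)%E.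
have Noo : (N < +oo)%E by have /integrableP[] := Ir K'.
have N0 : (0 <= N)%E by exact: integral_ge0.
apply: (@le_lt_trans _ _ (\int[mu]_s (`|w s|%:E * (`|B|%:E * N)))%E); last first.
  rewrite ge0_integralZr//; last 2 first.
  - by apply/measurable_EFinP; exact: measurableT_comp.
  - by rewrite mule_ge0.
  have /integrableP[_ wf] := Iw.
  by rewrite lte_mul_pinfty// ?integral_ge0// ?ge0_fin_numE ?integral_ge0// lte_mul_pinfty.
apply: ge0_le_integral; [exact: measurableT| | | |].
- by move=> s _; exact: integral_ge0.
- apply: (@measurable_fun_fubini_tonelli_F _ _ _ _ _ lebp3 (fun z => `|(w z.1 * (r (c z.1 *: z.2 + d z.1) * psi z))%:E|%E)) => //.
  by apply: measurableT_comp => //; exact/measurable_EFinP.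
- by apply: emeasurable_funM => //; apply/measurable_EFinP; exact: measurableT_comp.
move=> s _; rewrite /fubini_F /=.
have [ws0|ws0] := eqVneq (w s) 0.
  rewrite ws0 normr0 mul0e.
  by under eq_integral do rewrite mul0r normr0; rewrite integral0.
have [c1 cC dD] := supp_w ws0.
have mf : measurable_fun setT (fun x => (`|r x| * \1_(cube K') x)%:E).
  apply/measurable_EFinP; apply: measurable_funM; first exact: measurableT_comp.
  by apply: measurable_indic; exact: measurable_cube.
have mA : measurable_fun setT (fun x : R3 R => (c s *: x + d s) : R3 R).
  exact: measurable_R3_comb.
have mfA := measurableT_comp mf mA.
apply: (@le_trans _ _ (\int[leb3]_x ((`|w s| * `|B|)%:E * (`|r (c s *: x + d s)| * \1_(cube K') (c s *: x + d s))%:E))%E).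
  apply: ge0_le_integral; [exact: measurableT|by []| | |].
  - apply/measurable_EFinP; apply: measurableT_comp => //.
    apply: measurable_funM => //; apply: measurable_funM.
      exact: (measurableT_comp mr mA).
    exact: (measurable_fun_pair2 s mpsi).
  - exact: measurable_funeM.
  move=> x _; rewrite lee_fin !normrM -!mulrA ler_wpM2l//.
  rewrite mulrCA ler_wpM2l//.
  apply: le_trans (Hpsi s x ws0) _; rewrite !indicE.
  have [/set_mem xK|_] := boolP (x \in cube K); last by rewrite mulr0 mulr_ge0.
  rewrite mem_set ?mulr1 ?ler_norm// /cube/= /K'.
  rewrite (le_trans (ler_normD _ _))// lerD// normrZ ger0_norm ?(le_trans _ c1)//.
  by rewrite ler_pM// ?(le_trans _ c1)// (le_trans xK)// ler_norm.
rewrite ge0_integralZl//.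
rewrite (@ge0_integral_affine3 _ (c s) (d s) (fun x => (`|r x| * \1_(cube K') x)%:E)) ?(lt_le_trans _ c1)//.
rewrite muleA EFinM -!muleA; apply: lee_wpmul2l => //; apply: lee_wpmul2l => //.
rewrite (_ : (\int[leb3]_x _)%E = N); last first.
  rewrite /N [RHS]integral_mkcond; apply: eq_integral => x _.
  by rewrite /patch indicE; case: ifP; rewrite ?mulr1 ?mulr0.
rewrite -[leRHS]mul1e; apply: lee_wpmul2r => //.
by rewrite lee_fin invf_le1 ?exprn_gt0 ?exprn_ege1 ?(lt_le_trans _ c1).
Qed.

(** The two instances are dilations, with [c = id] and [d = 0], and translations along an axis, with
    [c = 1] and [d s] a multiple of a basis vector. *)
Definition avg y : R := \int[mu]_s (w s * r (c s *: y + d s)).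

Let measurable_cube_indic K : measurable_fun setT (fun z : M * R3 R => \1_(cube K) z.2 : R).
Proof.
apply: (measurableT_comp _ measurable_snd); apply: measurable_indic.
exact: measurable_cube.
Qed.

Let avg_cube K : leb3.-integrable setT (EFin \o (fun y => avg y * \1_(cube K) y)).
Proof.
have := @flow_integrable (fun z : M * R3 R => \1_(cube K) z.2) K 1 (@measurable_cube_indic K).
have H s y : w s != 0 -> `|\1_(cube K) y : R| <= 1 * \1_(cube K) y.
  by rewrite mul1r ger0_norm.
move=> /(_ H) /integrable_fine_G.
congr (integrable _ _ (EFin \o _)); apply/funext => y.
rewrite /avg /= indicE; case: (y \in cube K).
  by rewrite mulr1; apply: eq_Rintegral => s _; rewrite mulr1.
rewrite mulr0; transitivity (\int[mu]_(s in setT) cst (0:R) s).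
  by apply: eq_Rintegral => s _ /=; rewrite !mulr0.
by rewrite Rintegral_cst// mul0r.
Qed.

Lemma locint_avg : locint avg.
Proof.
split.
  apply: (@measurable_fun_cvg _ _ _ _ (fun n y => avg y * \1_(cube n%:R) y)).
    by move=> n; apply/measurable_EFinP; exact: measurable_int (avg_cube _).
  move=> y _; apply: cvg_near_cst; near=> n.
  rewrite indicE mem_set ?mulr1//= /cube/=.
  near: n; exact: nbhs_infty_ger.
move=> K; have := avg_cube K => /(integrableS measurableT (@measurable_cube R K) (@subsetT _ _)).
apply: eq_integrable => [|y yK /=]; first exact: measurable_cube.
by rewrite indicE yK mulr1.
Unshelve. all: by end_near. Qed.

Lemma avg_test phi : test_function phi ->
  \int[leb3]_y (avg y * phi y) =
  \int[mu]_s (w s * \int[leb3]_y (r (c s *: y + d s) * phi y)).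
Proof.
move=> tphi; have [K [B [_ _ H]]] := test_bounded tphi.
have mphi := test_measurable tphi; have [mr _] := lr.
have Iz := @flow_integrable (fun z : M * R3 R => phi z.2) K B
  (measurableT_comp mphi measurable_snd) (fun s y _ => H y).
transitivity (\int[lebp3]_y \int[mu]_s (w s * (r (c s *: y + d s) * phi y))).
  apply: eq_Rintegral => y _; rewrite /avg mulrC -RintegralZ.
    by apply: eq_Rintegral => s _; ring.
  by apply: measurable_funM => //; apply: (measurableT_comp mr); exact: measurable_R3_comb.
rewrite -(Fubini_Rintegral Iz); apply: eq_Rintegral => s _ /=.
rewrite -RintegralZ//; apply: measurable_funM => //.
by apply: (measurableT_comp mr); exact: measurable_R3_comb.
Qed.

End Flow.

(** The counterpart of [avg_test] with the averaging on the test function: the flow is the identity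
    and [psi] carries the dependence on [s]. *)
Lemma test_avg r (w : R -> R) (psi : M * R3 R -> R) K B : locint r ->
  mu.-integrable setT (EFin \o w) -> measurable_fun setT psi ->
  (forall s y, w s != 0 -> `|psi (s, y)| <= B * \1_(cube K) y) ->
  \int[leb3]_y (r y * \int[mu]_s (w s * psi (s, y))) =
  \int[mu]_s (w s * \int[leb3]_y (r y * psi (s, y))).
Proof.
move=> lr Iw mpsi H; have [mr _] := lr.
have mw : measurable_fun setT w by apply/measurable_EFinP; exact: measurable_int Iw.
have H1 s : w s != 0 -> [/\ (1 : R) <= 1, (1 : R) <= 1 & `|0 : R3 R| <= 0].
  by rewrite normr0.
have Iz := @flow_integrable r w (fun=> 1) (fun=> 0) 1 0 lr Iw
  (measurable_cst _) (measurable_cst _) H1 psi K B mpsi H.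
transitivity (\int[lebp3]_y \int[mu]_s (w s * (r (1 *: y + 0) * psi (s, y)))).
  apply: eq_Rintegral => y _; rewrite -RintegralZ.
    by apply: eq_Rintegral => s _; rewrite scale1r addr0; ring.
  by apply: measurable_funM => //; exact: (measurable_fun_pair1 y mpsi).
rewrite -(Fubini_Rintegral Iz); apply: eq_Rintegral => s _ /=.
rewrite RintegralZ//; last first.
  apply: measurable_funM; last exact: (measurable_fun_pair2 s mpsi).
  by apply: (measurableT_comp mr); exact: measurable_R3_comb.
by congr (_ * _); apply: eq_Rintegral => y _; rewrite scale1r addr0.
Qed.

Lemma test_avg_integrable r (w : R -> R) (psi : M * R3 R -> R) K B : locint r ->
  mu.-integrable setT (EFin \o w) -> measurable_fun setT psi ->
  (forall s y, w s != 0 -> `|psi (s, y)| <= B * \1_(cube K) y) ->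
  leb3.-integrable setT (EFin \o (fun y => r y * \int[mu]_s (w s * psi (s, y)))).
Proof.
move=> lr Iw mpsi H; have [mr _] := lr.
have mw : measurable_fun setT w by apply/measurable_EFinP; exact: measurable_int Iw.
have H1 s : w s != 0 -> [/\ (1 : R) <= 1, (1 : R) <= 1 & `|0 : R3 R| <= 0].
  by rewrite normr0.
have := integrable_fine_G (@flow_integrable r w (fun=> 1) (fun=> 0) 1 0 lr Iw
  (measurable_cst _) (measurable_cst _) H1 psi K B mpsi H).
congr (integrable _ _ (EFin \o _)); apply/funext => y /=.
rewrite -RintegralZ.
  by apply: eq_Rintegral => s _; rewrite scale1r addr0; ring.
by apply: measurable_funM => //; exact: (measurable_fun_pair1 y mpsi).
Qed.

End Averages.

Section FTC.
Context {R : realType}.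
Local Notation mu := (@lebesgue_measure R).

Lemma FTC_Rintegral (f F : R -> R) (a b : R) : a < b ->
  (forall s : R, a <= s <= b -> is_derive s (1 : R) F (f s)) ->
  (forall s : R, a <= s <= b -> derivable f s 1) ->
  \int[mu]_s (\1_(`[a, b]%classic) s * f s) = F b - F a.
Proof.
move=> ab HF Hf.
have cF (s : R) : a <= s <= b -> {for s, continuous F}.
  move=> /HF[dF _]; apply: differentiable_continuous; exact/derivable1_diffP.
transitivity (\int[mu]_(s in `[a, b]) f s).
  rewrite [RHS]Rintegral_mkcond; apply: eq_Rintegral => s _.
  by rewrite /patch indicE; case: ifP; rewrite ?mul1r ?mul0r.
rewrite /Rintegral (@continuous_FTC2 _ f F)//.
- apply: derivable_within_continuous => s; rewrite in_itv/=; exact: Hf.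
- split.
  + move=> s; rewrite in_itv/= => /andP[h1 h2].
    by have [] := HF s _; rewrite ?(ltW h1) ?(ltW h2).
  + by apply: cvg_at_right_filter; apply: cF; rewrite lexx ltW.
  + by apply: cvg_at_left_filter; apply: cF; rewrite lexx ltW.
- move=> s; rewrite in_itv/= => /andP[h1 h2]; rewrite derive1E.
  by have [] := HF s _; rewrite ?(ltW h1) ?(ltW h2).
Qed.

Lemma integrable_itv_mul (f : R -> R) (a b : R) :
  (forall s : R, a <= s <= b -> derivable f s 1) ->
  mu.-integrable setT (EFin \o (fun s => \1_(`[a, b]%classic) s * f s)).
Proof.
move=> Hf.
have : mu.-integrable `[a, b] (EFin \o f).
  apply: continuous_compact_integrable; first exact: segment_compact.
  by apply: derivable_within_continuous => s; rewrite in_itv/=; exact: Hf.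
rewrite integrable_mkcond//; apply: eq_integrable => // s _.
by rewrite /patch /= indicE; case: ifP; rewrite ?mul1r ?mul0r.
Qed.

End FTC.

Section RintegralSum.
Context d (T : measurableType d) (R : realType) (m : {measure set T -> \bar R}).

Lemma integrable_Rsum n (F : 'I_n -> T -> R) :
  (forall k, m.-integrable setT (EFin \o F k)) ->
  m.-integrable setT (EFin \o (fun x => \sum_(k < n) F k x)).
Proof.
elim: n F => [|n IH] F IF.
  have : m.-integrable setT (EFin \o (fun=> 0 : R)) by exact: integrable0.
  by apply: eq_integrable => // x _ /=; rewrite big_ord0.
have := integrableD measurableT (IH _ (fun k => IF (widen_ord (leqnSn n) k))) (IF ord_max).
by apply: eq_integrable => // x _ /=; rewrite big_ord_recr.
Qed.

Lemma Rintegral_sum n (F : 'I_n -> T -> R) :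
  (forall k, m.-integrable setT (EFin \o F k)) ->
  \sum_(k < n) \int[m]_x F k x = \int[m]_x \sum_(k < n) F k x.
Proof.
elim: n F => [|n IH] F IF.
  rewrite big_ord0; transitivity (\int[m]_x (cst (0 : R) x)).
    by rewrite /Rintegral integral0.
  by apply: eq_Rintegral => x _; rewrite big_ord0.
rewrite big_ord_recr/= IH// -RintegralD//; last exact: integrable_Rsum.
by apply: eq_Rintegral => x _; rewrite big_ord_recr.
Qed.

End RintegralSum.

(** * Fundamental theorem of calculus for distributional derivatives *)

Section Lines.
Context {R : realType}.
Local Notation mu := (@lebesgue_measure R).
Local Notation M := (measurableTypeR R).
Implicit Types (r f g phi : R3 R -> R) (x y p v : R3 R) (K B : R) (i j : 'I_3).

Lemma R3_basis v : v = \sum_(i < 3) xcoord i v *: Defs.basis i.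
Proof.
rewrite !big_ord_recl big_ord0 /Defs.basis /=.
case: v => -[a b] c; congr (_, _, _); rewrite /xcoord /=.
all: by rewrite /GRing.scale /=; ring.
Qed.

Lemma xcoordN_basis i j : xcoord i (- Defs.basis j : R3 R) = - (i == j)%:R.
Proof. by case: i => -[|[|[|//]]] hi; case: j => -[|[|[|//]]] hj. Qed.

Lemma diff_pd phi x v : differentiable phi x ->
  'd phi x v = \sum_(i < 3) xcoord i v * pd i phi x.
Proof.
move=> dphi; rewrite {1}(R3_basis v) linear_sum; apply: eq_bigr => i _.
by rewrite linearZ pd_diff.
Qed.

Lemma is_derive_line phi p v (k : R) : differentiable phi (p + k *: v) ->
  is_derive k (1 : R) (fun s => phi (p + s *: v))
    (\sum_(i < 3) xcoord i v * pd i phi (p + k *: v)).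
Proof.
move=> dphi.
have dl : is_diff k (fun s : R => p + s *: v) ( *:%R^~ v).
  have -> : (fun s : R => p + s *: v) = cst p \+ ( *:%R^~ v) by [].
  by apply: is_diff_eq; rewrite add0r.
have dA : differentiable (fun s : R => p + s *: v) k by exact: ex_diff.
have dc : differentiable (phi \o (fun s : R => p + s *: v)) k.
  exact: differentiable_comp.
apply: DeriveDef; first exact/derivable1_diffP.
rewrite deriveE//.
have E := diff_comp dA dphi.
apply: etrans (congr1 (fun F : R -> R => F 1) E) _.
by rewrite /= diff_val scale1r diff_pd.
Qed.

(** This is [- div(x phi)], the formal adjoint of [x . grad]. *)
Definition Ldil phi : R3 R -> R := fun x => - \sum_(i < 3) pd i (fun y => xcoord i y * phi y) x.

Lemma test_Ldil phi : test_function phi -> test_function (Ldil phi).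
Proof.
move=> tphi; have : test_function (fun x => \sum_(i < 3) pd i (fun y => xcoord i y * phi y) x).
  by apply: test_sum => i; apply: test_pd; exact: test_mulx.
move=> /(test_scale (-1)); congr test_function; apply/funext => x.
by rewrite /Ldil mulN1r.
Qed.

Lemma LdilE phi x : differentiable phi x ->
  Ldil phi x = - (3 * phi x + \sum_(i < 3) xcoord i x * pd i phi x).
Proof.
move=> dphi; rewrite /Ldil; congr (- _).
rewrite (eq_bigr (fun i => xcoord i x * pd i phi x + phi x)).
  by rewrite big_split/= addrC; congr (_ + _); rewrite sumr_const card_ord mulr_natl.
move=> i _; rewrite pdM//; last by have H := is_diff_xcoord i x; exact: ex_diff.
by rewrite pd_xcoord eqxx mulr1.
Qed.

(** By a change of variables, [r(s y)] tested against [phi] is [r] tested against [s^-3 phi(y/s)].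
    Differentiating this kernel in [s] replaces differentiating [r]. *)
Lemma is_derive_dilation phi y (s : R) : (forall x, differentiable phi x) -> 0 < s ->
  is_derive s (1 : R) (fun s => (s ^+ 3)^-1 * phi (s^-1 *: y))
    ((s ^+ 4)^-1 * Ldil phi (s^-1 *: y)).
Proof.
move=> dphi s0; have sN0 : s != 0 by rewrite gt_eqF.
have dV : is_derive s (1 : R) (fun s : R => s^-1) (- s ^- 2 *: 1).
  exact: (@is_deriveV _ id).
have dl : is_derive s^-1 (1 : R) (fun k => phi (k *: y)) (\sum_(i < 3) xcoord i y * pd i phi (s^-1 *: y)).
  have := @is_derive_line phi 0 y s^-1; rewrite add0r => /(_ (dphi _)).
  by congr is_derive; apply/funext => k; rewrite add0r.
have d1 := @is_derive1_comp _ _ (fun s : R => s^-1) s _ _ dl dV.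
have d3 : is_derive s (1 : R) (fun s : R => s ^+ 3) (3 * s ^+ 2).
  by apply: is_derive_eq; rewrite /GRing.scale/=; ring.
have d3V : is_derive s (1 : R) (fun s : R => (s ^+ 3)^-1) (- (s ^+ 3) ^- 2 *: (3 * s ^+ 2)).
  by apply: is_deriveV; rewrite expf_neq0.
have d := @is_deriveM _ _ _ _ _ _ _ _ d3V d1.
apply: is_derive_eq d _; rewrite LdilE// /GRing.scale/=.
have -> : \sum_(i < 3) xcoord i (s^-1 *: y) * pd i phi (s^-1 *: y) =
    s^-1 * \sum_(i < 3) xcoord i y * pd i phi (s^-1 *: y).
  rewrite mulr_sumr; apply: eq_bigr => i _; rewrite mulrA; congr (_ * _).
  have := xcoord_affine i s^-1 y 0; rewrite addr0 => ->.
  by rewrite (_ : xcoord i 0 = 0) ?addr0//; move: i; apply: forall_ord3.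
set X := \sum_(_ < _) _; set Y := phi _.
by field.
Qed.

(** Chain rule for distributions: the inverse dilation is moved to the test function, as [chi]. *)
Lemma represents_pd_scale (c : R) u g i : 0 < c -> locint u -> locint g ->
  represents g (distr_pd i (distr_of u)) ->
  represents (fun x => c * g (c *: x)) (distr_pd i (distr_of (fun x => u (c *: x)))).
Proof.
move=> c0 [mu_ _] [mg _] Hg phi tphi; rewrite /distr_pd /distr_of.
have cN0 : c != 0 by rewrite gt_eqF.
have ci0 : 0 < c^-1 by rewrite invr_gt0.
pose chi := fun x => phi (c^-1 *: x + 0).
have tchi : test_function chi by exact: test_affine.
have phiE x : phi x = chi (c *: x + 0).
  by rewrite /chi !addr0 scalerA mulVf// scale1r.
have pdE x : pd i phi x = c * pd i chi (c *: x + 0).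
  rewrite -pd_affine; last by apply: smooth_differentiable; case: tchi.
  by congr (pd i _ x); apply/funext => z.
transitivity (- \int[leb3]_x (c * (fun z => u z * pd i chi z) (c *: x + 0))).
  by congr (- _); apply: eq_Rintegral => x _; rewrite pdE addr0; ring.
have mpd := test_measurable (test_pd i tchi); have mchi := test_measurable tchi.
have mA : measurable_fun setT (fun x : R3 R => (c *: x + 0) : R3 R).
  exact: measurable_R3_comb.
have mup : measurable_fun setT (fun z => u z * pd i chi z) by exact: measurable_funM.
have mgc : measurable_fun setT (fun z => g z * chi z) by exact: measurable_funM.
rewrite RintegralZ; last exact: (measurableT_comp mup mA).
have E1 : \int[leb3]_x (u (c *: x + 0) * pd i chi (c *: x + 0)) =
    (c ^+ 3)^-1 * \int[leb3]_x (u x * pd i chi x) := integral_affine3 0 c0 mup.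
have E2 : \int[leb3]_x (g (c *: x + 0) * chi (c *: x + 0)) =
    (c ^+ 3)^-1 * \int[leb3]_x (g x * chi x) := integral_affine3 0 c0 mgc.
rewrite E1.
have := Hg _ tchi; rewrite /distr_pd /distr_of => H.
transitivity (\int[leb3]_x (c * (fun z => g z * chi z) (c *: x + 0))); last first.
  by apply: eq_Rintegral => x _; rewrite phiE addr0; ring.
rewrite RintegralZ; last exact: (measurableT_comp mgc mA).
rewrite E2 -H; ring.
Qed.

Lemma represents_unique g g' (T : @distr R) : locint g -> locint g' ->
  represents g T -> represents g' T -> {ae leb3, forall x, g x = g' x}.
Proof.
move=> lg lg' Hg Hg'.
have : {ae leb3, forall x, g x - g' x = 0}.
  apply: du_bois_reymond; first exact: locintB.
  move=> phi tphi.
  transitivity (\int[leb3]_x (g x * phi x) - \int[leb3]_x (g' x * phi x)); last first.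
    by have := Hg' _ tphi; rewrite (Hg _ tphi) /distr_of => ->; rewrite subrr.
  rewrite -RintegralB//; first by apply: eq_Rintegral => x _; rewrite mulrBl.
  exact: locint_test.
  exact: locint_test.
by apply: filterS => x /eqP; rewrite subr_eq0 => /eqP.
Qed.

Lemma locint_scale (c : R) r : 0 < c -> locint r -> locint (fun x => r (c *: x)).
Proof.
move=> c0 [mr Ir].
have mA : measurable_fun setT (fun x : R3 R => (c *: x + 0) : R3 R).
  exact: measurable_R3_comb.
have mrc : measurable_fun setT (fun x => r (c *: x)).
  by have := measurableT_comp mr mA; congr measurable_fun; apply/funext => x /=; rewrite addr0.
split => // K; have mK := measurable_cube K.
apply/integrableP; split; first by apply/measurable_EFinP; exact: measurable_funTS.
have /integrableP[_] := Ir (c * K).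
rewrite integral_mkcond => Ioo.
have mf : measurable_fun setT ((fun x => `|(r x)%:E|%E) \_ (cube (c * K))).
  apply/(measurable_restrictT _ _).1; first exact: measurable_cube.
  by apply: measurable_funTS; apply: measurableT_comp => //; exact/measurable_EFinP.
have := @ge0_integral_affine3 _ c 0 _ c0 mf.
have f0 x : (0 <= ((fun x => `|(r x)%:E|%E) \_ (cube (c * K))) x)%E.
  by rewrite /patch; case: ifP.
move=> /(_ f0) E.
rewrite integral_mkcond (_ : (\int[leb3]_x _)%E = ((c ^+ 3)^-1%:E * \int[leb3]_x (((fun x => `|(r x)%:E|%E) \_ (cube (c * K))) x))%E).
  by rewrite lte_mul_pinfty// lee_fin invr_ge0 exprn_ge0// ltW.
rewrite -E; apply: eq_integral => x _; rewrite /patch addr0.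
congr (if _ then _ else _); apply/idP/idP => /set_mem h; apply/mem_set; move: h;
  by rewrite /cube/= normrZ (gtr0_norm c0) ler_pM2l.
Qed.

Lemma xgrad_distrE r phi : locint r -> test_function phi ->
  xgrad_distr r phi = \int[leb3]_x (r x * Ldil phi x).
Proof.
move=> lr tphi; rewrite /xgrad_distr /distr_mulx /distr_pd /distr_of.
have I i : leb3.-integrable setT (EFin \o (fun x => r x * pd i (fun y => xcoord i y * phi y) x)).
  by apply: locint_test => //; apply: test_pd; exact: test_mulx.
rewrite sumrN Rintegral_sum// -RintegralN; apply: eq_Rintegral => x _.
by rewrite /Ldil mulrN mulr_sumr.
Qed.

Lemma Ldil_scale phi (c : R) x : (forall x, differentiable phi x) ->
  Ldil (fun y => phi (c *: y + 0)) x = Ldil phi (c *: x + 0).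
Proof.
move=> dphi; rewrite !LdilE//; last exact: differentiable_affine.
congr (- (_ + _)); apply: eq_bigr => i _; rewrite pd_affine// xcoord_affine.
rewrite (_ : xcoord i 0 = 0); last by move: i; apply: forall_ord3.
by ring.
Qed.

(** Both sides are tested against [phi]. On the left this gives [r] against
    [t^-3 phi(y/t) - phi(y)], which is the integral over [[1, t]] of [s^-4 Ldil phi (y/s)]; on the
    right [r'] is traded for [r] by applying its defining property to [phi(y/s)], and the same
    kernel appears. *)
Lemma dilation_identity r r' (t : R) : 1 < t -> locint r -> locint r' ->
  represents r' (xgrad_distr r) ->
  {ae leb3, forall y, r (t *: y) - r y =
    \int[mu]_s (\1_(`[1, t]%classic) s * s^-1 * r' (s *: y + 0))}.
Proof.
move=> t1 lr lr' Hr'.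
have t0 : 0 < t by rewrite (lt_trans _ t1).
pose w (s : R) : R := \1_(`[1, t]%classic) s * s^-1.
have w1 s : w s != 0 -> 1 <= s <= t.
  rewrite /w indicE; case: (boolP (s \in _)) => [/set_mem|]; last by rewrite mul0r eqxx.
  by rewrite /= in_itv.
have Iw : mu.-integrable setT (EFin \o w).
  apply: integrable_itv_mul => s /andP[s1 _]; apply: ex_derive.
  by apply: (@is_deriveV _ id); rewrite gt_eqF// (lt_le_trans _ s1).
have sw s : w s != 0 -> [/\ 1 <= s, s <= t & `|0 : R3 R| <= 0].
  by move=> /w1/andP[? ?]; rewrite normr0.
have mid : measurable_fun setT (fun s : R => s) by [].
have m0 : measurable_fun setT (fun _ : R => 0 : R3 R) by exact: measurable_cst.
have lavg := locint_avg lr' Iw mid m0 sw.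
have lrt := locint_scale t0 lr.
have : {ae leb3, forall y, r (t *: y) - r y - avg r' w id (fun=> 0) y = 0}.
  apply: du_bois_reymond; first by apply: locintB => //; exact: locintB.
  move=> phi tphi.
  have dphi x : differentiable phi x by apply: smooth_differentiable; case: tphi.
  have mphi := test_measurable tphi.
  have [mr _] := lr; have [mr' _] := lr'.
  have tL := test_Ldil tphi; have mL := test_measurable tL.
  have [K [B [K0 B0 HB]]] := test_bounded tL.
  (* Written as a real power, the inverse is measurable in [s] by [measurable_powR]; on [[1, t]],
     where the weight lives, it is [s^-1]. *)
  pose psi (z : M * R3 R) : R := (z.1 `^ (-1)) ^+ 3 * Ldil phi (z.1 `^ (-1) *: z.2 + 0).
  have mpsi : measurable_fun setT psi.
    have mp : measurable_fun setT (fun z : M * R3 R => z.1 `^ (-1)).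
      have mp1 : measurable_fun setT (fun s : M => s `^ (-1) : R) by exact: measurable_powR.
      exact: (measurableT_comp mp1 measurable_fst).
    apply: measurable_funM; first exact: measurable_funX.
    by apply: (measurableT_comp mL); exact: measurable_R3_comb.
  have psiE s y : 1 <= s -> psi (s, y) = s^-1 ^+ 3 * Ldil phi (s^-1 *: y + 0).
    by move=> s1; rewrite /psi/= powR_inv1// (le_trans _ s1).
  have bpsi s y : w s != 0 -> `|psi (s, y)| <= B * \1_(cube (t * K)) y.
    move=> /w1/andP[s1 st]; rewrite psiE// normrM.
    have s0 : 0 < s by rewrite (lt_le_trans _ s1).
    rewrite ger0_norm ?exprn_ge0 ?invr_ge0 ?(ltW s0)//.
    rewrite (@le_trans _ _ (1 * `|Ldil phi (s^-1 *: y + 0)|))//.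
      by rewrite ler_wpM2r// exprn_ile1 ?invr_ge0 ?(ltW s0)// invf_le1.
    rewrite mul1r (le_trans (HB _))// ler_wpM2l// !indicE ler_nat.
    case: (boolP (_ \in cube K)) => // /set_mem; rewrite /cube/= addr0 normrZ.
    rewrite ger0_norm ?invr_ge0 ?(ltW s0)// ler_pdivrMl// => h.
    by rewrite mem_set//= (le_trans h)// ler_wpM2r.
  have E : \int[leb3]_y (avg r' w id (fun=> 0) y * phi y) =
      \int[leb3]_y (r (t *: y) * phi y) - \int[leb3]_y (r y * phi y).
    rewrite (avg_test lr' Iw mid m0 sw tphi).
    transitivity (\int[mu]_s (w s * \int[leb3]_y (r y * psi (s, y)))).
      apply: eq_Rintegral => s _.
      have [->|ws0] := eqVneq (w s) 0; first by rewrite !mul0r.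
      congr (_ * _); have /andP[s1 st] := w1 _ ws0.
      have s0 : 0 < s by rewrite (lt_le_trans _ s1).
      pose phis y := phi (s^-1 *: y + 0).
      have si0 : 0 < s^-1 by rewrite invr_gt0.
      have tphis : test_function phis by exact: test_affine.
      have mphis := test_measurable tphis.
      have mp : measurable_fun setT (fun y => r' y * phis y) by exact: measurable_funM.
      transitivity ((s ^+ 3)^-1 * \int[leb3]_y (r' y * phis y)).
        rewrite -(integral_affine3 0 s0 mp); apply: eq_Rintegral => y _; congr (_ * _).
        by rewrite /phis !addr0 scalerA mulVf ?gt_eqF// scale1r.
      have -> : \int[leb3]_x (r' x * phis x) = xgrad_distr r phis by rewrite (Hr' _ tphis).
      rewrite xgrad_distrE// -RintegralZ; last first.
        by apply: measurable_funM => //; exact: test_measurable (test_Ldil tphis).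
      by apply: eq_Rintegral => y _; rewrite psiE// Ldil_scale// exprVn; ring.
    rewrite -(test_avg lr Iw mpsi bpsi).
    have ti0 : 0 < t^-1 by rewrite invr_gt0.
    pose phit y := phi (t^-1 *: y + 0).
    have tphit : test_function phit by exact: test_affine.
    have mphit := test_measurable tphit.
    have mp : measurable_fun setT (fun y => r y * phit y) by exact: measurable_funM.
    have -> : \int[leb3]_y (r (t *: y) * phi y) = \int[leb3]_y ((t ^+ 3)^-1 * (r y * phit y)).
      rewrite RintegralZ// -(integral_affine3 0 t0 mp); apply: eq_Rintegral => y _.
      by rewrite /phit !addr0 scalerA mulVf ?gt_eqF// scale1r.
    rewrite -RintegralB//; last 2 first.
    - apply: eq_integrable (integrableZl measurableT (t ^+ 3)^-1 (locint_test lr tphit)) => //.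
    - exact: locint_test.
    apply: eq_Rintegral => y _.
    have -> : \int[mu]_s (w s * psi (s, y)) = (t ^+ 3)^-1 * phi (t^-1 *: y) - (1 ^+ 3)^-1 * phi (1^-1 *: y).
      have F1 (s : R) : 1 <= s <= t -> is_derive s (1 : R) (fun s => (s ^+ 3)^-1 * phi (s^-1 *: y))
          ((s ^+ 4)^-1 * Ldil phi (s^-1 *: y)).
        by move=> /andP[s1 _]; apply: is_derive_dilation => //; rewrite (lt_le_trans _ s1).
      have F2 (s : R) : 1 <= s <= t -> derivable (fun s : R => (s ^+ 4)^-1 * Ldil phi (s^-1 *: y)) s 1.
        move=> /andP[s1 _]; have s0 : 0 < s by rewrite (lt_le_trans _ s1).
        have dL x : differentiable (Ldil phi) x by apply: smooth_differentiable; case: tL.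
        (* As [s^-4 = s^-1 s^-3], the derivative formula can be used again, with [Ldil phi] in place
           of [phi]. *)
        have d1 := is_derive_dilation y dL s0.
        have d2 : is_derive s (1 : R) (fun s : R => s^-1) (- s ^- 2 *: 1).
          by apply: (@is_deriveV _ id); rewrite gt_eqF.
        have := @is_deriveM _ _ _ _ _ _ _ _ d2 d1.
        case=> D _.
        rewrite (_ : (fun s2 : R => _) = (GRing.inv : R -> R) * (fun s2 : R => (s2 ^+ 3)^-1 * Ldil phi (s2^-1 *: y))).
          exact: D.
        by apply/funext => z; rewrite [RHS]mulrA -invfM -exprS.
      apply: etrans (FTC_Rintegral t1 F1 F2).
      apply: eq_Rintegral => s _; rewrite /w indicE.
      case: (boolP (s \in _)) => [/set_mem|]; last by rewrite !mul0r.
      rewrite /= in_itv/= => /andP[s1 st]; rewrite !mul1r psiE// addr0.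
      by rewrite mulrA exprVn -invfM -exprS.
    rewrite expr1n invr1 mul1r scale1r /phit addr0; ring.
  have I1 := locint_test lrt tphi; have I2 := locint_test lr tphi; have I3 := locint_test lavg tphi.
  transitivity (\int[leb3]_y (r (t *: y) * phi y) - \int[leb3]_y (r y * phi y) - \int[leb3]_y (avg r' w id (fun=> 0) y * phi y)).
    rewrite -RintegralB// -RintegralB//; last by apply: eq_integrable (integrableB _ I1 I2).
    by apply: eq_Rintegral => y _; ring.
  by rewrite E subrr.
by apply: filterS => y /eqP; rewrite subr_eq0 => /eqP.
Qed.

(** Formally, [d/ds [(1 - s) u(y + s e)]] is integrated over [[0, 1]]: the weight is 0 at [s = 1],
    so that [u(y)] is the only boundary term. As [g] is only a weak derivative, this is carried out
    on translated test functions. *)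
Lemma translation_identity u g i : locint u -> locint g ->
  represents g (distr_pd i (distr_of u)) ->
  {ae leb3, forall y, u y =
    \int[mu]_s (\1_(`[0, 1]%classic) s * u (1 *: y + s *: Defs.basis i)) -
    \int[mu]_s (\1_(`[0, 1]%classic) s * (1 - s) * g (1 *: y + s *: Defs.basis i))}.
Proof.
move=> lu lg Hg.
pose e : R3 R := Defs.basis i.
pose w1 (s : R) : R := \1_(`[0, 1]%classic) s.
pose w2 (s : R) : R := \1_(`[0, 1]%classic) s * (1 - s).
have hw1 s : w1 s != 0 -> 0 <= s <= 1.
  rewrite /w1 indicE; case: (boolP (s \in _)) => [/set_mem|]; last by rewrite eqxx.
  by rewrite /= in_itv.
have hw2 s : w2 s != 0 -> 0 <= s <= 1.
  by rewrite /w2 mulf_eq0 negb_or => /andP[/hw1].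
have Iw1 : mu.-integrable setT (EFin \o w1).
  have : mu.-integrable setT (EFin \o (fun s => \1_(`[0, 1]%classic) s * 1 : R)).
    by apply: integrable_itv_mul => s _; exact: derivable_cst.
  by apply: eq_integrable => // s _; rewrite /= mulr1.
have Iw2 : mu.-integrable setT (EFin \o w2).
  by apply: integrable_itv_mul => s _; apply: ex_derive.
have md : measurable_fun setT (fun s : R => s *: e : R3 R).
  have := @measurable_R3_comb R _ M (fun s => s) (cst e) (cst 0).
  move=> /(_ (@measurable_id _ _ _) (measurable_cst _) (measurable_cst _)).
  by congr measurable_fun; apply/funext => s /=; rewrite addr0.
have m1 : measurable_fun setT (fun _ : R => 1 : R) by exact: measurable_cst.
have se s : 0 <= s <= 1 -> [/\ (1 : R) <= 1, (1 : R) <= 1 & `|s *: e| <= `|e|].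
  move=> /andP[s0 s1]; split=> //; rewrite normrZ ger0_norm//.
  by rewrite ler_piMl.
have sw1 s : w1 s != 0 -> [/\ (1 : R) <= 1, (1 : R) <= 1 & `|s *: e| <= `|e|].
  by move=> /hw1/se.
have sw2 s : w2 s != 0 -> [/\ (1 : R) <= 1, (1 : R) <= 1 & `|s *: e| <= `|e|].
  by move=> /hw2/se.
have la1 := locint_avg lu Iw1 m1 md sw1.
have la2 := locint_avg lg Iw2 m1 md sw2.
set A1 := avg u w1 (fun=> 1) (fun s => s *: e).
set A2 := avg g w2 (fun=> 1) (fun s => s *: e).
have : {ae leb3, forall y, u y - (A1 y - A2 y) = 0}.
  apply: du_bois_reymond; first by apply: locintB => //; exact: locintB.
  move=> phi tphi.
  have dphi x : differentiable phi x by apply: smooth_differentiable; case: tphi.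
  have shift chi : test_function chi -> exists K B, [/\ measurable_fun setT (fun z : M * R3 R => chi (1 *: z.2 + (- z.1) *: e)),
     measurable_fun setT chi &
     forall s y, 0 <= s <= 1 -> `|chi (1 *: y + (- s) *: e)| <= B * \1_(cube K) y].
    move=> tchi; have [K [B [K0 B0 HB]]] := test_bounded tchi.
    have mchi := test_measurable tchi.
    exists (K + `|e|), B; split=> //.
      apply: (measurableT_comp mchi).
      apply: (@measurable_R3_comb R _ (M * R3 R)%type (fun=> 1) snd (fun z => - z.1 *: e)) => //.
      have := @measurable_R3_comb R _ (M * R3 R)%type (fun z => - z.1) (cst e) (cst 0).
      have mN : measurable_fun setT (fun z : M * R3 R => - z.1 : R).
        by apply: (@measurable_funN _ (M * R3 R)%type R setT fst); exact: measurable_fst.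
      move=> /(_ mN (measurable_cst _) (measurable_cst _)).
      by congr measurable_fun; apply/funext => s /=; rewrite addr0.
    move=> s y s01; rewrite (le_trans (HB _))// ler_wpM2l// !indicE ler_nat.
    case: (boolP (_ \in cube K)) => // /set_mem; rewrite /cube/= => h.
    rewrite mem_set//=.
    have -> : y = (1 *: y + (- s) *: e) + s *: e by rewrite scale1r scaleNr subrK.
    by rewrite (le_trans (ler_normD _ _))// lerD//; have [] := se _ s01.
  have adj f w (chi : R3 R -> R) : locint f -> test_function chi ->
      mu.-integrable setT (EFin \o w) -> (forall s, w s != 0 -> 0 <= s <= 1) ->
      \int[leb3]_y (f y * \int[mu]_s (w s * chi (1 *: y + (- s) *: e))) =
      \int[mu]_s (w s * \int[leb3]_y (f y * chi (1 *: y + (- s) *: e))) /\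
      leb3.-integrable setT (EFin \o (fun y => f y * \int[mu]_s (w s * chi (1 *: y + (- s) *: e)))).
    move=> lf tchi Iw hw.
    have [K [B [mpsi mchi H]]] := shift _ tchi.
    have bpsi s y : w s != 0 -> `|chi (1 *: (s, y).2 + (- (s, y).1) *: e)| <= B * \1_(cube K) y.
      by move=> /hw; exact: H.
    split; first exact: (test_avg lf Iw mpsi bpsi).
    exact: (test_avg_integrable lf Iw mpsi bpsi).
  have tr f (chi : R3 R -> R) s : measurable_fun setT f -> measurable_fun setT chi ->
      \int[leb3]_y (f (1 *: y + s *: e) * chi y) = \int[leb3]_y (f y * chi (1 *: y + (- s) *: e)).
    move=> mf mchi.
    have mA : measurable_fun setT (fun x : R3 R => (1 *: x + (- s) *: e) : R3 R).
      exact: measurable_R3_comb.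
    have mp : measurable_fun setT (fun y => f y * chi (1 *: y + (- s) *: e)).
      by apply: measurable_funM => //; exact: (measurableT_comp mchi mA).
    have := integral_affine3 (s *: e) ltr01 mp; rewrite expr1n invr1 mul1r => <-.
    by apply: eq_Rintegral => y _; rewrite !scale1r scaleNr addrK.
  have [mu_ _] := lu; have [mg _] := lg.
  have mphi := test_measurable tphi.
  have tpd := test_pd i tphi.
  have [B1 J1] := adj u w1 phi lu tphi Iw1 hw1.
  have [B2 J2] := adj u w2 (pd i phi) lu tpd Iw2 hw2.
  have E1 : \int[leb3]_y (A1 y * phi y) = \int[leb3]_y (u y * \int[mu]_s (w1 s * phi (1 *: y + (- s) *: e))).
    rewrite B1 (avg_test lu Iw1 m1 md sw1 tphi).
    by apply: eq_Rintegral => s _; rewrite tr.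
  have E2 : \int[leb3]_y (A2 y * phi y) = - \int[leb3]_y (u y * \int[mu]_s (w2 s * pd i phi (1 *: y + (- s) *: e))).
    rewrite B2 (avg_test lg Iw2 m1 md sw2 tphi) -RintegralN.
    apply: eq_Rintegral => s _; rewrite tr// -mulrN; congr (_ * _).
    have tsh : test_function (fun y => phi (1 *: y + (- s) *: e)) by exact: test_affine.
    have <- : \int[leb3]_y (u y * pd i (fun y => phi (1 *: y + (- s) *: e)) y) =
        \int[leb3]_y (u y * pd i phi (1 *: y + (- s) *: e)).
      by apply: eq_Rintegral => y _; rewrite pd_affine// mul1r.
    exact/esym/(Hg _ tsh).
  have I1 := locint_test la1 tphi; have I2 := locint_test la2 tphi; have I0 := locint_test lu tphi.
  transitivity (\int[leb3]_y (u y * phi y) - (\int[leb3]_y (A1 y * phi y) - \int[leb3]_y (A2 y * phi y))).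
    rewrite -RintegralB// -RintegralB//; last by apply: eq_integrable (integrableB _ I1 I2).
    by apply: eq_Rintegral => y _; ring.
  rewrite E1 E2 opprK -RintegralD//.
  apply/eqP; rewrite subr_eq0; apply/eqP; apply: eq_Rintegral => y _.
  rewrite -mulrDr; congr (_ * _).
  have dl (chi : R3 R -> R) (s : R) : (forall x, differentiable chi x) ->
    is_derive s (1 : R) (fun s => chi (1 *: y + (- s) *: e)) (- pd i chi (1 *: y + (- s) *: e)).
    move=> dchi.
    have := @is_derive_line chi (1 *: y) (- e) s (dchi _).
    have -> : (fun s : R => chi (1 *: y + s *: - e)) = (fun s => chi (1 *: y + (- s) *: e)).
      by apply/funext => z; rewrite scalerN scaleNr.
    congr is_derive.
    rewrite (bigD1 i)//= big1 ?addr0 => [|j ji].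
      by rewrite xcoordN_basis eqxx mulN1r scalerN -scaleNr.
    by rewrite xcoordN_basis (negbTE ji) oppr0 mul0r.
  (* A primitive of the combined kernel [f], with [F 1 - F 0 = phi y]. *)
  pose F (s : R) : R := - ((1 - s) * phi (1 *: y + (- s) *: e)).
  pose f (s : R) : R := phi (1 *: y + (- s) *: e) + (1 - s) * pd i phi (1 *: y + (- s) *: e).
  have dpd x : differentiable (pd i phi) x by apply: smooth_differentiable; case: tpd.
  have d1s (s : R) : is_derive s (1 : R) (fun s : R => 1 - s) (-1).
    by have := @is_deriveB R R R _ _ _ _ _ _ (is_derive_cst (1 : R) s (1 : R)) (is_derive_id s (1 : R)); rewrite sub0r.
  have D2 (s : R) : derivable (fun s : R => (1 - s) * pd i phi (1 *: y + (- s) *: e)) s 1.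
    by have [] := @is_deriveM _ _ _ _ _ _ _ _ (d1s s) (dl _ s dpd).
  have D1 (s : R) : derivable (fun s : R => phi (1 *: y + (- s) *: e)) s 1.
    by have [] := dl _ s dphi.
  have HF (s : R) : 0 <= s <= 1 -> is_derive s (1 : R) F (f s).
    move=> _; have := @is_deriveN _ _ _ _ _ _ _ (@is_deriveM _ _ _ _ _ _ _ _ (d1s s) (dl _ s dphi)).
    by move=> D; apply: (is_derive_eq D); rewrite /f /GRing.scale/=; ring.
  have Hf (s : R) : 0 <= s <= 1 -> derivable f s 1 by move=> _; exact: derivableD.
  have EF := FTC_Rintegral ltr01 HF Hf.
  transitivity (F 1 - F 0).
    by rewrite /F subrr mul0r oppr0 opprK add0r addr0 mul1r scale0r addr0 scale1r.
  rewrite -EF.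
  have J3 := integrable_itv_mul (a := 0) (b := 1) (fun s _ => D1 s).
  have J4 := integrable_itv_mul (a := 0) (b := 1) (fun s _ => D2 s).
  transitivity (\int[mu]_s (\1_(`[0, 1]%classic) s * phi (1 *: y + (- s) *: e) +
    \1_(`[0, 1]%classic) s * ((1 - s) * pd i phi (1 *: y + (- s) *: e)))).
    by apply: eq_Rintegral => s _; rewrite /f mulrDr.
  rewrite RintegralD//; congr (_ + _); apply: eq_Rintegral => s _.
  by rewrite /w2 mulrA.
by apply: filterS => y /eqP; rewrite subr_eq0 => /eqP.
Qed.

End Lines.

(** * The Coulomb kernel and the Loomis-Whitney inequality *)

Section Kernel.
Context {R : realType}.
Local Notation mu := (@lebesgue_measure R).
Local Notation M := (measurableTypeR R).
Implicit Types (x y z : R3 R) (K : R).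

Lemma leb3_cubeE K : 0 <= K -> leb3 (cube K) = ((2 * K) ^+ 3)%:E.
Proof.
move=> K0; rewrite cubeE.
set I : set M := `[-K, K]%classic.
have mI : measurable I by exact: measurable_itv.
have -> : leb3 (I `*` I `*` I) = (mu I * mu I * mu I)%E.
  transitivity (lebp2 (I `*` I) * mu I)%E.
    by apply: (@product_measure1E _ _ _ _ _ lebp2 mu) => //; exact: measurableX.
  by congr (_ * _)%E; exact: product_measure1E.
rewrite lebesgue_measure_itv/= lte_fin.
move: K0; rewrite le_eqVlt => /predU1P[<-|K0].
  by rewrite oppr0 ltxx !mul0e mulr0 expr0n.
rewrite gtrN// -EFinB -!EFinM; congr (_%:E); ring.
Qed.

Lemma measurable_eucl : measurable_fun setT (eucl : R3 R -> R).
Proof.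
apply: (measurableT_comp (continuous_measurable_fun (@sqrt_continuous R))).
rewrite (_ : (fun _ => _) = (fun x : R3 R => x.1.1 ^+ 2 + (x.1.2 ^+ 2 + x.2 ^+ 2))); last first.
  by apply/funext => x; rewrite !big_ord_recl big_ord0 addr0.
apply: measurable_funD; last apply: measurable_funD; apply: measurable_funX.
- exact: measurable_x0.
- exact: measurable_x1.
- exact: measurable_x2.
Qed.

Lemma eucl_ge0 x : 0 <= eucl x.
Proof. exact: sqrtr_ge0. Qed.

Lemma norm_le_eucl x : `|x| <= eucl x.
Proof.
have H i : `|xcoord i x| <= eucl x.
  rewrite -sqrtr_sqr /eucl ler_wsqrtr// (bigD1 i)//= lerDl sumr_ge0// => j _.
  exact: sqr_ge0.
rewrite R3_norm_le.
by apply/and3P; split; [exact: (H ord0)|exact: (H (lift ord0 ord0))|exact: (H ord_max)].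
Qed.

Lemma euclZ (c : R) x : 0 <= c -> eucl (c *: x) = c * eucl x.
Proof.
move=> c0; rewrite /eucl -[X in _ = X * _](ger0_norm c0) -sqrtr_sqr -sqrtrM ?sqr_ge0//.
congr Num.sqrt; rewrite mulr_sumr; apply: eq_bigr => i _.
have := xcoord_affine i c x 0; rewrite addr0 => ->.
rewrite (_ : xcoord i 0 = 0) ?addr0 ?exprMn//; by move: i; apply: forall_ord3.
Qed.

(* The junk value 0^-1 = 0 makes the kernel vanish at the origin. *)
Definition kern x : R := (eucl x)^-1.
Definition kern_near x : R := kern x * \1_(cube 1) x.
Definition kern_far x : R := kern x * \1_(~` cube 1) x.

Lemma kern_split x : kern x = kern_near x + kern_far x.
Proof.
rewrite /kern_near /kern_far -mulrDr !indicE in_setC.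
by case: (x \in cube 1); rewrite ?addr0 ?add0r mulr1.
Qed.

Lemma kern_ge0 x : 0 <= kern x.
Proof. by rewrite invr_ge0 eucl_ge0. Qed.

Lemma kern_le x : kern x <= `|x|^-1.
Proof.
have [->|x0] := eqVneq x 0; last by rewrite lef_pV2 ?posrE ?norm_le_eucl ?normr_gt0// (lt_le_trans _ (norm_le_eucl x))// normr_gt0.
rewrite normr0 invr0 /kern /eucl big1 ?sqrtr0 ?invr0// => i _.
by rewrite (_ : xcoord i 0 = 0) ?expr0n//; move: i; apply: forall_ord3.
Qed.

Lemma measurable_kern : measurable_fun setT kern.
Proof.
have mV : measurable_fun setT (fun x : R3 R => eucl x `^ (-1)).
  have mp1 : measurable_fun setT (fun s : M => s `^ (-1) : R) by exact: measurable_powR.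
  exact: (measurableT_comp mp1 measurable_eucl).
by move: mV; congr measurable_fun; apply/funext => x; rewrite powR_inv1// eucl_ge0.
Qed.

Lemma measurable_kern_near : measurable_fun setT kern_near.
Proof.
apply: measurable_funM; first exact: measurable_kern.
by apply: measurable_indic; exact: measurable_cube.
Qed.

Lemma measurable_kern_far : measurable_fun setT kern_far.
Proof.
apply: measurable_funM; first exact: measurable_kern.
by apply: measurable_indic; apply: measurableC; exact: measurable_cube.
Qed.

Local Open Scope ereal_scope.

(** [f] lies below the sum of the functions [c n] times the indicator of [cube (K n)], whose
    integrals are at most the terms of a geometric series with sum [C]. Full cubes instead of shells
    lose only a constant factor. *)
Lemma shell_series_bound (f : R3 R -> R) (c K : nat -> R) (C : R) :
  measurable_fun setT f -> (forall x, (0 <= f x)%R) ->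
  (forall n, (0 <= c n)%R) -> (forall n, (0 <= K n)%R) -> (0 <= C)%R ->
  (forall n, c n * (2 * K n) ^+ 3 <= C / (2 ^ n.+1)%:R)%R ->
  (forall x, f x = 0%R \/ exists n, (`|x| <= K n)%R /\ (f x <= c n)%R) ->
  \int[leb3]_x (f x)%:E <= C%:E.
Proof.
move=> mf f0 c0 K0 C0 Hc Hf.
pose F n (x : R3 R) := (c n * \1_(cube (K n)) x)%:E.
have mF n : measurable_fun setT (F n).
  by apply/measurable_EFinP; apply: measurable_funM => //; apply: measurable_indic; exact: measurable_cube.
have F0 n x : 0 <= F n x by rewrite lee_fin mulr_ge0.
apply: (@le_trans _ _ (\int[leb3]_x \sum_(n <oo) F n x)).
  apply: ge0_le_integral => //.
  - by move=> x _; rewrite lee_fin.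
  - exact/measurable_EFinP.
  - exact: ge0_emeasurable_sum.
  move=> x _; case: (Hf x) => [->|[n [xn fn]]]; first exact: nneseries_ge0.
  apply: (@le_trans _ _ (F n x)).
    by rewrite lee_fin indicE mem_set ?mulr1.
  apply: le_trans (nneseries_lim_ge n.+1 _) => //.
  rewrite big_nat_recr//= leeDr// sume_ge0// => i _; exact: F0.
rewrite integral_nneseries//; apply: le_trans (epsilon_trick0 xpredT C0).
apply: lee_nneseries => [n _ _|n _]; first exact: integral_ge0.
rewrite /F; under eq_integral do rewrite EFinM.
rewrite ge0_integralZl_EFin//; last first.
  by apply/measurable_EFinP; apply: measurable_indic; exact: measurable_cube.
rewrite integral_indic ?setIT//; last exact: measurable_cube.
by rewrite leb3_cubeE// -EFinM lee_fin.
Qed.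

(** On [2^-(n+1) < |x| <= 2^-n] the squared kernel is at most [4^(n+1)], and the cube has volume
    [8 * 8^-n]; the product is [64 / 2^(n+1)]. *)
Lemma integral_kern_near : \int[leb3]_x (kern_near x ^+ 2)%:E <= 64%:E.
Proof.
apply: (@shell_series_bound _ (fun n => 4 * 4 ^+ n)%R (fun n => (2 ^+ n)^-1)%R) => //.
- by apply: measurable_funX; exact: measurable_kern_near.
- by move=> x; exact: sqr_ge0.
- move=> n; rewrite natrX (exprS (2 : R) n).
  have e0 : (2 ^+ n != 0 :> R)%R by rewrite expf_neq0.
  rewrite (_ : 4 ^+ n = (2 ^+ n) ^+ 2)%R; last by rewrite -exprM mulnC exprM; congr (_ ^+ _)%R; ring.
  by rewrite le_eqVlt; apply/orP; left; apply/eqP; field.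
move=> x; rewrite /kern_near indicE.
have [/set_mem x1|] := boolP (x \in cube 1); last by left; rewrite mulr0 expr0n.
have [x0|x0] := eqVneq x 0%R.
  left; rewrite mulr1 (_ : kern x = 0%R) ?expr0n//; apply/eqP.
  by rewrite eq_le kern_ge0 (le_trans (kern_le _))// x0 normr0 invr0.
right; rewrite mulr1.
have xp : (0 < `|x|)%R by rewrite normr_gt0.
have ex : exists n, ((2 ^+ n.+1)^-1 < `|x|)%R.
  have := near_infty_natSinv_lt (PosNum xp) => -[N _ /(_ N (leqnn N))] /= HN.
  exists N; apply: le_lt_trans HN; rewrite lef_pV2 ?posrE ?exprn_gt0// -natrX ler_nat.
  by rewrite (ltn_trans (@ltn_expl 2 N isT))// ltn_exp2l.
have := ex_minnP ex => -[n Hn Hmin]; exists n; split.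
  case: n Hn Hmin => [|n] Hn Hmin; first by rewrite expr0 invr1.
  by rewrite leNgt; apply/negP => /Hmin; rewrite ltnn.
have k0 := kern_ge0 x.
apply: (@le_trans _ _ (`|x|^-1 ^+ 2)%R).
  by rewrite ler_sqr ?nnegrE ?kern_le// invr_ge0.
have H : (`|x|^-1 <= 2 ^+ n.+1)%R by rewrite -[leRHS]invrK lef_pV2 ?posrE ?ltW// invr_gt0 exprn_gt0.
apply: (@le_trans _ _ ((2 ^+ n.+1) ^+ 2)%R).
  by rewrite ler_sqr ?nnegrE ?exprn_ge0// invr_ge0.
rewrite -exprS -exprM mulnC exprM (_ : 2 ^+ 2 = 4 :> R)%R//.
by rewrite expr2; ring.
Qed.

(** On [2^n <= |x| <= 2^(n+1)] the sixth power is at most [2^(-6n)], and the cube has volume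
    [64 * 8^n]; the product [64 * 8^-n] is at most [128 / 2^(n+1)]. *)
Lemma integral_kern_far : \int[leb3]_x (kern_far x ^+ 6)%:E <= 128%:E.
Proof.
apply: (@shell_series_bound _ (fun n => (2 ^+ n)^-1 ^+ 6)%R (fun n => 2 ^+ n.+1)%R) => //.
- by apply: measurable_funX; exact: measurable_kern_far.
- by move=> x; rewrite exprn_even_ge0.
- move=> n; rewrite natrX (exprS (2 : R) n).
  have e0 : (1 <= 2 ^+ n :> R)%R by rewrite exprn_ege1// ler1n.
  have e1 : (2 ^+ n != 0 :> R)%R by rewrite expf_neq0.
  rewrite (_ : _ * _ = 64 * ((2 ^+ n)^-1 ^+ 3))%R; last by field.
  rewrite (_ : _ / _ = 64 * (2 ^+ n)^-1)%R; last by field.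
  rewrite ler_wpM2l// -[leRHS]expr1 ler_wiXn2l// ?invr_ge0 ?exprn_ge0//.
  by rewrite invf_le1// exprn_gt0.
move=> x; rewrite /kern_far indicE in_setC.
have [_|x1] := boolP (x \in cube 1); first by left; rewrite mulr0 expr0n.
right; rewrite mulr1.
have {}x1 : (1 < `|x|)%R by rewrite ltNge; apply: contra x1 => h; exact/mem_set.
have ex : exists n, (`|x| <= 2 ^+ n.+1)%R.
  exists (Num.truncn `|x|); rewrite (le_trans (ltW (truncnS_gt _)))// -natrX ler_nat.
  exact/ltnW/ltn_expl.
have := ex_minnP ex => -[n Hn Hmin]; exists n; split => //.
have Hl : (2 ^+ n <= `|x|)%R.
  case: n Hn Hmin => [|n] Hn Hmin; first by rewrite expr0 ltW.
  by rewrite leNgt; apply/negP => /ltW/Hmin; rewrite ltnn.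
rewrite lerXn2r ?nnegrE ?kern_ge0 ?invr_ge0 ?exprn_ge0//.
rewrite (le_trans (kern_le _))// lef_pV2 ?posrE ?exprn_gt0//.
by rewrite (lt_le_trans _ Hl)// exprn_gt0.
Qed.

End Kernel.

Section LeIntegralT.
Context d (T : measurableType d) (R : realType) (m : {measure set T -> \bar R}).
Local Open Scope ereal_scope.

Lemma ge0_le_integralT (f g : T -> \bar R) : (forall x, 0 <= f x) ->
  measurable_fun setT f -> measurable_fun setT g -> (forall x, f x <= g x) ->
  \int[m]_x f x <= \int[m]_x g x.
Proof. by move=> f0 mf mg fg; apply: ge0_le_integral => // x _. Qed.

End LeIntegralT.

Section LoomisWhitney.
Context {R : realType}.
Local Open Scope ereal_scope.
Local Notation mu := (@lebesgue_measure R).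
Local Notation M := (measurableTypeR R).

Section Tonelli.
Variable f : R3 R -> \bar R.
Hypothesis mf : measurable_fun setT f.
Hypothesis f0 : forall x, 0 <= f x.

Let mfabc : measurable_fun setT (fun z : (M * M) * M => f (z.1.1, z.1.2, z.2)).
Proof. by have := mf; congr measurable_fun; apply/funext => -[[]]. Qed.

Let mfacb : measurable_fun setT (fun z : (M * M) * M => f (z.1.1, z.2, z.1.2)).
Proof.
apply: (measurableT_comp mf); apply: measurable_R3; [exact: measurable_x0|exact: measurable_x2|exact: measurable_x1].
Qed.

Let mfbca : measurable_fun setT (fun z : (M * M) * M => f (z.2, z.1.1, z.1.2)).
Proof.
apply: (measurableT_comp mf); apply: measurable_R3; [exact: measurable_x2|exact: measurable_x0|exact: measurable_x1].
Qed.

Lemma measurable_int2 : measurable_fun setT (fun z : M * M => \int[mu]_c f (z.1, z.2, c)).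
Proof. by apply: (@measurable_fun_fubini_tonelli_F _ _ _ _ _ mu _ mfabc). Qed.

Lemma measurable_int1 : measurable_fun setT (fun z : M * M => \int[mu]_b f (z.1, b, z.2)).
Proof. by apply: (@measurable_fun_fubini_tonelli_F _ _ _ _ _ mu _ mfacb). Qed.

Lemma measurable_int0 : measurable_fun setT (fun z : M * M => \int[mu]_a f (a, z.1, z.2)).
Proof. by apply: (@measurable_fun_fubini_tonelli_F _ _ _ _ _ mu _ mfbca). Qed.

Lemma measurable_iter (g : M * M -> \bar R) : measurable_fun setT g ->
  (forall z, 0 <= g z) -> measurable_fun setT (fun a : M => \int[mu]_b g (a, b)).
Proof. by move=> mg g0; exact: (@measurable_fun_fubini_tonelli_F _ _ _ _ _ mu g mg). Qed.

Lemma tonelli_acb : \int[leb3]_x f x = \int[mu]_a \int[mu]_c \int[mu]_b f (a, b, c).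
Proof.
rewrite (tonelli3 mf f0); apply: eq_integral => a _.
apply: (@fubini_tonelli _ _ _ _ _ mu mu (fun z : M * M => f (a, z.1, z.2))) => //.
have mA : measurable_fun setT (fun z : M * M => (a, z.1, z.2) : R3 R).
  by apply: measurable_R3.
exact: (measurableT_comp mf mA).
Qed.

Lemma tonelli_bca : \int[leb3]_x f x = \int[mu]_b \int[mu]_c \int[mu]_a f (a, b, c).
Proof.
transitivity (\int[mu]_b \int[mu]_a \int[mu]_c f (a, b, c)).
  rewrite (tonelli3 mf f0).
  apply: (@fubini_tonelli _ _ _ _ _ mu mu (fun z : M * M => \int[mu]_c f (z.1, z.2, c))) => //.
    exact: measurable_int2.
  by move=> z; exact: integral_ge0.
apply: eq_integral => b _.
apply: (@fubini_tonelli _ _ _ _ _ mu mu (fun z : M * M => f (z.1, b, z.2))) => //.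
have mA : measurable_fun setT (fun z : M * M => (z.1, b, z.2) : R3 R).
  by apply: measurable_R3.
exact: (measurableT_comp mf mA).
Qed.

End Tonelli.

Lemma integral_half_prod (F : M * M -> \bar R) (G0 G1 : M -> \bar R) :
  measurable_fun setT F -> measurable_fun setT G0 -> measurable_fun setT G1 ->
  (forall z, 0 <= F z) -> (forall b, 0 <= G0 b) -> (forall b, 0 <= G1 b) ->
  \int[mu]_a \int[mu]_b (2^-1%:E * (F (a, b) + G0 b * G1 a)) =
  2^-1%:E * (\int[mu]_a \int[mu]_b F (a, b) + \int[mu]_b G0 b * \int[mu]_a G1 a).
Proof.
move=> mF mG0 mG1 F0 G00 G10.
have GG0 a b : 0 <= G0 b * G1 a by exact: mule_ge0.
have inner a : \int[mu]_b (2^-1%:E * (F (a, b) + G0 b * G1 a)) =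
    2^-1%:E * (\int[mu]_b F (a, b) + \int[mu]_b G0 b * G1 a).
  have mFa : measurable_fun setT (fun b => F (a, b)) by exact: (measurable_fun_pair2 a mF).
  have mGa : measurable_fun setT (fun b => G0 b * G1 a) by apply: emeasurable_funM.
  rewrite ge0_integralZl_EFin//; last 2 first.
  - by move=> b _; rewrite adde_ge0.
  - exact: emeasurable_funD.
  by rewrite ge0_integralD// ge0_integralZr.
under eq_integral do rewrite inner.
have mFI : measurable_fun setT (fun a => \int[mu]_b F (a, b)) by exact: (measurable_iter mF).
have FI0 a : 0 <= \int[mu]_b F (a, b) by exact: integral_ge0.
have GI0 : 0 <= \int[mu]_b G0 b by exact: integral_ge0.
have mGI : measurable_fun setT (fun a => \int[mu]_b G0 b * G1 a) by exact: measurable_funeM.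
have GG a : 0 <= \int[mu]_b G0 b * G1 a by exact: mule_ge0.
rewrite ge0_integralZl_EFin//; last 2 first.
- by move=> b _; rewrite adde_ge0.
- exact: emeasurable_funD.
by rewrite ge0_integralD// ge0_integralZl.
Qed.

(* With [V(a,b)] the integral of [v] over [c], [F(a,b)] that of [h], and [G0(b)],
   [G1(a)] those of [h] over the other two variables, [v <= F], [V <= G0] and
   [V <= G1]; hence [v^(3/2) <= sqrt(F) v] integrates to
   [sqrt(F) V <= (F + V^2)/2 <= (F + G0 G1)/2]. *)
Lemma loomis_whitney (v : R3 R -> R) (h : R3 R -> \bar R) :
  measurable_fun setT v -> (forall x, (0 <= v x)%R) ->
  measurable_fun setT h -> (forall x, 0 <= h x) ->
  (forall a b c, (v (a, b, c))%:E <= \int[mu]_t h (t, b, c)) ->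
  (forall a b c, (v (a, b, c))%:E <= \int[mu]_t h (a, t, c)) ->
  (forall a b c, (v (a, b, c))%:E <= \int[mu]_t h (a, b, t)) ->
  \int[leb3]_x (v x * Num.sqrt (v x))%:E <=
    2^-1%:E * (\int[leb3]_x h x + \int[leb3]_x h x * \int[leb3]_x h x).
Proof.
move=> mv v0 mh h0 H0 H1 H2.
have mve : measurable_fun setT (EFin \o v) by exact/measurable_EFinP.
have ve0 x : 0 <= (EFin \o v) x by rewrite lee_fin.
pose F (z : M * M) := \int[mu]_c h (z.1, z.2, c).
pose V (z : M * M) := \int[mu]_c (v (z.1, z.2, c))%:E.
pose G0 (b : M) := \int[mu]_c \int[mu]_a h (a, b, c).
pose G1 (a : M) := \int[mu]_c \int[mu]_b h (a, b, c).
have mF : measurable_fun setT F by exact: measurable_int2.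
have mV : measurable_fun setT V by exact: (measurable_int2 mve).
have mG0 : measurable_fun setT G0.
  apply: (measurable_iter (measurable_int0 mh h0)) => z; exact: integral_ge0.
have mG1 : measurable_fun setT G1.
  apply: (measurable_iter (measurable_int1 mh h0)) => z; exact: integral_ge0.
have F0 z : 0 <= F z by exact: integral_ge0.
have V0 z : 0 <= V z by apply: integral_ge0 => c _; rewrite lee_fin.
have G00 b : 0 <= G0 b by do 2 apply: integral_ge0 => *.
have G10 b : 0 <= G1 b by do 2 apply: integral_ge0 => *.
have VG0 a b : V (a, b) <= G0 b.
  apply: ge0_le_integralT.
  - by move=> c; rewrite lee_fin.
  - exact: (measurable_fun_pair2 (a, b) (mve : measurable_fun [set: (M * M) * M] _)).
  - exact: (measurable_fun_pair2 b (measurable_int0 mh h0)).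
  - by move=> c; exact: H0.
have VG1 a b : V (a, b) <= G1 a.
  apply: ge0_le_integralT.
  - by move=> c; rewrite lee_fin.
  - exact: (measurable_fun_pair2 (a, b) (mve : measurable_fun [set: (M * M) * M] _)).
  - exact: (measurable_fun_pair2 a (measurable_int1 mh h0)).
  - by move=> c; exact: H1.
have mvs : measurable_fun setT (fun x => (v x * Num.sqrt (v x))%:E).
  apply/measurable_EFinP; apply: measurable_funM => //.
  exact: (measurableT_comp (continuous_measurable_fun (@sqrt_continuous R)) mv).
have key a b : \int[mu]_c (v (a, b, c) * Num.sqrt (v (a, b, c)))%:E <=
    2^-1%:E * (F (a, b) + G0 b * G1 a).
  have VV : V (a, b) * V (a, b) <= G0 b * G1 a by exact: lee_pmul.
  apply: (@le_trans _ _ (2^-1%:E * (F (a, b) + V (a, b) * V (a, b)))); last first.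
    by apply: lee_wpmul2l => //; apply: leeD2l.
  (* If [F(a, b)] is infinite, so is the right-hand side; otherwise its square root is a finite
     factor. *)
  have := F0 (a, b); case EF : (F (a, b)) => [f| |//] f0; last first.
    have VV0 : 0 <= V (a, b) * V (a, b) by exact: mule_ge0.
    by rewrite addye ?gt0_muley ?lte_fin ?leey// -ltNye (lt_le_trans _ VV0).
  apply: (@le_trans _ _ (\int[mu]_c ((Num.sqrt f)%:E * (v (a, b, c))%:E))).
    apply: ge0_le_integralT.
    - by move=> c; rewrite lee_fin mulr_ge0 ?sqrtr_ge0.
    - exact: (measurable_fun_pair2 (a, b) (mvs : measurable_fun [set: (M * M) * M] _)).
    - apply: measurable_funeM; exact: (measurable_fun_pair2 (a, b) (mve : measurable_fun [set: (M * M) * M] _)).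
    - move=> c; rewrite -EFinM lee_fin mulrC ler_wpM2r// ler_sqrt// -lee_fin -EF.
      exact: H2.
  rewrite ge0_integralZl_EFin ?sqrtr_ge0//; last 2 first.
  - by move=> c _; rewrite lee_fin.
  - by exact: (measurable_fun_pair2 (a, b) (mve : measurable_fun [set: (M * M) * M] _)).
  rewrite -/(V (a, b)); have := V0 (a, b); case: (V (a, b)) => [k| |//] k0; last first.
    by rewrite mulyy addey// [leRHS]gt0_muley ?lte_fin// leey.
  rewrite -[leRHS]/((2^-1 * (f + k * k))%:E) -EFinM lee_fin -{2}(sqr_sqrtr (f0 : (0 <= f)%R)).
  have := sqr_ge0 (Num.sqrt f - k); nra.
rewrite (tonelli3 mvs); last by move=> x; rewrite lee_fin mulr_ge0 ?sqrtr_ge0.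
apply: (@le_trans _ _ (\int[mu]_a \int[mu]_b (2^-1%:E * (F (a, b) + G0 b * G1 a)))).
  have mGG : measurable_fun setT (fun z : M * M => 2^-1%:E * (F z + G0 z.2 * G1 z.1)).
    apply: measurable_funeM; apply: emeasurable_funD => //; apply: emeasurable_funM.
      exact: (measurableT_comp mG0 measurable_snd).
    exact: (measurableT_comp mG1 measurable_fst).
  have GG0 z : 0 <= 2^-1%:E * (F z + G0 z.2 * G1 z.1).
    by rewrite mule_ge0// adde_ge0// mule_ge0.
  have vs0 x : 0 <= (v x * Num.sqrt (v x))%:E by rewrite lee_fin mulr_ge0 ?sqrtr_ge0.
  have mI := measurable_int2 mvs vs0.
  have I0 z : 0 <= \int[mu]_c (v (z.1, z.2, c) * Num.sqrt (v (z.1, z.2, c)))%:E.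
    by apply: integral_ge0 => c _; rewrite lee_fin mulr_ge0 ?sqrtr_ge0.
  apply: ge0_le_integralT.
  - by move=> a; apply: integral_ge0 => b _; exact: (I0 (a, b)).
  - exact: (measurable_iter mI I0).
  - exact: (measurable_iter mGG GG0).
  move=> a; apply: ge0_le_integralT.
  - by move=> b; exact: (I0 (a, b)).
  - exact: (measurable_fun_pair2 a mI).
  - exact: (measurable_fun_pair2 a mGG).
  - by move=> b; exact: key.
have N0 : 0 <= \int[leb3]_x h x by exact: integral_ge0.
rewrite integral_half_prod//.
by rewrite -(tonelli3 mh h0) -(tonelli_bca mh h0) -(tonelli_acb mh h0).
Qed.

End LoomisWhitney.

(** * Young inequalities and the normalized double integral *)

Section Young.
Context {R : realType}.
Local Notation mu := (@lebesgue_measure R).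
Local Notation M := (measurableTypeR R).
Implicit Types (x y z : R3 R) (a k f : R).

Lemma powR65_5 a : 0 <= a -> (a `^ (6 / 5)) ^+ 5 = a ^+ 6.
Proof.
move=> a0; rewrite -powR_mulrn ?powR_ge0// -powRrM -powR_mulrn//.
by congr powR; field.
Qed.

(* With [X = a^(6/5)], [Y = k^2], [Z = f^(3/2)]:
   [a k f = (XY)^(1/3) (YZ)^(1/6) (XZ)^(1/2)]. *)
Lemma young3 a k f : 0 <= a -> 0 <= k -> 0 <= f ->
  a * k * f <= a `^ (6 / 5) * k ^+ 2 + k ^+ 2 * (f * Num.sqrt f)
    + a `^ (6 / 5) * (f * Num.sqrt f).
Proof.
move=> a0 k0 f0; set X := a `^ (6 / 5); set Y := k ^+ 2; set Z := f * Num.sqrt f.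
have X0 : 0 <= X by exact: powR_ge0.
have Y0 : 0 <= Y by exact: sqr_ge0.
have Z0 : 0 <= Z by rewrite mulr_ge0 ?sqrtr_ge0.
have XY := mulr_ge0 X0 Y0; have YZ := mulr_ge0 Y0 Z0; have XZ := mulr_ge0 X0 Z0.
set m := _ + _ + _.
have m1 : X * Y <= m by rewrite /m; lra.
have m2 : Y * Z <= m by rewrite /m; lra.
have m3 : X * Z <= m by rewrite /m; lra.
have m0 : 0 <= m by rewrite (le_trans XY).
rewrite -(@ler_pXn2r _ 6)// ?nnegrE ?mulr_ge0//.
(* The exponents 1/3, 1/6 and 1/2 add up to 1 and become 2, 1 and 3 in sixth powers, so bounding
   each product by [m] gives [m^6]. *)
have E : (a * k * f) ^+ 6 = (X * Y) ^+ 2 * (Y * Z) * (X * Z) ^+ 3.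
  have Z2 : Z ^+ 2 = f ^+ 3 by rewrite exprMn sqr_sqrtr//; ring.
  transitivity (X ^+ 5 * Y ^+ 3 * (Z ^+ 2) ^+ 2); last by ring.
  by rewrite powR65_5// Z2 /Y; ring.
rewrite E (_ : m ^+ 6 = m ^+ 2 * m * m ^+ 3); last by ring.
apply: ler_pM; rewrite ?mulr_ge0 ?exprn_ge0//; last by rewrite lerXn2r ?nnegrE.
by apply: ler_pM; rewrite ?exprn_ge0// lerXn2r ?nnegrE.
Qed.

(** The exponents [6/5] and [6] are conjugate: with [X = a^(6/5)], [(a k)^6 = X^5 k^6], and both [X]
    and [k^6] are at most the sum. *)
Lemma young2 a k : 0 <= a -> 0 <= k -> a * k <= a `^ (6 / 5) + k ^+ 6.
Proof.
move=> a0 k0; set X := a `^ _.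
have X0 : 0 <= X by exact: powR_ge0.
have K0 : 0 <= k ^+ 6 by rewrite exprn_ge0.
set m := _ + _.
have m1 : X <= m by rewrite /m; lra.
have m2 : k ^+ 6 <= m by rewrite /m; lra.
have m0 : 0 <= m by rewrite (le_trans X0).
rewrite -(@ler_pXn2r _ 6)// ?nnegrE ?mulr_ge0// exprMn -powR65_5//.
rewrite (_ : m ^+ 6 = m ^+ 5 * m); last by ring.
by apply: ler_pM; rewrite ?exprn_ge0// lerXn2r ?nnegrE.
Qed.

Lemma kernN x : kern (- x) = kern x.
Proof.
rewrite /kern /eucl; congr (Num.sqrt _)^-1; apply: eq_bigr => i _.
by rewrite (_ : xcoord i (- x) = - xcoord i x) ?sqrrN//; move: i; apply: forall_ord3.
Qed.

Lemma kern_nearN x : kern_near (- x) = kern_near x.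
Proof.
rewrite /kern_near kernN !indicE; congr (_ * (nat_of_bool _)%:R).
by apply/idP/idP => /set_mem h; apply/mem_set; move: h; rewrite /cube/= normrN.
Qed.

Local Open Scope ereal_scope.
Local Notation P := (lebp3 \x lebp3)%E.

Lemma measurable_R3B : measurable_fun setT (fun z : R3 R * R3 R => (z.1 - z.2)%R : R3 R).
Proof.
have := @measurable_R3_comb R _ (R3 R * R3 R)%type (fun=> -1)%R snd fst (measurable_cst _) measurable_snd measurable_fst.
by congr measurable_fun; apply/funext => z; rewrite scaleN1r addrC.
Qed.

Lemma measurable_R3C : measurable_fun setT (fun z : R3 R * R3 R => (z.2 - z.1)%R : R3 R).
Proof.
have := @measurable_R3_comb R _ (R3 R * R3 R)%type (fun=> -1)%R fst snd (measurable_cst _) measurable_fst measurable_snd.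
by congr measurable_fun; apply/funext => z; rewrite scaleN1r addrC.
Qed.

Lemma integral_shift (f : R3 R -> \bar R) (d : R3 R) : measurable_fun setT f ->
  (forall x, 0 <= f x) -> \int[leb3]_x f (x + d)%R = \int[leb3]_x f x.
Proof.
move=> mf f0; have := @ge0_integral_affine3 _ 1%R d f ltr01 mf f0.
by rewrite expr1n invr1 mul1e => <-; apply: eq_integral => x _; rewrite scale1r.
Qed.

Lemma double_conv (X Y : R3 R -> \bar R) : measurable_fun setT X -> measurable_fun setT Y ->
  (forall x, 0 <= X x) -> (forall x, 0 <= Y x) ->
  \int[P]_z (X z.1 * Y (z.2 - z.1)%R) = \int[leb3]_x X x * \int[leb3]_x Y x.
Proof.
move=> mX mY X0 Y0.
have mXY : measurable_fun setT (fun z : R3 R * R3 R => X z.1 * Y (z.2 - z.1)%R).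
  apply: emeasurable_funM; first exact: (measurableT_comp mX measurable_fst).
  exact: (measurableT_comp mY measurable_R3C).
rewrite fubini_tonelli1//; last by move=> z; exact: mule_ge0.
rewrite /fubini_F/= -ge0_integralZr//; last exact: integral_ge0.
apply: eq_integral => x _.
rewrite ge0_integralZl//; last exact: (measurableT_comp mY (measurable_fun_pair2 x measurable_R3C)).
by congr (_ * _); exact: (integral_shift (- x)%R mY Y0).
Qed.

Lemma double_conv_sym (X Y : R3 R -> \bar R) : measurable_fun setT X -> measurable_fun setT Y ->
  (forall x, 0 <= X x) -> (forall x, 0 <= Y x) ->
  \int[P]_z (X z.2 * Y (z.1 - z.2)%R) = \int[leb3]_x X x * \int[leb3]_x Y x.
Proof.
move=> mX mY X0 Y0.
have mXY : measurable_fun setT (fun z : R3 R * R3 R => X z.2 * Y (z.1 - z.2)%R).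
  apply: emeasurable_funM; first exact: (measurableT_comp mX measurable_snd).
  exact: (measurableT_comp mY measurable_R3B).
rewrite fubini_tonelli2//; last by move=> z; exact: mule_ge0.
rewrite /fubini_G/= -ge0_integralZr//; last exact: integral_ge0.
apply: eq_integral => x _.
rewrite ge0_integralZl//; last exact: (measurableT_comp mY (measurable_fun_pair1 x measurable_R3B)).
by congr (_ * _); exact: (integral_shift (- x)%R mY Y0).
Qed.

Lemma double_prod (X Y : R3 R -> \bar R) : measurable_fun setT X -> measurable_fun setT Y ->
  (forall x, 0 <= X x) -> (forall x, 0 <= Y x) ->
  \int[P]_z (X z.1 * Y z.2) = \int[leb3]_x X x * \int[leb3]_x Y x.
Proof.
move=> mX mY X0 Y0.
have mXY : measurable_fun setT (fun z : R3 R * R3 R => X z.1 * Y z.2).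
  apply: emeasurable_funM; first exact: (measurableT_comp mX measurable_fst).
  exact: (measurableT_comp mY measurable_snd).
rewrite fubini_tonelli1//; last by move=> z; exact: mule_ge0.
rewrite /fubini_F/= -ge0_integralZr//; last exact: integral_ge0.
by apply: eq_integral => x _; rewrite ge0_integralZl.
Qed.

(** The near kernel is treated by [young3], the far kernel by [young2] multiplied by [v]. Each of
    the five resulting terms integrates to a product of two integrals, with bounds [64], [3 * 64],
    [3], [1] and [128]; their sum is 388. *)
Lemma pairing_normalized (psi v : R3 R -> R) :
  measurable_fun setT psi -> measurable_fun setT v ->
  (forall x, (0 <= psi x)%R) -> (forall x, (0 <= v x)%R) ->
  \int[leb3]_x (psi x `^ (6 / 5))%:E <= 1 -> \int[leb3]_x (v x)%:E <= 1 ->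
  \int[leb3]_x (v x * Num.sqrt (v x))%:E <= 3%:E ->
  \int[P]_z (psi z.1 * (v z.2 * kern (z.1 - z.2)))%:E <= 388%:E.
Proof.
move=> mpsi mv psi0 v0 I1 I2 I3.
pose X (x : R3 R) := (psi x `^ (6 / 5))%:E.
pose Y (x : R3 R) := (kern_near x ^+ 2)%:E.
pose Z (x : R3 R) := (v x * Num.sqrt (v x))%:E.
pose W (x : R3 R) := (kern_far x ^+ 6)%:E.
pose V (x : R3 R) := (v x)%:E.
have mX : measurable_fun setT X.
  apply/measurable_EFinP.
  have mp1 : measurable_fun setT (fun s : M => s `^ (6 / 5) : R)%R by exact: measurable_powR.
  exact: (measurableT_comp mp1 mpsi).
have mY : measurable_fun setT Y.
  by apply/measurable_EFinP; apply: measurable_funX; exact: measurable_kern_near.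
have mZ : measurable_fun setT Z.
  apply/measurable_EFinP; apply: measurable_funM => //.
  exact: (measurableT_comp (continuous_measurable_fun (@sqrt_continuous R)) mv).
have mW : measurable_fun setT W.
  by apply/measurable_EFinP; apply: measurable_funX; exact: measurable_kern_far.
have mV : measurable_fun setT V by exact/measurable_EFinP.
have X0 x : 0 <= X x by rewrite lee_fin powR_ge0.
have Y0 x : 0 <= Y x by rewrite lee_fin sqr_ge0.
have Z0 x : 0 <= Z x by rewrite lee_fin mulr_ge0 ?sqrtr_ge0.
have W0 x : 0 <= W x by rewrite lee_fin exprn_even_ge0.
have V0 x : 0 <= V x by rewrite lee_fin.
pose F1 (z : R3 R * R3 R) := X z.1 * Y (z.2 - z.1)%R.
pose F2 (z : R3 R * R3 R) := Z z.2 * Y (z.1 - z.2)%R.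
pose F3 (z : R3 R * R3 R) := X z.1 * Z z.2.
pose F4 (z : R3 R * R3 R) := X z.1 * V z.2.
pose F5 (z : R3 R * R3 R) := V z.2 * W (z.1 - z.2)%R.
have m1 : measurable_fun setT F1.
  apply: emeasurable_funM; first exact: (measurableT_comp mX measurable_fst).
  exact: (measurableT_comp mY measurable_R3C).
have m2 : measurable_fun setT F2.
  apply: emeasurable_funM; first exact: (measurableT_comp mZ measurable_snd).
  exact: (measurableT_comp mY measurable_R3B).
have m3 : measurable_fun setT F3.
  apply: emeasurable_funM; first exact: (measurableT_comp mX measurable_fst).
  exact: (measurableT_comp mZ measurable_snd).
have m4 : measurable_fun setT F4.
  apply: emeasurable_funM; first exact: (measurableT_comp mX measurable_fst).
  exact: (measurableT_comp mV measurable_snd).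
have m5 : measurable_fun setT F5.
  apply: emeasurable_funM; first exact: (measurableT_comp mV measurable_snd).
  exact: (measurableT_comp mW measurable_R3B).
have p1 (z : R3 R * R3 R) : 0 <= F1 z by exact: mule_ge0.
have p2 (z : R3 R * R3 R) : 0 <= F2 z by exact: mule_ge0.
have p3 (z : R3 R * R3 R) : 0 <= F3 z by exact: mule_ge0.
have p4 (z : R3 R * R3 R) : 0 <= F4 z by exact: mule_ge0.
have p5 (z : R3 R * R3 R) : 0 <= F5 z by exact: mule_ge0.
pose F := (((F1 \+ F2) \+ F3) \+ F4) \+ F5.
have m12 := emeasurable_funD m1 m2.
have m123 := emeasurable_funD m12 m3.
have m1234 := emeasurable_funD m123 m4.
have p12 (z : R3 R * R3 R) : 0 <= (F1 \+ F2) z by exact: adde_ge0.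
have p123 (z : R3 R * R3 R) : 0 <= ((F1 \+ F2) \+ F3) z by exact: adde_ge0.
have p1234 (z : R3 R * R3 R) : 0 <= (((F1 \+ F2) \+ F3) \+ F4) z by exact: adde_ge0.
apply: (@le_trans _ _ (\int[P]_z F z)).
  apply: ge0_le_integralT.
  - by move=> z; rewrite lee_fin !mulr_ge0// kern_ge0.
  - apply/measurable_EFinP; apply: measurable_funM; first exact: (measurableT_comp mpsi measurable_fst).
    apply: measurable_funM; first exact: (measurableT_comp mv measurable_snd).
    exact: (measurableT_comp measurable_kern measurable_R3B).
  - exact: emeasurable_funD.
  move=> z; rewrite /F /F1 /F2 /F3 /F4 /F5 /X /Y /Z /V /W.
  rewrite -[leRHS]/((psi z.1 `^ (6 / 5) * kern_near (z.2 - z.1) ^+ 2 +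
    v z.2 * Num.sqrt (v z.2) * kern_near (z.1 - z.2) ^+ 2 +
    psi z.1 `^ (6 / 5) * (v z.2 * Num.sqrt (v z.2)) +
    psi z.1 `^ (6 / 5) * v z.2 + v z.2 * kern_far (z.1 - z.2) ^+ 6)%:E) lee_fin.
  rewrite -(opprB z.1 z.2) kern_nearN kern_split.
  set d := (z.1 - z.2)%R.
  have kn : (0 <= kern_near d)%R by rewrite mulr_ge0 ?kern_ge0.
  have kf : (0 <= kern_far d)%R by rewrite mulr_ge0 ?kern_ge0.
  have := young3 (psi0 z.1) kn (v0 z.2); rewrite /= => Y3.
  have := ler_wpM2r (v0 z.2) (young2 (psi0 z.1) kf) => Y2.
  nra.
rewrite /F ge0_integralD// ge0_integralD// ge0_integralD// ge0_integralD//.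
rewrite /F1 /F2 /F3 /F4 /F5 !double_conv// !double_conv_sym// !double_prod//.
have IX0 : 0 <= \int[leb3]_x X x by exact: integral_ge0.
have IY0 : 0 <= \int[leb3]_x Y x by exact: integral_ge0.
have IZ0 : 0 <= \int[leb3]_x Z x by exact: integral_ge0.
have IV0 : 0 <= \int[leb3]_x V x by exact: integral_ge0.
have IW0 : 0 <= \int[leb3]_x W x by exact: integral_ge0.
have IY := @integral_kern_near R.
have IW := @integral_kern_far R.
apply: (@le_trans _ _ (1 * 64%:E + 3%:E * 64%:E + 1 * 3%:E + 1 * 1 + 1 * 128%:E)).
  by do 4 (apply: leeD; last exact: lee_pmul); exact: lee_pmul.
by rewrite -[leLHS]/((1 * 64 + 3 * 64 + 1 * 3 + 1 * 1 + 1 * 128)%:E) lee_fin; lra.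
Qed.

End Young.

(** * Pairing with the potential *)

Section AbsIntegral.
Local Open Scope ereal_scope.
Context d (T : measurableType d) (R : realType) (m : {measure set T -> \bar R}).

Lemma normr_Rintegral_le (f : T -> R) : measurable_fun setT f ->
  `|(\int[m]_x f x)%R|%:E <= \int[m]_x `|f x|%:E.
Proof.
move=> mf; have mfe : measurable_fun setT (EFin \o f) by exact/measurable_EFinP.
apply: le_trans (le_abse_integral m measurableT mfe); rewrite /Rintegral /comp.
by case: (\int[m]_x (f x)%:E) => [r| |] //=; rewrite ?normr0 ?lee_fin// leey.
Qed.

End AbsIntegral.

(** * Bounds by integrals over coordinate lines *)

Section SobolevLine.
Context {R : realType}.
Local Notation mu := (@lebesgue_measure R).
Local Notation M := (measurableTypeR R).
Implicit Types (x y z : R3 R) (u g : R3 R -> R) (i : 'I_3).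

Lemma measurable_line y (c : R3 R) : measurable_fun setT (fun s : M => (1 *: y + s *: c) : R3 R).
Proof.
have := @measurable_R3_comb R _ M id (fun=> c) (fun=> 1 *: y) (@measurable_id _ M setT)
  (measurable_cst _) (measurable_cst _).
by congr measurable_fun; apply/funext => s; rewrite addrC.
Qed.

Local Open Scope ereal_scope.

(** In [translation_identity] each integrand is bounded by [|a| <= c/2 + a^2 / (2c)] with
    [c = |u(y)| / 2]. The two constants add up to half of [|u(y)|] and are absorbed on the left;
    multiplying by [|u(y)|] and enlarging [[0, 1]] to the whole line gives the factor 2. *)
Lemma sobolev_line u g i : locint u -> locint g ->
  represents g (distr_pd i (distr_of u)) ->
  {ae leb3, forall y, (u y ^+ 2)%:E <=
    2%:E * \int[mu]_s (u (1 *: y + s *: Defs.basis i) ^+ 2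
                      + g (1 *: y + s *: Defs.basis i) ^+ 2)%:E}.
Proof.
move=> lu lg Hg; have := translation_identity lu lg Hg; apply: filterS => y E.
have [mu_ _] := lu; have [mg _] := lg.
pose U (s : M) := u (1 *: y + s *: Defs.basis i)%R.
pose G (s : M) := g (1 *: y + s *: Defs.basis i)%R.
have mU : measurable_fun setT U := measurableT_comp mu_ (measurable_line y (Defs.basis i)).
have mG : measurable_fun setT G := measurableT_comp mg (measurable_line y (Defs.basis i)).
pose c : R := (`|u y| / 2)%R.
have [u0|u0] := eqVneq (u y) 0%R.
  rewrite u0 expr0n/= mule_ge0//; apply: integral_ge0 => s _.
  by rewrite lee_fin addr_ge0 ?sqr_ge0.
have a0 : (0 < `|u y|)%R by rewrite normr_gt0.
have c0 : (0 < c)%R by rewrite divr_gt0.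
pose I : M -> R := \1_(`[0%R, 1%R]%classic).
have mI : measurable_fun setT I by exact: measurable_indic.
have I01 s : (0 <= I s <= 1)%R by rewrite /I indicE; case: (s \in _); rewrite ?lexx ?ler01.
have mS : measurable_fun setT (fun s : M => (1 - s)%R : R) by apply: measurable_funB.
have m1 : measurable_fun setT (fun s : M => I s * U s)%R by exact: measurable_funM.
have m2 : measurable_fun setT (fun s : M => I s * (1 - s) * G s)%R.
  by apply: measurable_funM => //; exact: measurable_funM.
have mUG : measurable_fun setT (fun s : M => U s ^+ 2 + G s ^+ 2)%R.
  by apply: measurable_funD; exact: measurable_funX.
set L := \int[mu]_s _.
have L0 : 0 <= L by apply: integral_ge0 => s _; rewrite lee_fin addr_ge0 ?sqr_ge0.
have H : `|u y|%:E <= c%:E + ((2 * c)^-1)%:E * L.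
  apply: (@le_trans _ _ (\int[mu]_s `|I s * U s|%:E + \int[mu]_s `|I s * (1 - s) * G s|%:E)).
    rewrite E; apply: le_trans (leeD (normr_Rintegral_le _ m1) (normr_Rintegral_le _ m2)).
    by rewrite -EFinD lee_fin; exact: ler_normB.
  rewrite -ge0_integralD//; last 2 first.
  - by apply/measurable_EFinP; exact: measurableT_comp.
  - by apply/measurable_EFinP; exact: measurableT_comp.
  apply: (@le_trans _ _ (\int[mu]_s ((c * I s)%:E + ((2 * c)^-1 * (U s ^+ 2 + G s ^+ 2))%:E))).
    apply: ge0_le_integralT.
    - by move=> s; rewrite -EFinD lee_fin addr_ge0.
    - by apply: emeasurable_funD; apply/measurable_EFinP; exact: measurableT_comp.
    - by apply: emeasurable_funD; apply/measurable_EFinP; exact: measurable_funM.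
    move=> s; rewrite -!EFinD lee_fin.
    have K (a : R) : (`|a| <= c / 2 + (2 * c)^-1 * a ^+ 2)%R.
      rewrite -subr_ge0 -(real_normK (num_real a)).
      rewrite (_ : _ - _ = (2 * c)^-1 * (c - `|a|) ^+ 2)%R; last by field; rewrite gt_eqF.
      by rewrite mulr_ge0 ?sqr_ge0// invr_ge0; lra.
    have q0 : (0 <= (2 * c)^-1)%R by rewrite invr_ge0; lra.
    have [] := boolP (s \in (`[0%R, 1%R]%classic : set R)) => hs.
      have /andP[s0 s1] : (0 <= s <= 1)%R by move/set_mem: hs; rewrite /= in_itv.
      rewrite /I indicE hs !mul1r mulr1 mulrDr.
      have := K (U s); have := K (G s).
      have : (`|(1 - s) * G s| <= `|G s|)%R.
        by rewrite normrM ler_piMl// ger0_norm; lra.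
      lra.
    rewrite /I indicE (negbTE hs) !mul0r normr0 !add0r mulr0 add0r mulr_ge0// addr_ge0 ?sqr_ge0//.
  rewrite ge0_integralD//; last 4 first.
  - by move=> s _; rewrite lee_fin mulr_ge0 ?(ltW c0)//; case/andP: (I01 s).
  - by apply/measurable_EFinP; exact: measurable_funM.
  - by move=> s _; rewrite lee_fin mulr_ge0 ?addr_ge0 ?sqr_ge0 ?invr_ge0//; lra.
  - by apply/measurable_EFinP; exact: measurable_funM.
  have mUGe : measurable_fun setT (fun s : M => (U s ^+ 2 + G s ^+ 2)%:E) by exact/measurable_EFinP.
  have UG0 (s : M) : setT s -> 0 <= (U s ^+ 2 + G s ^+ 2)%:E.
    by move=> _; rewrite lee_fin addr_ge0 ?sqr_ge0.
  have q0 : (0 <= (2 * c)^-1)%R by rewrite invr_ge0; lra.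
  apply: leeD; last first.
    by rewrite (eq_integral _ _ (fun s _ => EFinM _ _)) (ge0_integralZl_EFin mu measurableT UG0 mUGe q0).
  rewrite (eq_integral _ _ (fun s _ => EFinM _ _)) ge0_integralZl_EFin//; last 3 first.
  - by move=> s _; rewrite lee_fin; case/andP: (I01 s).
  - exact/measurable_EFinP.
  - exact: ltW.
  rewrite integral_indic// setIT (_ : _ `[0%R, 1%R]%classic = 1%:E); last first.
    transitivity (mu `[0%R, 1%R]); first by [].
    by rewrite lebesgue_measure_itv/= lte_fin ltr01 oppr0 adde0.
  by rewrite -[leLHS]/((c * 1)%:E) mulr1.
have c2 : (2 * c = `|u y|)%R by rewrite /c; field.
move: H L0; case: L => [r| |]//.
  rewrite -!EFinM -EFinD !lee_fin c2 => H r0.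
  rewrite -(real_normK (num_real (u y))).
  have := ler_wpM2l (ltW a0) H; rewrite mulrDr mulrA divff ?gt_eqF// mul1r /c => H'.
  lra.
by move=> _ _; rewrite gt0_muley ?leey// lte_fin.
Qed.

End SobolevLine.

Section CoordinateLines.
Context {R : realType}.
Local Notation mu := (@lebesgue_measure R).
Local Notation M := (measurableTypeR R).
Implicit Types (h : R3 R -> \bar R).
Local Open Scope ereal_scope.

Lemma ge0_integral_shift1 (f g : R -> \bar R) (a : R) : measurable_fun setT f ->
  (forall s, 0 <= f s) -> (forall s, g s = f (1 * s + a)%R) ->
  \int[mu]_s g s = \int[mu]_s f s.
Proof.
move=> mf f0 gE; have := @ge0_integral_affine1 R 1%R a f ltr01 mf f0.
by rewrite invr1 mul1e => <-; apply: eq_integral => s _; exact: gE.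
Qed.

Lemma integral_line0 h (a b c : R) : measurable_fun setT h -> (forall x, 0 <= h x) ->
  \int[mu]_s h (1 *: (a, b, c) + s *: Defs.basis (Ordinal (isT : (0 < 3)%N)))%R = \int[mu]_t h (t, b, c).
Proof.
move=> mh h0; apply: (ge0_integral_shift1 (a := a)) => // [|s].
  by apply: (measurableT_comp mh); exact: measurable_R3.
congr h; transitivity (((1 * a + s * 1, 1 * b + s * 0, 1 * c + s * 0) : R3 R))%R => //.
by congr (_, _, _); ring.
Qed.

Lemma integral_line1 h (a b c : R) : measurable_fun setT h -> (forall x, 0 <= h x) ->
  \int[mu]_s h (1 *: (a, b, c) + s *: Defs.basis (Ordinal (isT : (1 < 3)%N)))%R = \int[mu]_t h (a, t, c).
Proof.
move=> mh h0; apply: (ge0_integral_shift1 (a := b)) => // [|s].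
  by apply: (measurableT_comp mh); exact: measurable_R3.
congr h; transitivity (((1 * a + s * 0, 1 * b + s * 1, 1 * c + s * 0) : R3 R))%R => //.
by congr (_, _, _); ring.
Qed.

Lemma integral_line2 h (a b c : R) : measurable_fun setT h -> (forall x, 0 <= h x) ->
  \int[mu]_s h (1 *: (a, b, c) + s *: Defs.basis (Ordinal (isT : (2 < 3)%N)))%R = \int[mu]_t h (a, b, t).
Proof.
move=> mh h0; apply: (ge0_integral_shift1 (a := c)) => // [|s].
  by apply: (measurableT_comp mh); exact: measurable_R3.
congr h; transitivity (((1 * a + s * 0, 1 * b + s * 0, 1 * c + s * 1) : R3 R))%R => //.
by congr (_, _, _); ring.
Qed.

(** When the integral is infinite, both sides are the default value 0. *)
Lemma Lnormr_powR (q : R) (f : R3 R -> R) : (0 < q)%R ->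
  (Lnormr q f `^ q)%R = fine (\int[leb3]_x (`|f x| `^ q)%:E).
Proof.
move=> q0; rewrite (eq_integral (fun x => `|(EFin \o f) x| `^ q)); last by [].
rewrite -powR_Lnorm ?gt_eqF// /Lnormr.
have := Lnorm_ge0 leb3 q%:E (EFin \o f).
case: ('N[leb3]_q%:E[EFin \o f]) => [r| |]//= _.
by rewrite powR0 ?gt_eqF// poweRyr// gt_eqF.
Qed.

End CoordinateLines.

(** * Measurability and finiteness for [H1] functions *)

Section H1facts.
Context {R : realType}.
Local Notation mu := (@lebesgue_measure R).
Local Notation M := (measurableTypeR R).
Implicit Types (u : R3 R -> R[i]) (i : 'I_3).

Lemma cabs_sqr u x : cabs u x ^+ 2 = reC u x ^+ 2 + imC u x ^+ 2.
Proof.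
rewrite /cabs /reC /imC; case: (u x) => a b /=.
by rewrite sqr_sqrtr// addr_ge0 ?sqr_ge0.
Qed.

Lemma cabs_ge0 u x : 0 <= cabs u x.
Proof. by rewrite /cabs; case: (u x) => a b; exact: sqrtr_ge0. Qed.

Lemma grad_abs_sqr u x : grad_abs u x ^+ 2 = \sum_(i < 3) cabs (wpd i u) x ^+ 2.
Proof. by rewrite /grad_abs sqr_sqrtr// sumr_ge0// => i _; rewrite sqr_ge0. Qed.

Lemma pd_cabs_le u i x :
  reC u x ^+ 2 + reC (wpd i u) x ^+ 2 + (imC u x ^+ 2 + imC (wpd i u) x ^+ 2)
  <= cabs u x ^+ 2 + grad_abs u x ^+ 2.
Proof.
have H : cabs (wpd i u) x ^+ 2 <= grad_abs u x ^+ 2.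
  rewrite (grad_abs_sqr u x) (bigD1 i) //= lerDl.
  by apply: sumr_ge0 => j _; exact: sqr_ge0.
have E1 := cabs_sqr u x; have E2 := cabs_sqr (wpd i u) x.
move: H E1 E2.
move: (cabs (wpd i u) x) (grad_abs u x) (cabs u x) (reC u x) (imC u x)
  (reC (wpd i u) x) (imC (wpd i u) x) => a b c d e f g.
lra.
Qed.

Lemma wpdP u i : H1 u -> is_wpd i u (wpd i u).
Proof. by move=> [_ /(_ i)[g Hg]]; apply: (xgetPex (fun=> 0) (P := [set g | is_wpd i u g])); exists g. Qed.

Lemma L2C_measurable u : L2C u -> measurable_fun setT (cabs u).
Proof.
move=> [/Lq_measurable m1 /Lq_measurable m2].
rewrite (_ : cabs u = Num.sqrt \o (fun x => reC u x ^+ 2 + imC u x ^+ 2)).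
  apply: (measurableT_comp (continuous_measurable_fun (@sqrt_continuous R))).
  by apply: measurable_funD; exact: measurable_funX.
by apply/funext => x /=; rewrite -cabs_sqr sqrtr_sqr ger0_norm// cabs_ge0.
Qed.

Local Open Scope ereal_scope.

Lemma Lq2_lty (f : R3 R -> R) : Lq 2 f -> \int[leb3]_x (f x ^+ 2)%:E < +oo.
Proof.
move=> lf; have := Lq_integrable (ler1n _ 2) lf => /integrableP[_].
congr (_ < _); apply: eq_integral => x _.
by rewrite abse_EFin ger0_norm ?powR_ge0// powR_mulrn// real_normK// num_real.
Qed.

Lemma L2C_lty u : L2C u -> \int[leb3]_x (cabs u x ^+ 2)%:E < +oo.
Proof.
move=> [l1 l2].
rewrite (eq_integral (fun x => (reC u x ^+ 2)%:E + (imC u x ^+ 2)%:E)); last first.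
  by move=> x _; rewrite cabs_sqr.
rewrite ge0_integralD//; last 4 first.
- by move=> x _; rewrite lee_fin sqr_ge0.
- by apply/measurable_EFinP; apply: measurable_funX; exact: Lq_measurable l1.
- by move=> x _; rewrite lee_fin sqr_ge0.
- by apply/measurable_EFinP; apply: measurable_funX; exact: Lq_measurable l2.
by apply: lte_add_pinfty; exact: Lq2_lty.
Qed.

Lemma Lnormr2_sqr (f : R3 R -> R) : (forall x, (0 <= f x)%R) ->
  \int[leb3]_x (f x ^+ 2)%:E < +oo ->
  \int[leb3]_x (f x ^+ 2)%:E = (Lnormr 2 f ^+ 2)%:E.
Proof.
move=> f0 fi; have L0 : (0 <= Lnormr 2 f)%R by rewrite fine_ge0// Lnorm_ge0.
rewrite -powR_mulrn// Lnormr_powR//.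
rewrite (_ : \int[leb3]_x (`|f x| `^ 2)%:E = \int[leb3]_x (f x ^+ 2)%:E).
  by rewrite fineK// ge0_fin_numE//; apply: integral_ge0 => x _; rewrite lee_fin sqr_ge0.
by apply: eq_integral => x _; rewrite powR_mulrn// real_normK// num_real.
Qed.

Lemma measurable_grad_abs u : H1 u -> measurable_fun setT (fun x => grad_abs u x ^+ 2)%R.
Proof.
move=> hu; under eq_fun do rewrite grad_abs_sqr.
apply: measurable_sum => i; apply: measurable_funX; apply: L2C_measurable.
by case: (wpdP i hu).
Qed.

Lemma grad_abs_lty u : H1 u -> \int[leb3]_x (grad_abs u x ^+ 2)%:E < +oo.
Proof.
move=> hu.
have mi i : measurable_fun setT (fun x => (cabs (wpd i u) x ^+ 2)%:E).
  apply/measurable_EFinP; apply: measurable_funX; apply: L2C_measurable.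
  by case: (wpdP i hu).
have pi i x : 0 <= (cabs (wpd i u) x ^+ 2)%:E by rewrite lee_fin sqr_ge0.
have li i : \int[leb3]_x (cabs (wpd i u) x ^+ 2)%:E < +oo.
  by apply: L2C_lty; case: (wpdP i hu).
rewrite (eq_integral (fun x => \sum_(i < 3) (cabs (wpd i u) x ^+ 2)%:E)); last first.
  by move=> x _; rewrite grad_abs_sqr sumEFin.
rewrite ge0_integral_sum//.
by apply: lte_sum_pinfty => i _; exact: li.
Qed.

Lemma integral_cabs_sqr u : L2C u -> \int[leb3]_x (cabs u x ^+ 2)%:E = (LnormC 2 u ^+ 2)%:E.
Proof. by move=> lu; apply: Lnormr2_sqr; [exact: cabs_ge0|exact: L2C_lty]. Qed.

Lemma integral_grad_sqr u : H1 u -> \int[leb3]_x (grad_abs u x ^+ 2)%:E = (grad2 u ^+ 2)%:E.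
Proof.
by move=> hu; apply: Lnormr2_sqr; [move=> x; exact: sqrtr_ge0|exact: grad_abs_lty].
Qed.

Lemma H1_line u : H1 u -> {ae leb3, forall y, forall i, (cabs u y ^+ 2)%:E <=
  2%:E * \int[mu]_s (cabs u (1 *: y + s *: Defs.basis i) ^+ 2
                      + grad_abs u (1 *: y + s *: Defs.basis i) ^+ 2)%:E}.
Proof.
move=> hu; have lu : L2C u by case: hu.
have l12 := ler1n R 2.
apply: filter_forall => i.
have [[lw1 lw2] r1 r2] := wpdP i hu; have [lu1 lu2] := lu.
have S1 := sobolev_line (Lq_locint l12 lu1) (Lq_locint l12 lw1) r1.
have S2 := sobolev_line (Lq_locint l12 lu2) (Lq_locint l12 lw2) r2.
have m1 := Lq_measurable lu1; have m2 := Lq_measurable lu2.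
have m3 := Lq_measurable lw1; have m4 := Lq_measurable lw2.
apply: filterS2 S1 S2 => y H1 H2.
have ml := measurable_line y (Defs.basis i).
pose A (s : M) := (reC u (1 *: y + s *: Defs.basis i)%R ^+ 2 + reC (wpd i u) (1 *: y + s *: Defs.basis i)%R ^+ 2)%:E.
pose B (s : M) := (imC u (1 *: y + s *: Defs.basis i)%R ^+ 2 + imC (wpd i u) (1 *: y + s *: Defs.basis i)%R ^+ 2)%:E.
have mA : measurable_fun setT A.
  by apply/measurable_EFinP; apply: measurable_funD; apply: measurable_funX; [exact: measurableT_comp m1 ml|exact: measurableT_comp m3 ml].
have mB : measurable_fun setT B.
  by apply/measurable_EFinP; apply: measurable_funD; apply: measurable_funX; [exact: measurableT_comp m2 ml|exact: measurableT_comp m4 ml].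
have A0 s : setT s -> 0 <= A s by move=> _; rewrite lee_fin addr_ge0 ?sqr_ge0.
have B0 s : setT s -> 0 <= B s by move=> _; rewrite lee_fin addr_ge0 ?sqr_ge0.
rewrite cabs_sqr EFinD; apply: le_trans (leeD H1 H2) _.
rewrite -ge0_muleDr ?integral_ge0// lee_pmul2l// -ge0_integralD//.
apply: ge0_le_integralT.
- by move=> s; rewrite adde_ge0 ?A0 ?B0.
- exact: emeasurable_funD.
- apply/measurable_EFinP; apply: measurable_funD.
    by apply: measurable_funX; exact: (measurableT_comp (L2C_measurable lu) ml).
  exact: (measurableT_comp (measurable_grad_abs hu) ml).
by move=> s; have := pd_cabs_le u i (1 *: y + s *: Defs.basis i)%R; rewrite -lee_fin.
Qed.

End H1facts.

Section Pairing.
Context {R : realType}.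
Local Notation mu := (@lebesgue_measure R).
Local Notation M := (measurableTypeR R).
Implicit Types (u : R3 R -> R[i]) (i : 'I_3) (psi : R3 R -> R).

Lemma H1norm2_ge0 u : 0 <= H1norm2 u.
Proof. by rewrite addr_ge0 ?sqr_ge0. Qed.

Local Open Scope ereal_scope.

(* [v] vanishes on the null set of [H1_line], so that the line bounds required
   by [loomis_whitney] hold everywhere. *)
Lemma H1_L3 u (B : R) : H1 u -> (H1norm2 u < B)%R -> exists v : R3 R -> R,
  [/\ measurable_fun setT v /\ (forall x, (0 <= v x)%R),
      {ae leb3, forall x, v x = (cabs u x ^+ 2 / B)%R},
      \int[leb3]_x (v x)%:E <= 1 & \int[leb3]_x (v x * Num.sqrt (v x))%:E <= 3%:E].
Proof.
move=> hu HB; have lu : L2C u by case: hu.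
have B0 : (0 < B)%R := le_lt_trans (H1norm2_ge0 u) HB.
have [N [mN N0 HN]] := H1_line hu.
pose v x := (cabs u x ^+ 2 / B * \1_(~` N) x)%R.
(* The 2 is the factor of [H1_line]. Dividing by [B] makes the integral of [h] at most 2, so that
   Loomis-Whitney yields [(2 + 2 * 2) / 2 = 3]. *)
pose h x := (2 / B * (cabs u x ^+ 2 + grad_abs u x ^+ 2))%:E.
have mc : measurable_fun setT (fun x => cabs u x ^+ 2)%R.
  by apply: measurable_funX; exact: L2C_measurable.
have mg := measurable_grad_abs hu.
have mv : measurable_fun setT v.
  apply: measurable_funM; first by apply: measurable_funM.
  by apply: measurable_indic; exact: measurableC.
have v0 x : (0 <= v x)%R.
  by apply: mulr_ge0; [rewrite divr_ge0 ?sqr_ge0// ltW|rewrite indicE; case: (_ \in _)].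
have mcg : measurable_fun setT (fun x => (cabs u x ^+ 2 + grad_abs u x ^+ 2)%:E).
  by apply/measurable_EFinP; exact: measurable_funD.
have cg0 x : 0 <= (cabs u x ^+ 2 + grad_abs u x ^+ 2)%:E by rewrite lee_fin addr_ge0 ?sqr_ge0.
have q0 : (0 <= 2 / B)%R by rewrite divr_ge0// ltW.
have mh : measurable_fun setT h.
  by apply/measurable_EFinP; apply: measurable_funM => //; exact/measurable_EFinP.
have h0 x : 0 <= h x by rewrite lee_fin mulr_ge0// addr_ge0 ?sqr_ge0.
have Ih : \int[leb3]_x h x = (2 / B * H1norm2 u)%:E.
  rewrite (eq_integral _ _ (fun x _ => EFinM _ _)) ge0_integralZl_EFin//.
  rewrite (eq_integral _ _ (fun x _ => EFinD _ _)) ge0_integralD//; last 4 first.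
  - by move=> x _; rewrite lee_fin sqr_ge0.
  - exact/measurable_EFinP.
  - by move=> x _; rewrite lee_fin sqr_ge0.
  - exact/measurable_EFinP.
  by rewrite integral_cabs_sqr// integral_grad_sqr// -EFinD -EFinM addrC.
have Ih2 : \int[leb3]_x h x <= 2%:E.
  rewrite Ih lee_fin mulrAC -mulrA ger_pMr// ler_pdivrMr// mul1r; exact: ltW.
have Hv y i : (v y)%:E <= \int[mu]_s h (1 *: y + s *: Defs.basis i)%R.
  have [yN|yN] := boolP (y \in ~` N); last first.
    by rewrite /v indicE (negbTE yN) mulr0 integral_ge0.
  rewrite /v indicE yN mulr1.
  have ml := measurable_line y (Defs.basis i).
  have := ge0_integralZl_EFin mu measurableT (fun s _ => cg0 (1 *: y + s *: Defs.basis i)%R)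
    (measurableT_comp mcg ml) q0.
  rewrite -(eq_integral _ _ (fun s _ => EFinM _ _)) => ->.
  have Hy : (cabs u y ^+ 2)%:E <=
    2%:E * \int[mu]_s (cabs u (1 *: y + s *: Defs.basis i) ^+ 2
                      + grad_abs u (1 *: y + s *: Defs.basis i) ^+ 2)%:E.
    move/set_mem: yN; apply: contra_notP => K; apply: HN => /= Hi.
    by apply: K; exact: Hi.
  have Bi0 : 0 <= B^-1%:E by rewrite lee_fin invr_ge0 ltW.
  by have := lee_wpmul2l Bi0 Hy; rewrite muleA -!EFinM (mulrC B^-1 2)%R (mulrC B^-1 _)%R.
exists v; split => //.
- exists N; split => // x /= H; apply: contrapT => xN; apply: H.
  by rewrite /v indicE mem_set// mulr1.
- apply: (@le_trans _ _ (\int[leb3]_x (B^-1 * (cabs u x ^+ 2))%:E)).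
    apply: ge0_le_integralT => //.
    - exact/measurable_EFinP.
    - by apply/measurable_EFinP; exact: measurable_funM.
    move=> x; rewrite lee_fin /v mulrC (mulrC (cabs _ _ ^+ 2)%R).
    apply: ler_piMl; first by rewrite mulr_ge0 ?invr_ge0 ?sqr_ge0// ltW.
    by rewrite indicE; case: (_ \in _).
  rewrite (eq_integral _ _ (fun x _ => EFinM _ _)) ge0_integralZl_EFin//; last 3 first.
  - by move=> x _; rewrite lee_fin sqr_ge0.
  - exact/measurable_EFinP.
  - by rewrite invr_ge0 ltW.
  rewrite integral_cabs_sqr// -EFinM lee_fin mulrC ler_pdivrMr// mul1r (le_trans _ (ltW HB))//.
  by rewrite lerDr sqr_ge0.
apply: (@le_trans _ _ (2^-1%:E * (\int[leb3]_x h x + \int[leb3]_x h x * \int[leb3]_x h x))).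
  apply: (loomis_whitney mv v0 mh h0) => a b c.
  - by rewrite -(integral_line0 a b c mh h0).
  - by rewrite -(integral_line1 a b c mh h0).
  - by rewrite -(integral_line2 a b c mh h0).
have Ip : 0 <= \int[leb3]_x h x by exact: integral_ge0.
apply: (@le_trans _ _ (2^-1%:E * (2%:E + 2%:E * 2%:E))).
  by apply: lee_pmul => //; [rewrite adde_ge0// mule_ge0|apply: leeD => //; exact: lee_pmul].
by rewrite -[leLHS]/((2^-1 * (2 + 2 * 2))%:E) lee_fin; lra.
Qed.

(** The potential with values in [[0, +oo]]; [S0] replaces an infinite value by 0, so upper bounds
    for [S0e] pass to [S0]. *)
Definition S0e u (x : R3 R) : \bar R := \int[leb3]_y (cabs u y ^+ 2 / (8 * pi * eucl (x - y)))%:E.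

Lemma S0_ge0 u x : (0 <= S0 u x)%R.
Proof.
rewrite /S0 /Rintegral fine_ge0//; apply: integral_ge0 => y _.
by rewrite lee_fin divr_ge0 ?sqr_ge0// !mulr_ge0 ?pi_ge0// eucl_ge0.
Qed.

Lemma S0_integrandE u x y : (cabs u y ^+ 2 / (8 * pi * eucl (x - y)) =
  (8 * pi)^-1 * (cabs u y ^+ 2 * kern (x - y)))%R.
Proof. by rewrite /kern invfM; ring. Qed.

Lemma measurable_S0e u : L2C u -> measurable_fun setT (S0e u).
Proof.
move=> lu.
have mF : measurable_fun setT (fun z : R3 R * R3 R =>
    (cabs u z.2 ^+ 2 / (8 * pi * eucl (z.1 - z.2)))%:E).
  apply/measurable_EFinP; under eq_fun do rewrite S0_integrandE.
  apply: measurable_funM => //; apply: measurable_funM.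
    by apply: measurable_funX; exact: (measurableT_comp (L2C_measurable lu) measurable_snd).
  exact: (measurableT_comp measurable_kern measurable_R3B).
apply: (@measurable_fun_fubini_tonelli_F _ _ _ _ _ lebp3 _ mF) => z.
by rewrite lee_fin divr_ge0 ?sqr_ge0// !mulr_ge0 ?pi_ge0// eucl_ge0.
Qed.

Lemma measurable_S0 u : L2C u -> measurable_fun setT (S0 u).
Proof.
move=> lu; apply: (measurableT_comp (@fine_measurable R setT measurableT)).
exact: measurable_S0e.
Qed.

Lemma S0_le u x : (S0 u x)%:E <= S0e u x.
Proof.
rewrite /S0 /Rintegral -/(S0e u x).
have : 0 <= S0e u x.
  apply: integral_ge0 => y _.
  by rewrite lee_fin divr_ge0 ?sqr_ge0// !mulr_ge0 ?pi_ge0// eucl_ge0.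
by case: (S0e u x) => [r| |]//= _; exact: leey.
Qed.

(** The normalized estimate for [|psi| / A] and [|u|^2 / B]. Taking [A] and [B] strictly above the
    norms makes them positive, so that division is possible even when a norm is 0. *)
Lemma S0_pairing_lt u psi (A B : R) : H1 u -> Lq (6 / 5) psi ->
  (Lnormr (6 / 5) psi < A)%R -> (H1norm2 u < B)%R ->
  \int[leb3]_x (S0 u x * `|psi x|)%:E <= (388 / (8 * pi) * (A * B))%:E.
Proof.
move=> hu lpsi HA HB; have lu : L2C u by case: hu.
have L0 : (0 <= Lnormr (6 / 5) psi)%R by rewrite fine_ge0// Lnorm_ge0.
have A0 : (0 < A)%R := le_lt_trans L0 HA.
have B0 : (0 < B)%R := le_lt_trans (H1norm2_ge0 u) HB.
have mpsi := Lq_measurable lpsi.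
have [v [[mv v0] ve Iv Iv3]] := H1_L3 hu HB.
pose f x := (`|psi x| / A)%R.
have mf : measurable_fun setT f by apply: measurable_funM => //; exact: measurableT_comp.
have f0 x : (0 <= f x)%R by rewrite divr_ge0// ltW.
have If : \int[leb3]_x (f x `^ (6 / 5))%:E <= 1.
  rewrite (eq_integral (fun x => (A^-1 `^ (6 / 5))%:E * (`|psi x| `^ (6 / 5))%:E)); last first.
    by move=> x _; rewrite -EFinM /f mulrC powRM// invr_ge0 ltW.
  rewrite ge0_integralZl_EFin//; last 2 first.
  - apply/measurable_EFinP.
    have mp1 : measurable_fun setT (fun s : M => s `^ (6 / 5) : R)%R by exact: measurable_powR.
    by apply: (measurableT_comp mp1); exact: measurableT_comp.
  - exact: powR_ge0.
  have l65 : (1 <= 6 / 5 :> R)%R by lra.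
  have := Lnormr_powR psi (lt_le_trans ltr01 l65).
  have := integrable_fin_num measurableT (Lq_integrable l65 lpsi).
  set I := \int[leb3]_x _; move=> If1 E; rewrite -(fineK If1).
  rewrite -E -EFinM -powRM ?invr_ge0 ?(ltW A0)// lee_fin.
  have h1 : (A^-1 * Lnormr (6 / 5) psi <= 1)%R by rewrite mulrC ler_pdivrMr// mul1r ltW.
  have h0 : (0 <= A^-1 * Lnormr (6 / 5) psi)%R by rewrite mulr_ge0// invr_ge0 ltW.
  have := @ge0_ler_powR R (6 / 5)%R (le_trans ler01 l65) _ 1%R h0 ler01 h1.
  by rewrite powR1.
have := pairing_normalized mf mv f0 v0 If Iv Iv3.
set K := \int[_]_z _ => HK.
have mfv : measurable_fun setT (fun z : R3 R * R3 R => (f z.1 * (v z.2 * kern (z.1 - z.2)))%:E).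
  apply/measurable_EFinP; apply: measurable_funM; first exact: (measurableT_comp mf measurable_fst).
  apply: measurable_funM; first exact: (measurableT_comp mv measurable_snd).
  exact: (measurableT_comp measurable_kern measurable_R3B).
have fv0 (z : R3 R * R3 R) : 0 <= (f z.1 * (v z.2 * kern (z.1 - z.2)))%:E.
  by rewrite lee_fin; apply: mulr_ge0 => //; apply: mulr_ge0 => //; exact: kern_ge0.
have p0 : (0 < pi :> R)%R by exact: pi_gt0.
have c0 : (0 <= A * B / (8 * pi))%R by rewrite divr_ge0 ?mulr_ge0// ltW.
apply: (@le_trans _ _ ((A * B / (8 * pi))%:E * K)); last first.
  rewrite (_ : (388 / (8 * pi) * (A * B))%:E = (A * B / (8 * pi))%:E * 388%:E).
    by apply: lee_wpmul2l.
  by rewrite -EFinM; congr EFin; ring.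
have EK : K = \int[lebp3]_x \int[lebp3]_y (f x * (v y * kern (x - y)))%:E.
  exact: (@fubini_tonelli1 _ _ _ _ _ lebp3 lebp3 _ mfv fv0).
rewrite EK.
have mF : measurable_fun setT (fun x => \int[lebp3]_y (f x * (v y * kern (x - y)))%:E).
  exact: (@measurable_fun_fubini_tonelli_F _ _ _ _ _ lebp3 _ mfv).
have F0 x : 0 <= \int[lebp3]_y (f x * (v y * kern (x - y)))%:E.
  by apply: integral_ge0 => y _; rewrite lee_fin; apply: mulr_ge0 => //; apply: mulr_ge0 => //; exact: kern_ge0.
rewrite -ge0_integralZl_EFin//.
apply: ge0_le_integralT.
- by move=> x; rewrite lee_fin mulr_ge0// S0_ge0.
- apply/measurable_EFinP; apply: measurable_funM; first exact: measurable_S0.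
  exact: measurableT_comp.
- exact: emeasurable_funM.
move=> x;
have mk : measurable_fun setT (fun y => v y * kern (x - y))%R.
  apply: measurable_funM => //.
  exact: (measurableT_comp measurable_kern (measurable_fun_pair2 x measurable_R3B)).
have k0 y : 0 <= (v y * kern (x - y))%:E by rewrite lee_fin mulr_ge0// kern_ge0.
have q0 : (0 <= B / (8 * pi))%R by rewrite divr_ge0 ?mulr_ge0// ltW.
have E : S0e u x = (B / (8 * pi))%:E * \int[lebp3]_y (v y * kern (x - y))%:E.
  rewrite -ge0_integralZl_EFin//; last exact/measurable_EFinP.
  apply: ae_eq_integral => //.
  - apply/measurable_EFinP; under eq_fun do rewrite S0_integrandE.
    apply: measurable_funM => //; apply: measurable_funM.
      by apply: measurable_funX; exact: L2C_measurable.
    exact: (measurableT_comp measurable_kern (measurable_fun_pair2 x measurable_R3B)).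
  - by apply/measurable_EFinP; exact: measurable_funM.
  apply: filterS ve => y vE _; rewrite -EFinM S0_integrandE vE; congr EFin.
  set k := kern _; set c := (8 * pi)^-1%R; set a := (_ ^+ 2)%R.
  transitivity (c * (a * k) * (B / B))%R; last by ring.
  by rewrite divff ?mulr1// gt_eqF.
have -> : \int[lebp3]_y (f x * (v y * kern (x - y)))%:E =
    (f x)%:E * \int[lebp3]_y (v y * kern (x - y))%:E.
  by rewrite -ge0_integralZl_EFin//; exact/measurable_EFinP.
rewrite muleA -EFinM (_ : (A * B / (8 * pi) * f x) = `|psi x| * (B / (8 * pi)))%R; last first.
  rewrite /f; set c := (8 * pi)^-1%R.
  transitivity (`|psi x| * (B * c) * (A / A))%R; first by ring.
  by rewrite divff ?mulr1// gt_eqF.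
rewrite (EFinM `|psi x|) -muleA -E mulrC EFinM.
by apply: lee_wpmul2l; [rewrite lee_fin|exact: S0_le].
Qed.

Definition S0_cst : R := 388 / (8 * pi).

Lemma S0_cst_ge0 : (0 <= S0_cst)%R.
Proof. by apply: divr_ge0; [exact: ler0n|apply: mulr_ge0; [exact: ler0n|exact: pi_ge0]]. Qed.

(** The limit of [S0_pairing_lt] as [A] and [B] decrease to the norms. *)
Lemma S0_pairing u psi : H1 u -> Lq (6 / 5) psi ->
  \int[leb3]_x (S0 u x * `|psi x|)%:E <= (S0_cst * (Lnormr (6 / 5) psi * H1norm2 u))%:E.
Proof.
move=> hu lpsi; have H := S0_pairing_lt hu lpsi; move: H; rewrite -/S0_cst.
have a0 : (0 <= Lnormr (6 / 5) psi)%R by rewrite fine_ge0// Lnorm_ge0.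
have b0 := H1norm2_ge0 u; have c0 := S0_cst_ge0.
have : 0 <= \int[leb3]_x (S0 u x * `|psi x|)%:E.
  by apply: integral_ge0 => x _; rewrite lee_fin mulr_ge0// S0_ge0.
move: (Lnormr _ _) (H1norm2 u) S0_cst a0 b0 c0 => a b c a0 b0 c0.
case: (\int[leb3]_x _) => [r| |]// r0 H; last first.
  by have := H (a + 1)%R (b + 1)%R; rewrite !ltrDl ltr01 => /(_ isT isT); rewrite leye_eq.
rewrite lee_fin leNgt; apply/negP => Hr.
(* For [0 < e <= 1], [c (a + e) (b + e) <= c a b + e (q - 1)]. The extra 1 in [q] makes this
   strictly less than [r] as soon as [e q <= r - c a b]. *)
pose q : R := (1 + c * (a + b + 1))%R.
have q0 : (0 < q)%R by rewrite /q ltr_pwDl// mulr_ge0// !addr_ge0.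
pose e : R := (Num.min 1 ((r - c * (a * b)) / q))%R.
have e0 : (0 < e)%R by rewrite lt_min ltr01 divr_gt0// subr_gt0.
have e1 : (e <= 1)%R by rewrite ge_min lexx.
have eq : (e * q <= r - c * (a * b))%R by rewrite -ler_pdivlMr// ge_min lexx orbT.
have := H (a + e)%R (b + e)%R; rewrite !ltrDl e0 lee_fin => /(_ isT isT).
have : (c * (e * e) <= c * e)%R by rewrite ler_wpM2l// ger_pMl.
rewrite /q in eq; lra.
Qed.

Lemma S0_integrable u psi : H1 u -> Lq (6 / 5) psi ->
  leb3.-integrable setT (EFin \o (fun x => S0 u x * psi x)%R).
Proof.
move=> hu lpsi; have lu : L2C u by case: hu.
apply/integrableP; split.
  apply/measurable_EFinP; apply: measurable_funM; first exact: measurable_S0.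
  exact: Lq_measurable lpsi.
apply: le_lt_trans (ltry (S0_cst * (Lnormr (6 / 5) psi * H1norm2 u))).
apply: le_trans (S0_pairing hu lpsi); rewrite le_eqVlt; apply/orP; left; apply/eqP.
by apply: eq_integral => x _; rewrite /= normrM (ger0_norm (S0_ge0 _ _)).
Qed.

Lemma S0_pairing_le u psi : H1 u -> Lq (6 / 5) psi ->
  (`|\int[leb3]_x (S0 u x * psi x)| <= S0_cst * (Lnormr (6 / 5) psi * H1norm2 u))%R.
Proof.
move=> hu lpsi; have lu : L2C u by case: hu.
rewrite -lee_fin; apply: le_trans (S0_pairing hu lpsi).
apply: le_trans (normr_Rintegral_le _ _) _.
  by apply: measurable_funM; [exact: measurable_S0|exact: Lq_measurable lpsi].
rewrite le_eqVlt; apply/orP; left; apply/eqP.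
by apply: eq_integral => x _; rewrite /= normrM (ger0_norm (S0_ge0 _ _)).
Qed.

End Pairing.

(** * Scaling of the functionals *)

Section Scaling.
Context {R : realType}.
Local Notation mu := (@lebesgue_measure R).
Local Notation M := (measurableTypeR R).
Implicit Types (u g : R3 R -> R[i]) (i : 'I_3) (f : R3 R -> R).

Lemma measurable_scale (l : R) f : measurable_fun setT f ->
  measurable_fun setT (fun x : R3 R => f (l *: x)).
Proof. by move=> mf; exact: (measurableT_comp mf (measurable_R3Z l)). Qed.

Lemma Lnormr_scale (q c l : R) f : 0 < q -> 0 <= c -> 0 < l -> measurable_fun setT f ->
  Lnormr q (fun x => c * f (l *: x)) `^ q = c `^ q * (l ^+ 3)^-1 * Lnormr q f `^ q.
Proof.
move=> q0 c0 l0 mf; rewrite !Lnormr_powR//.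
have mp1 : measurable_fun setT (fun s : M => s `^ q : R) by exact: measurable_powR.
have mF : measurable_fun setT (fun x : R3 R => `|f x| `^ q).
  by apply: (measurableT_comp mp1); exact: measurableT_comp.
rewrite (_ : fine _ = \int[leb3]_x (c `^ q * (`|f (l *: x + 0)| `^ q))); last first.
  rewrite /Rintegral; congr fine; apply: eq_integral => x _.
  by rewrite addr0 normrM (ger0_norm c0) powRM.
have mF' : measurable_fun setT (fun x : R3 R => `|f (l *: x + 0)| `^ q).
  by under eq_fun do rewrite addr0; exact: (measurable_scale l mF).
rewrite (RintegralZ _ _ mF') (integral_affine3 0 l0 mF).
by rewrite mulrA.
Qed.

Lemma Lq_scale (q c l : R) f : 1 <= q -> 0 < l -> Lq q f -> Lq q (fun x => c * f (l *: x)).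
Proof.
move=> q1 l0 lf; have mf := Lq_measurable lf.
have q0 : 0 < q by exact: lt_le_trans q1.
have mp1 : measurable_fun setT (fun s : M => s `^ q : R) by exact: measurable_powR.
have mF : measurable_fun setT (fun x : R3 R => (`|f x| `^ q)%:E).
  by apply/measurable_EFinP; apply: (measurableT_comp mp1); exact: measurableT_comp.
rewrite /Lq inE; apply/andP; split; rewrite inE /=.
  by apply: measurable_funM => //; exact: measurable_scale.
rewrite /finite_norm unlock; apply: poweR_lty.
rewrite (eq_integral (fun x : R3 R => (`|c| `^ q)%:E * (`|f (l *: x + 0)| `^ q)%:E))%E; last first.
  by move=> x _; rewrite /= -EFinM addr0 normrM powRM.
have mF' : measurable_fun setT (fun x : R3 R => (`|f (l *: x + 0)| `^ q)%:E).
  by under eq_fun do rewrite addr0; exact: (measurableT_comp mF (measurable_R3Z l)).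
rewrite ge0_integralZl_EFin//.
have h0 x : (0 <= (`|f x| `^ q)%:E)%E by rewrite lee_fin powR_ge0.
rewrite (ge0_integral_affine3 0 l0 mF h0).
have /integrableP[_ H] := Lq_integrable q1 lf.
rewrite lte_mul_pinfty ?lee_fin ?powR_ge0// lte_mul_pinfty ?lee_fin ?invr_ge0 ?exprn_ge0 ?(ltW l0)//.
apply: le_lt_trans H; rewrite le_eqVlt; apply/orP; left; apply/eqP.
by apply: eq_integral => x _; rewrite abse_EFin ger0_norm// powR_ge0.
Qed.

Lemma represents_pdZ (c : R) f (g : R3 R -> R) i : measurable_fun setT f -> measurable_fun setT g ->
  represents g (distr_pd i (distr_of f)) ->
  represents (fun x => c * g x) (distr_pd i (distr_of (fun x => c * f x))).
Proof.
move=> mf mg H phi tphi; have := H _ tphi; rewrite /distr_pd /distr_of => E.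
under eq_Rintegral do rewrite -mulrA.
under [RHS]eq_Rintegral do rewrite -mulrA.
have m1 : measurable_fun setT (fun x : R3 R => f x * pd i phi x).
  by apply: measurable_funM => //; apply: test_measurable; exact: test_pd.
have m2 : measurable_fun setT (fun x : R3 R => g x * phi x).
  by apply: measurable_funM => //; exact: test_measurable.
by rewrite (RintegralZ _ _ m1) (RintegralZ _ _ m2) -E mulrN.
Qed.

Lemma reC_scale (c l : R) u x : reC (fun x => c%:C%C * u (l *: x)) x = c * reC u (l *: x).
Proof. by rewrite /reC; case: (u (l *: x)) => a b /=; rewrite mul0r subr0. Qed.

Lemma imC_scale (c l : R) u x : imC (fun x => c%:C%C * u (l *: x)) x = c * imC u (l *: x).
Proof. by rewrite /imC; case: (u (l *: x)) => a b /=; rewrite mul0r addr0. Qed.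

Lemma cabs_scale (c l : R) u x : 0 <= c -> cabs (fun x => c%:C%C * u (l *: x)) x = c * cabs u (l *: x).
Proof.
move=> c0; rewrite /cabs Normc.normcM; congr (_ * _).
by rewrite /= expr0n addr0 sqrtr_sqr ger0_norm.
Qed.

Lemma L2C_scale (c l : R) u : 0 < l -> L2C u -> L2C (fun x => c%:C%C * u (l *: x)).
Proof.
move=> l0 [h1 h2]; split.
- rewrite (_ : reC _ = (fun x => c * reC u (l *: x))); last by apply/funext => x; exact: reC_scale.
  by apply: Lq_scale => //; exact: ler1n.
- rewrite (_ : imC _ = (fun x => c * imC u (l *: x))); last by apply/funext => x; exact: imC_scale.
  by apply: Lq_scale => //; exact: ler1n.
Qed.

Lemma is_wpd_scale (l : R) u g i : 0 < l -> L2C u -> is_wpd i u g ->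
  is_wpd i (scale l u) (fun x => (l `^ (3 / 2) * l)%:C%C * g (l *: x)).
Proof.
move=> l0 [u1 u2] [lg r1 r2]; have [g1 g2] := lg.
have l12 := ler1n R 2.
have scaled f f' : Lq 2 f -> Lq 2 f' -> represents f' (distr_pd i (distr_of f)) ->
    represents (fun x => l `^ (3 / 2) * (l * f' (l *: x)))
      (distr_pd i (distr_of (fun x => l `^ (3 / 2) * f (l *: x)))).
  move=> h h' Hf; apply: represents_pdZ.
  - by apply: measurable_scale; exact: Lq_measurable h.
  - by apply: measurable_funM => //; apply: measurable_scale; exact: Lq_measurable h'.
  exact: represents_pd_scale l0 (Lq_locint l12 h) (Lq_locint l12 h') Hf.
split; first exact: L2C_scale.
- move: (scaled _ _ u1 g1 r1); congr (represents _ (distr_pd i (distr_of _))).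
    by apply/funext => x; rewrite reC_scale mulrA.
  by apply/funext => x; rewrite reC_scale.
- move: (scaled _ _ u2 g2 r2); congr (represents _ (distr_pd i (distr_of _))).
    by apply/funext => x; rewrite imC_scale mulrA.
  by apply/funext => x; rewrite imC_scale.
Qed.

Lemma H1_scale (l : R) u : 0 < l -> H1 u -> H1 (scale l u).
Proof.
move=> l0 [lu hu]; split; first exact: L2C_scale.
by move=> i; have [g Hg] := hu i; eexists; exact: is_wpd_scale Hg.
Qed.

(** [wpd] is a chosen representative, so the chain rule holds only almost everywhere, by uniqueness
    of the function representing a distribution. *)
Lemma wpd_scale (l : R) u i : 0 < l -> H1 u ->
  {ae leb3, forall x, cabs (wpd i (scale l u)) x ^+ 2 = (l `^ (3 / 2) * l) ^+ 2 * cabs (wpd i u) (l *: x) ^+ 2}.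
Proof.
move=> l0 hu; have lu : L2C u by case: hu.
have [lw r1 r2] := is_wpd_scale l0 lu (wpdP i hu).
have [lw' r1' r2'] := wpdP i (H1_scale l0 hu).
have l12 := ler1n R 2.
have E1 := represents_unique (Lq_locint l12 lw.1) (Lq_locint l12 lw'.1) r1 r1'.
have E2 := represents_unique (Lq_locint l12 lw.2) (Lq_locint l12 lw'.2) r2 r2'.
have c0 : 0 <= l `^ (3 / 2) * l by rewrite mulr_ge0 ?powR_ge0// ltW.
apply: filterS2 E1 E2 => x e1 e2.
by rewrite cabs_sqr -e1 -e2 -cabs_sqr (cabs_scale _ _ _ c0) exprMn.
Qed.

Lemma powR32_sqr (l : R) : 0 <= l -> (l `^ (3 / 2)) ^+ 2 = l ^+ 3.
Proof.
by move=> l0; rewrite -powR_mulrn ?powR_ge0// -powRrM -powR_mulrn//; congr powR; field.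
Qed.

Lemma grad2_scale (l : R) u : 0 < l -> H1 u -> grad2 (scale l u) ^+ 2 = l ^+ 2 * grad2 u ^+ 2.
Proof.
move=> l0 hu; apply: EFin_inj; rewrite -integral_grad_sqr; last exact: H1_scale.
have mg := measurable_grad_abs hu.
have mg' := measurable_grad_abs (H1_scale l0 hu).
have mgl : measurable_fun setT (fun x : R3 R => grad_abs u (l *: x + 0) ^+ 2).
  by under eq_fun do rewrite addr0; exact: (measurable_scale l mg).
transitivity (\int[leb3]_x ((l ^+ 5)%:E * (grad_abs u (l *: x + 0) ^+ 2)%:E))%E.
  apply: ae_eq_integral => //.
  - exact/measurable_EFinP.
  - by apply/measurable_EFinP; exact: measurable_funM.
  have : {ae leb3, forall x, forall i : 'I_3, cabs (wpd i (scale l u)) x ^+ 2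
      = (l `^ (3 / 2) * l) ^+ 2 * cabs (wpd i u) (l *: x) ^+ 2}.
    by apply: filter_forall => i; exact: wpd_scale.
  apply: filterS => x H _; rewrite -EFinM addr0 !grad_abs_sqr; congr EFin.
  rewrite mulr_sumr; apply: eq_bigr => i _; rewrite H; congr (_ * _).
  by rewrite exprMn powR32_sqr ?ltW// -exprD.
rewrite ge0_integralZl_EFin//; last 3 first.
- by move=> x _; rewrite lee_fin sqr_ge0.
- exact/measurable_EFinP.
- by rewrite exprn_ge0// ltW.
have mge : measurable_fun setT (fun x : R3 R => (grad_abs u x ^+ 2)%:E).
  by apply/measurable_EFinP; exact: mg.
have g0 x : (0 <= (grad_abs u x ^+ 2)%:E)%E by rewrite lee_fin sqr_ge0.
rewrite (ge0_integral_affine3 0 l0 mge g0) integral_grad_sqr// -!EFinM; congr EFin.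
by field; rewrite gt_eqF.
Qed.

Lemma cabs_scaleE (l : R) u x : cabs (scale l u) x = l `^ (3 / 2) * cabs u (l *: x).
Proof. by rewrite cabs_scale// powR_ge0. Qed.

Lemma LnormC_scale (q l : R) u : 0 < q -> 0 < l -> L2C u ->
  LnormC q (scale l u) `^ q = l `^ (3 / 2 * q - 3) * LnormC q u `^ q.
Proof.
move=> q0 l0 lu; rewrite /LnormC.
rewrite (_ : cabs (scale l u) = (fun x => l `^ (3 / 2) * cabs u (l *: x))); last first.
  by apply/funext => x; exact: cabs_scaleE.
rewrite Lnormr_scale ?powR_ge0//; last exact: L2C_measurable.
congr (_ * _); rewrite powRB; last by apply/implyP => _; rewrite gt_eqF.
by rewrite -powRrM powR_mulrn// ltW.
Qed.

Lemma LnormC2_scale (l : R) u : 0 < l -> L2C u -> LnormC 2 (scale l u) ^+ 2 = LnormC 2 u ^+ 2.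
Proof.
move=> l0 lu; have L0 v : 0 <= LnormC 2 v by rewrite fine_ge0// Lnorm_ge0.
rewrite -!powR_mulrn// LnormC_scale// (_ : 3 / 2 * 2 - 3 = 0); last by field.
by rewrite powRr0 mul1r.
Qed.

Lemma cabs_scale_sqr (l : R) u x : 0 <= l -> cabs (scale l u) x ^+ 2 = l ^+ 3 * cabs u (l *: x) ^+ 2.
Proof. by move=> l0; rewrite cabs_scaleE exprMn powR32_sqr. Qed.

Lemma S0_scale (l : R) u x : 0 < l -> L2C u -> S0 (scale l u) x = l * S0 u (l *: x).
Proof.
move=> l0 lu; rewrite /S0.
pose f y := cabs u y ^+ 2 / (8 * pi * eucl (l *: x - y)).
have mf : measurable_fun setT f.
  rewrite /f; under eq_fun do rewrite S0_integrandE.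
  apply: measurable_funM => //; apply: measurable_funM.
    by apply: measurable_funX; exact: L2C_measurable.
  exact: (measurableT_comp measurable_kern (measurable_fun_pair2 (l *: x) measurable_R3B)).
have mf' : measurable_fun setT (fun y : R3 R => f (l *: y + 0)).
  by under eq_fun do rewrite addr0; exact: (measurable_scale l mf).
transitivity (\int[leb3]_y (l ^+ 4 * f (l *: y + 0))).
  apply: eq_Rintegral => y _; rewrite cabs_scale_sqr ?ltW// addr0 /f -scalerBr euclZ ?ltW//.
  rewrite !invfM; set a := cabs _ _ ^+ 2; set k := (eucl _)^-1.
  transitivity (l ^+ 3 * a * (8^-1 / pi * k) * (l / l)); last by ring.
  by rewrite divff ?gt_eqF// mulr1.
rewrite (RintegralZ _ _ mf') (integral_affine3 0 l0 mf) mulrA; congr (_ * _).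
by field; rewrite gt_eqF.
Qed.

Lemma Dfun_scale (l : R) u : 0 < l -> L2C u -> Dfun (scale l u) = l * Dfun u.
Proof.
move=> l0 lu; rewrite /Dfun mulrCA; congr (_ * _).
pose f x := S0 u x * cabs u x ^+ 2.
have mf : measurable_fun setT f.
  by apply: measurable_funM; [exact: measurable_S0|apply: measurable_funX; exact: L2C_measurable].
have mf' : measurable_fun setT (fun y : R3 R => f (l *: y + 0)).
  by under eq_fun do rewrite addr0; exact: (measurable_scale l mf).
transitivity (\int[leb3]_y (l ^+ 4 * f (l *: y + 0))).
  apply: eq_Rintegral => y _; rewrite cabs_scale_sqr ?ltW// addr0 S0_scale// /f.
  by ring.
rewrite (RintegralZ _ _ mf') (integral_affine3 0 l0 mf) mulrA; congr (_ * _).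
by field; rewrite gt_eqF.
Qed.

(** The dilation is moved from [u] to [rho]; the weight [S0 u] is then fixed and only [rho] has to
    be expanded in [l]. *)
Lemma E1_scale (l : R) u (rho : R3 R -> R) : 0 < l -> L2C u -> measurable_fun setT rho ->
  E1 rho (scale l u) = - 4^-1 * (l^-1 ^+ 2 * \int[leb3]_x (S0 u x * rho (l^-1 *: x))).
Proof.
move=> l0 lu mr; rewrite /E1; congr (_ * _).
pose f x := S0 u x * rho (l^-1 *: x).
have mf : measurable_fun setT f.
  by apply: measurable_funM; [exact: measurable_S0|exact: measurable_scale].
have mf' : measurable_fun setT (fun y : R3 R => f (l *: y + 0)).
  by under eq_fun do rewrite addr0; exact: (measurable_scale l mf).
transitivity (\int[leb3]_y (l * f (l *: y + 0))).
  apply: eq_Rintegral => y _; rewrite addr0 S0_scale// /f scalerA mulVf ?gt_eqF// scale1r.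
  by rewrite mulrA.
rewrite (RintegralZ _ _ mf') (integral_affine3 0 l0 mf) mulrA; congr (_ * _).
by field; rewrite gt_eqF.
Qed.

Lemma Dfun_ge0 u : 0 <= Dfun u.
Proof.
rewrite mulr_ge0 ?invr_ge0//; apply: Rintegral_ge0 => x _.
by rewrite mulr_ge0 ?S0_ge0 ?sqr_ge0.
Qed.

End Scaling.

(** * Second-order expansion in rho *)

Section FlowPairing.
Context {R : realType}.
Local Notation mu := (@lebesgue_measure R).
Local Notation M := (measurableTypeR R).
Implicit Types (x : R3 R) (u : R3 R -> R[i]) (r g h rho phi psi : R3 R -> R) (i j : 'I_3).

Lemma integral_itv_indic (c t : R) : 0 <= c -> 1 <= t ->
  (\int[mu]_s (c * \1_(`[1%R, t]%classic : set M) s)%:E = (c * (t - 1))%:E)%E.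
Proof.
move=> c0 t1; rewrite (eq_integral _ _ (fun s _ => EFinM _ _)) ge0_integralZl_EFin//.
rewrite integral_indic// setIT (_ : _ `[1, t]%classic = (t - 1)%:E) ?EFinM//.
transitivity (mu `[1, t]); first by [].
  rewrite lebesgue_measure_itv/= lte_fin; case: ltP => // t1'.
  by rewrite (_ : t = 1) ?subrr//; apply/eqP; rewrite eq_le t1' t1.
by apply/measurable_EFinP; exact: measurable_indic.
Qed.

Lemma bounded_itv_integral (f : M -> R) (c t : R) : 0 <= c -> 1 <= t ->
  measurable_fun setT f -> (forall s, `|f s| <= c * \1_(`[1%R, t]%classic : set M) s) ->
  mu.-integrable setT (EFin \o f) /\ `|\int[mu]_s f s| <= c * (t - 1).
Proof.
move=> c0 t1 mf H.
have B : (\int[mu]_s `|f s|%:E <= (c * (t - 1))%:E)%E.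
  rewrite -integral_itv_indic//; apply: ge0_le_integralT => //.
  - by apply/measurable_EFinP; exact: measurableT_comp.
  - by apply/measurable_EFinP; apply: measurable_funM => //; exact: measurable_indic.
split; last by rewrite -lee_fin; exact: le_trans (normr_Rintegral_le _ mf) B.
apply/integrableP; split; first exact/measurable_EFinP.
exact: le_lt_trans B (ltry _).
Qed.

Lemma Lnormr_ge0 (q : R) r : 0 <= Lnormr q r.
Proof. by rewrite fine_ge0// Lnorm_ge0. Qed.

Lemma Lnormr_dilate (q s : R) r : 0 < q -> 1 <= s -> measurable_fun setT r ->
  Lnormr q (fun x => r (s *: x)) <= Lnormr q r.
Proof.
move=> q0 s1 mr; have s0 : 0 < s := lt_le_trans ltr01 s1.
rewrite leNgt; apply/negP => H.
have := gt0_ltr_powR q0 (_ : _ \in Num.nneg) (_ : _ \in Num.nneg) H.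
rewrite !nnegrE => /(_ (Lnormr_ge0 _ _) (Lnormr_ge0 _ _)); rewrite ltNge => /negP; apply.
have := Lnormr_scale q0 ler01 s0 mr.
rewrite (_ : (fun x => 1 * r (s *: x)) = (fun x => r (s *: x))); last first.
  by apply/funext => x; rewrite mul1r.
move=> ->; rewrite powR1 mul1r ler_piMl ?powR_ge0// invf_le1 ?exprn_gt0//.
by rewrite exprn_ege1.
Qed.

Lemma S0_dilate_le u r (s : R) : H1 u -> Lq (6 / 5) r -> 1 <= s ->
  leb3.-integrable setT (EFin \o (fun y => S0 u y * r (s *: y))) /\
  (\int[leb3]_y `|S0 u y * r (s *: y)|%:E <= (S0_cst * (Lnormr (6 / 5) r * H1norm2 u))%:E)%E.
Proof.
move=> hu lr s1; have s0 : 0 < s := lt_le_trans ltr01 s1.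
have l65 : 1 <= 6 / 5 :> R by lra.
have lrs : Lq (6 / 5) (fun x => r (s *: x)).
  have := Lq_scale 1 l65 s0 lr; congr Lq; by apply/funext => x; rewrite mul1r.
split; first exact: S0_integrable.
apply: (@le_trans _ _ (S0_cst * (Lnormr (6 / 5) (fun x => r (s *: x)) * H1norm2 u))%:E).
  apply: le_trans (S0_pairing hu lrs); rewrite le_eqVlt; apply/orP; left; apply/eqP.
  by apply: eq_integral => x _; rewrite normrM (ger0_norm (S0_ge0 _ _)).
rewrite lee_fin ler_wpM2l ?S0_cst_ge0// ler_wpM2r ?H1norm2_ge0//.
by apply: Lnormr_dilate => //; exact: Lq_measurable lr.
Qed.

Lemma S0_dilate_Rle u r (s : R) : H1 u -> Lq (6 / 5) r -> 1 <= s ->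
  `|\int[leb3]_y (S0 u y * r (s *: y))| <= S0_cst * (Lnormr (6 / 5) r * H1norm2 u).
Proof.
move=> hu lr s1; have [_ B] := S0_dilate_le hu lr s1; have lu : L2C u by case: hu.
rewrite -lee_fin; apply: le_trans B; apply: normr_Rintegral_le.
apply: measurable_funM; first exact: measurable_S0.
by apply: measurable_scale; exact: Lq_measurable lr.
Qed.

Section Flow.
Variables (u : R3 R -> R[i]) (r : R3 R -> R) (t : R) (w : M -> R).
Hypotheses (hu : H1 u) (lr : Lq (6 / 5) r) (t1 : 1 <= t) (mw : measurable_fun setT w).
Hypothesis w1 : forall s, `|w s| <= \1_(`[1%R, t]%classic : set M) s.

Let F (z : M * R3 R) : R := S0 u z.2 * (w z.1 * r (z.1 *: z.2)).

Lemma measurable_dilate2 : measurable_fun setT (fun z : M * R3 R => r (z.1 *: z.2)).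
Proof.
apply: (measurableT_comp (Lq_measurable lr)).
have := @measurable_R3_comb R _ (M * R3 R)%type fst snd (fun=> 0) measurable_fst measurable_snd (measurable_cst _).
by congr measurable_fun; apply/funext => z; rewrite addr0.
Qed.

Lemma flow_pairing_measurable : measurable_fun setT F.
Proof.
have lu : L2C u by case: hu.
apply: measurable_funM; first exact: (measurableT_comp (measurable_S0 lu) measurable_snd).
apply: measurable_funM; first exact: (measurableT_comp mw measurable_fst).
exact: measurable_dilate2.
Qed.

Let w0 s : ~ (1 <= s) -> w s = 0.
Proof.
move=> s1; apply/normr0_eq0/eqP; rewrite eq_le normr_ge0 andbT.
apply: le_trans (w1 s) _; rewrite indicE memNset//= in_itv/= => /andP[].
by move=> h _; exact: s1.
Qed.

(** Dilation by [s >= 1] does not increase the [L^(6/5)] norm, so the pairing with [r(s y)] is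
    bounded uniformly on the support of [w], which has length [t - 1]. *)
Lemma flow_pairing_integrable : (mu \x lebp3)%E.-integrable setT (EFin \o F).
Proof.
have lu : L2C u by case: hu.
have mF := flow_pairing_measurable.
apply/integrableP; split; first exact/measurable_EFinP.
have mFe : measurable_fun setT (fun z => (`|F z|)%:E).
  by apply/measurable_EFinP; exact: measurableT_comp.
have F0 z : (0 <= (`|F z|)%:E)%E by rewrite lee_fin.
have E : (\int[mu \x lebp3]_z (`|F z|)%:E = \int[mu]_s \int[lebp3]_y (`|F (s, y)|)%:E)%E.
  exact: (@fubini_tonelli1 _ _ _ _ _ mu lebp3 _ mFe F0).
rewrite [X in (X < _)%E](_ : _ = \int[mu \x lebp3]_z (`|F z|)%:E)%E// E.
set c := S0_cst * (Lnormr (6 / 5) r * H1norm2 u).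
have c0 : 0 <= c by apply: mulr_ge0; [exact: S0_cst_ge0|apply: mulr_ge0; [exact: Lnormr_ge0|exact: H1norm2_ge0]].
apply: (@le_lt_trans _ _ (c * (t - 1))%:E); last exact: ltry.
rewrite -integral_itv_indic//; apply: ge0_le_integralT.
- by move=> s; exact: integral_ge0.
- exact: (@measurable_fun_fubini_tonelli_F _ _ _ _ _ lebp3 _ mFe).
- by apply/measurable_EFinP; apply: measurable_funM => //; exact: measurable_indic.
move=> s.
have [s1|/negP s1] := boolP (1 <= s); last first.
  rewrite integral0_eq; first by rewrite lee_fin mulr_ge0// indicE; case: (_ \in _).
  by move=> y _; rewrite /F/= w0// mul0r mulr0 normr0.
have [_ B] := S0_dilate_le hu lr s1.
have mr := Lq_measurable lr.
have mG : measurable_fun setT (fun y : R3 R => S0 u y * r (s *: y)).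
  by apply: measurable_funM; [exact: measurable_S0|exact: measurable_scale].
rewrite (eq_integral (fun y => (`|w s|%:E * `|S0 u y * r (s *: y)|%:E))%E); last first.
  by move=> y _; rewrite -EFinM /F/= mulrCA normrM.
rewrite ge0_integralZl_EFin//; last by apply/measurable_EFinP; exact: measurableT_comp.
rewrite mulrC EFinM; apply: lee_pmul => //; first exact: integral_ge0.
by rewrite lee_fin.
Qed.

Lemma flow_pairing_Fubini :
  \int[leb3]_y (S0 u y * \int[mu]_s (w s * r (s *: y + 0))) =
  \int[mu]_s (w s * \int[leb3]_y (S0 u y * r (s *: y))).
Proof.
have lu : L2C u by case: hu.
have mr := Lq_measurable lr.
transitivity (\int[lebp3]_y \int[mu]_s F (s, y)).
  apply: eq_Rintegral => y _; rewrite /F/=.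
  have my : measurable_fun setT (fun s : M => w s * r (s *: y)).
    apply: measurable_funM => //.
    exact: (measurable_fun_pair1 y measurable_dilate2).
  rewrite (RintegralZ _ _ my); congr (_ * _).
  by apply: eq_Rintegral => s _; rewrite addr0.
rewrite -(Fubini_Rintegral flow_pairing_integrable); apply: eq_Rintegral => s _; rewrite /F/=.
have mG : measurable_fun setT (fun y : R3 R => S0 u y * r (s *: y)).
  by apply: measurable_funM; [exact: measurable_S0|exact: measurable_scale].
rewrite -(RintegralZ _ _ mG); apply: eq_Rintegral => y _; ring.
Qed.

Lemma flow_pairing_measurable1 :
  measurable_fun setT (fun s : M => w s * \int[leb3]_y (S0 u y * r (s *: y))).
Proof.
have lu : L2C u by case: hu.
have mr := Lq_measurable lr.
have := measurable_fine_F flow_pairing_integrable; congr measurable_fun.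
apply/funext => s; rewrite /F/=.
have mG : measurable_fun setT (fun y : R3 R => S0 u y * r (s *: y)).
  by apply: measurable_funM; [exact: measurable_S0|exact: measurable_scale].
rewrite -(RintegralZ _ _ mG); apply: eq_Rintegral => y _; ring.
Qed.

End Flow.

Let wt (t s : R) : R := \1_(`[1%R, t]%classic : set M) s * s^-1.

Let wt_le (t s : R) : `|wt t s| <= \1_(`[1%R, t]%classic : set M) s.
Proof.
rewrite /wt indicE; case: (boolP (s \in _)) => [/set_mem|_]; last by rewrite mul0r normr0.
rewrite /= in_itv/= mul1r => /andP[s1 _]; have s0 : 0 < s := lt_le_trans ltr01 s1.
by rewrite ger0_norm ?invr_ge0 ?(ltW s0)// invf_le1.
Qed.

Let measurable_wt (t : R) : measurable_fun setT (wt t : M -> R).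
Proof.
have Iw : mu.-integrable setT (EFin \o wt t).
  apply: integrable_itv_mul => s /andP[s1 _]; apply: ex_derive.
  by apply: (@is_deriveV _ id); rewrite gt_eqF// (lt_le_trans _ s1).
by apply/measurable_EFinP; exact: measurable_int Iw.
Qed.

Lemma flow_pairing u r r' (t : R) : H1 u -> Lq (6 / 5) r -> Lq (6 / 5) r' ->
  represents r' (xgrad_distr r) -> 1 < t ->
  \int[leb3]_y (S0 u y * r (t *: y)) - \int[leb3]_y (S0 u y * r y) =
  \int[mu]_s (\1_(`[1%R, t]%classic : set M) s * s^-1 * \int[leb3]_y (S0 u y * r' (s *: y))).
Proof.
move=> hu lr lr' Hr t1; have lu : L2C u by case: hu.
have l65 : 1 <= 6 / 5 :> R by lra.
have I1 := (S0_dilate_le hu lr (ltW t1)).1.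
have I2 := S0_integrable hu lr.
rewrite -(RintegralB measurableT I1 I2).
have := flow_pairing_Fubini hu lr' (ltW t1) (measurable_wt t) (wt_le t).
rewrite /wt => <-.
have HI := dilation_identity t1 (Lq_locint l65 lr) (Lq_locint l65 lr') Hr.
rewrite /Rintegral; congr fine; apply: ae_eq_integral => //.
- apply/measurable_EFinP; apply: measurable_funB.
  + by apply: measurable_funM; [exact: measurable_S0|apply: measurable_scale; exact: Lq_measurable lr].
  + by apply: measurable_funM; [exact: measurable_S0|exact: Lq_measurable lr].
- have H := measurable_fine_G (flow_pairing_integrable hu lr' (ltW t1) (measurable_wt t) (wt_le t)).
  apply/measurable_EFinP; move: H; congr measurable_fun; apply/funext => y /=.
  have my : measurable_fun setT (fun s : M => wt t s * r' (s *: y)).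
    apply: measurable_funM; first exact: measurable_wt.
    exact: (measurable_fun_pair1 y (measurable_dilate2 lr')).
  rewrite (RintegralZ _ _ my); congr (_ * _).
  by apply: eq_Rintegral => s _; rewrite addr0.
by apply: filterS HI => y E _; congr EFin; rewrite -mulrBr E.
Qed.

Lemma xgradP rho : A1 rho -> is_xgrad rho (xgrad rho).
Proof. by move=> [_ _ [g Hg] _]; apply: (xgetPex (fun=> 0) (P := [set g | is_xgrad rho g])); exists g. Qed.

Lemma xHessxP rho : A1 rho -> is_xHessx rho (xHessx rho).
Proof. by move=> [_ _ _ [g Hg]]; apply: (xgetPex (fun=> 0) (P := [set g | is_xHessx rho g])); exists g. Qed.

(** The adjoint of [x . (D^2 rho x) = E (E rho) - E rho] with [E = x . grad]. Moving [x_j] out of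
    [pd i] leaves a diagonal term, whose sum is [- Ldil phi]; the other terms compose to
    [Ldil (Ldil phi)]. *)
Lemma xHessx_LdilE phi x : test_function phi ->
  \sum_(i < 3) \sum_(j < 3) pd j (pd i (fun y => xcoord j y * (xcoord i y * phi y))) x
  = Ldil (Ldil phi) x - Ldil phi x.
Proof.
move=> tphi.
pose psi i := fun y => xcoord i y * phi y.
have tpsi i : test_function (psi i) by exact: test_mulx.
have dif (f : R3 R -> R) (y : R3 R) : test_function f -> differentiable f y.
  by move=> [sf _]; exact: smooth_differentiable.
have dx j y : differentiable (xcoord j : R3 R -> R) y by have H := is_diff_xcoord j y; exact: ex_diff.
have E1 i j : pd i (fun y => xcoord j y * psi i y) =
    (fun y => (i == j)%:R * psi i y + xcoord j y * pd i (psi i) y).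
  apply/funext => y; rewrite pdM//; last exact: dif.
  by rewrite pd_xcoord eq_sym; ring.
have E2 i j : pd j (pd i (fun y => xcoord j y * psi i y)) x =
    (i == j)%:R * pd j (psi i) x + pd j (fun y => xcoord j y * pd i (psi i) y) x.
  rewrite E1 pdD; last 2 first.
  - by apply: dif; exact: test_scale.
  - by apply: dif; apply: test_mulx; exact: test_pd.
  congr (_ + _); rewrite pdM//; last exact: dif.
  by rewrite pdC mulr0 addr0.
transitivity (\sum_(i < 3) pd i (psi i) x
   + \sum_(i < 3) \sum_(j < 3) pd j (fun y => xcoord j y * pd i (psi i) y) x).
  rewrite -big_split/=; apply: eq_bigr => i _.
  rewrite (eq_bigr (fun j => (i == j)%:R * pd j (psi i) x + pd j (fun y => xcoord j y * pd i (psi i) y) x)); last by move=> j _; exact: E2.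
  rewrite big_split/=; congr (_ + _); rewrite (bigD1 i)//= eqxx mul1r big1 ?addr0// => j ji.
  by rewrite eq_sym (negbTE ji) mul0r.
rewrite /Ldil opprK addrC; congr (_ + _).
rewrite exchange_big/= -sumrN; apply: eq_bigr => j _.
have tp i : test_function (fun y => xcoord j y * pd i (psi i) y) by apply: test_mulx; exact: test_pd.
have sum3 (F : 'I_3 -> R) : \sum_(i < 3) F i =
    F ord0 + (F (lift ord0 ord0) + F (lift ord0 (lift ord0 ord0))).
  by rewrite !big_ord_recl big_ord0 addr0.
have -> : (fun y => xcoord j y * - \sum_(i < 3) pd i (psi i) y) =
    (fun y => - 1 * (\sum_(i < 3) xcoord j y * pd i (psi i) y)).
  by apply/funext => y; rewrite mulrN mulN1r mulr_sumr.
rewrite pdM//; last by apply: dif; exact: test_sum.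
rewrite pdC mulr0 addr0 mulN1r opprK.
under [in RHS]eq_fun do rewrite !big_ord_recl big_ord0 addr0.
rewrite pdD; [|exact: dif|by apply: dif; exact: test_add].
rewrite pdD; [|exact: dif|exact: dif].
exact: sum3.
Qed.

Lemma represents_xgrad_xgrad rho g h : locint rho -> locint g -> locint h ->
  represents g (xgrad_distr rho) -> represents h (xHessx_distr rho) ->
  represents (fun x => g x + h x) (xgrad_distr g).
Proof.
move=> lr lg lh Hg Hh phi tphi.
have tL := test_Ldil tphi; have tLL := test_Ldil tL.
rewrite (xgrad_distrE lg tphi) -[LHS]/(distr_of g (Ldil phi)) -Hg// (xgrad_distrE lr tL).
rewrite /distr_of; under [RHS]eq_Rintegral do rewrite mulrDl.
rewrite (RintegralD measurableT (locint_test lg tphi) (locint_test lh tphi)).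
rewrite -[X in X + _]/(distr_of g phi) -[X in _ + X]/(distr_of h phi) -Hg// -Hh//.
rewrite (xgrad_distrE lr tphi).
pose D i j := pd j (pd i (fun y => xcoord j y * (xcoord i y * phi y))).
have tD i j : test_function (D i j) by do 2 apply: test_pd; do 2 apply: test_mulx.
have -> : xHessx_distr rho phi = \int[leb3]_x (rho x * (\sum_(i < 3) \sum_(j < 3) D i j x)).
  rewrite /xHessx_distr /distr_mulx /distr_pd /distr_of.
  have I i j : leb3.-integrable setT (EFin \o (fun x => rho x * D i j x)).
    exact: locint_test.
  rewrite (eq_bigr (fun i => \int[leb3]_x (\sum_(j < 3) rho x * D i j x))); last first.
    move=> i _; transitivity (\sum_(j < 3) \int[leb3]_x (rho x * D i j x)).
      by apply: eq_bigr => j _; rewrite opprK.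
    exact: Rintegral_sum.
  rewrite Rintegral_sum.
    by apply: eq_Rintegral => x _; rewrite mulr_sumr; apply: eq_bigr => i _; rewrite mulr_sumr.
  by move=> i; apply: integrable_Rsum => j.
rewrite -RintegralD//; last 2 first.
- exact: locint_test.
- have tS : test_function (fun x => \sum_(i < 3) \sum_(j < 3) D i j x).
    by do 2 apply: test_sum => ?.
  exact: locint_test.
apply: eq_Rintegral => x _; rewrite -mulrDr; congr (_ * _).
by rewrite /D xHessx_LdilE//; ring.
Qed.

(** With [G s] the pairing of [S0 u] with [(x . grad rho)(s y)], the left-hand side is the integral
    over [[1, t]] of [G s / s - G 1]. This is at most [|G s - G 1| + (s - 1) |G 1|] in absolute
    value; each summand is [O(s - 1)], and integration gives the second factor [t - 1]. The norm of
    [x . grad rho] is counted once for each summand. *)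
Lemma rho_flow u rho (t : R) : H1 u -> A1 rho -> 1 < t ->
  `|\int[leb3]_y (S0 u y * rho (t *: y)) - \int[leb3]_y (S0 u y * rho y)
    - (t - 1) * \int[leb3]_y (S0 u y * xgrad rho y)|
  <= S0_cst * ((2 * Lnormr (6 / 5) (xgrad rho) + Lnormr (6 / 5) (xHessx rho)) * H1norm2 u) * (t - 1) ^+ 2.
Proof.
move=> hu hr t1; have [lr _ _ _] := hr; have lu : L2C u by case: hu.
have [lg Hg] := xgradP hr; have [lh Hh] := xHessxP hr.
have l65 : 1 <= 6 / 5 :> R by lra.
have Hgh := represents_xgrad_xgrad (Lq_locint l65 lr) (Lq_locint l65 lg) (Lq_locint l65 lh) Hg Hh.
have lgh : Lq (6 / 5) (fun x => xgrad rho x + xHessx rho x).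
  exact: (@Lfun_addr_closed _ _ R leb3 (6 / 5)%:E _).2.
set g := xgrad rho in lg Hg Hgh lgh *; set h := xHessx rho in lh Hh Hgh lgh *.
pose B := H1norm2 u.
pose cg := S0_cst * (Lnormr (6 / 5) g * B); pose ch := S0_cst * (Lnormr (6 / 5) h * B).
have cg0 : 0 <= cg by apply: mulr_ge0; [exact: S0_cst_ge0|apply: mulr_ge0; [exact: Lnormr_ge0|exact: H1norm2_ge0]].
have ch0 : 0 <= ch by apply: mulr_ge0; [exact: S0_cst_ge0|apply: mulr_ge0; [exact: Lnormr_ge0|exact: H1norm2_ge0]].
pose G (s : R) := \int[leb3]_y (S0 u y * g (s *: y)).
have G1 : \int[leb3]_y (S0 u y * g y) = G 1.
  by apply: eq_Rintegral => y _; rewrite scale1r.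
have Gle s : 1 <= s -> `|G s| <= cg by move=> s1; exact: S0_dilate_Rle.
have GB s : 1 <= s -> `|G s - G 1| <= (cg + ch) * (s - 1).
  rewrite le_eqVlt => /predU1P[<-|s1]; first by rewrite !subrr normr0 mulr0.
  (* The first-order identity is now used for [g] itself, whose radial derivative is [g + h]. *)
  rewrite -G1 (flow_pairing hu lg lgh Hgh s1).
  apply: (bounded_itv_integral _ (ltW s1) _ _).2; first exact: addr_ge0.
    exact: (flow_pairing_measurable1 hu lgh (ltW s1) (measurable_wt s) (wt_le s)).
  move=> x; have [xI|xI] := boolP (x \in (`[1, s]%classic : set M)); last first.
    by rewrite indicE (negbTE xI) mulr0 !mul0r normr0.
  have /andP[x1 _] : 1 <= x <= s by move/set_mem: xI; rewrite /= in_itv.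
  rewrite normrM mulrC; apply: ler_pM => //; last exact: wt_le.
  have [Ig _] := S0_dilate_le hu lg x1; have [Ih _] := S0_dilate_le hu lh x1.
  under eq_Rintegral do rewrite mulrDr.
  rewrite (RintegralD measurableT Ig Ih); apply: le_trans (ler_normD _ _) _.
  by apply: lerD; exact: S0_dilate_Rle.
rewrite (flow_pairing hu lr lg Hg t1) G1.
pose f2 (s : M) : R := G 1 * \1_(`[1%R, t]%classic : set M) s.
have mf2 : measurable_fun setT f2.
  by apply: measurable_funM => //; exact: measurable_indic.
have t10 : 0 <= t - 1 by lra.
have E2 : (t - 1) * G 1 = \int[mu]_s f2 s.
  have m1 : measurable_fun setT (\1_(`[1%R, t]%classic : set M) : M -> R) by exact: measurable_indic.
  rewrite /f2 (RintegralZ _ _ m1) mulrC; congr (_ * _).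
  have := integral_itv_indic ler01 (ltW t1); rewrite mul1r => H.
  rewrite -[LHS]/(fine (t - 1)%:E) -H; congr fine; apply: eq_integral => s _.
  by rewrite mul1r.
have mf1 := flow_pairing_measurable1 hu lg (ltW t1) (measurable_wt t) (wt_le t).
pose f1 (s : M) : R := wt t s * G s.
have [If1 _] : mu.-integrable setT (EFin \o f1) /\ `|\int[mu]_s f1 s| <= cg * (t - 1).
  apply: bounded_itv_integral cg0 (ltW t1) mf1 _ => s.
  have [sI|sI] := boolP (s \in (`[1, t]%classic : set M)); last first.
    by rewrite /f1 /wt indicE (negbTE sI) mulr0 !mul0r normr0.
  have /andP[s1 _] : 1 <= s <= t by move/set_mem: sI; rewrite /= in_itv.
  by rewrite /f1 normrM mulrC; exact: ler_pM (normr_ge0 _) (normr_ge0 _) (Gle s s1) (wt_le t s).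
have [If2 _] : mu.-integrable setT (EFin \o f2) /\ `|\int[mu]_s f2 s| <= cg * (t - 1).
  apply: bounded_itv_integral cg0 (ltW t1) mf2 _ => s.
  rewrite normrM; apply: ler_pM => //; first exact: Gle.
  by rewrite ger0_norm// indicE; case: (_ \in _).
rewrite E2 -[X in X - _]/(\int[mu]_s f1 s) -(RintegralB measurableT If1 If2).
rewrite expr2 mulrA (_ : S0_cst * _ = cg + (cg + ch)); last by rewrite /cg /ch -/B; ring.
apply: (bounded_itv_integral _ (ltW t1) _ _).2.
- by rewrite mulr_ge0// !addr_ge0.
- exact: measurable_funB.
move=> s; have [sI|sI] := boolP (s \in (`[1, t]%classic : set M)); last first.
  by rewrite /f1 /f2 /wt indicE (negbTE sI) !mulr0 !mul0r subrr normr0.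
have /andP[s1 st] : 1 <= s <= t by move/set_mem: sI; rewrite /= in_itv.
have s0 : 0 < s := lt_le_trans ltr01 s1.
rewrite /f1 /f2 /wt indicE sI mul1r !mulr1.
have i0 : 0 <= s^-1 by rewrite invr_ge0 ltW.
have i1 : s^-1 <= 1 by rewrite invf_le1.
rewrite (_ : _ - _ = s^-1 * (G s - G 1) - s^-1 * (s - 1) * G 1); last by field; rewrite gt_eqF.
apply: le_trans (ler_normB _ _) _; rewrite addrC mulrDl; apply: lerD.
  rewrite normrM mulrC; apply: ler_pM => //; first exact: Gle.
  by rewrite ger0_norm ?mulr_ge0 ?subr_ge0// (le_trans (ler_piMl _ i1)) ?subr_ge0// lerB.
rewrite normrM (ger0_norm i0); apply: le_trans (ler_piMl _ i1) _ => //.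
apply: le_trans (GB _ s1) _; apply: ler_wpM2l; first exact: addr_ge0.
by rewrite lerB.
Qed.

End FlowPairing.

(** * Conclusion *)

Section RealInequalities.
Context {R : realType}.
Implicit Types (a b t l p : R).

(* Young's inequality for [(1/t)^b <= b/t + 1 - b], multiplied by [t^(1 + b)]. *)
Lemma powR_bernoulli_inv t b : 0 < t -> 0 <= b <= 1 -> t <= t `^ b * (t + b * (1 - t)).
Proof.
move=> t0 /andP[]; rewrite le_eqVlt => /predU1P[<- _|b0]; first by rewrite powRr0 mul0r; lra.
rewrite le_eqVlt => /predU1P[->|b1]; first by rewrite (powRr1 (ltW t0)) (_ : t + 1 * (1 - t) = 1) ?mulr1//; ring.
have i0 : 0 < t^-1 by rewrite invr_gt0.
have q0 : 0 < 1 - b by rewrite subr_gt0.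
have := @conjugate_powR R (t^-1 `^ b) 1 b^-1 (1 - b)^-1.
rewrite powR_ge0 ler01 !invr_gt0 b0 q0 !invrK addrC subrK => /(_ isT isT isT isT erefl).
rewrite mulr1 powR1 mul1r -powRrM mulfV ?gt_eqF// (powRr1 (ltW i0)) => H.
have E : t `^ b * t^-1 `^ b = 1 by rewrite -powRM ?ltW// mulfV ?gt_eqF// powR1.
have tb0 : 0 < t `^ b by exact: powR_gt0.
have := ler_wpM2l (ltW (mulr_gt0 t0 tb0)) H.
rewrite -mulrA E mulr1 => H1; apply: le_trans H1 _.
rewrite le_eqVlt; apply/orP; left; apply/eqP.
by field; rewrite gt_eqF.
Qed.

(** One or two integer powers are split off so that the remaining exponent [b] lies in [[0, 1]];
    then [t^b >= t / (t + b (1 - t))], and clearing the denominator leaves a polynomial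
    inequality. *)
Lemma powR_convex_gap a : 1 < a < 3 -> exists2 c, 0 < c &
  forall t, 0 < t <= 1 -> c * (1 - t) ^+ 2 <= t `^ a - 1 - a * (t - 1).
Proof.
move=> /andP[a1 a3]; have [a2|a2] := leP a 2.
  (* With [c = b^2], [b = a - 1], the polynomial terms in [1 - t] cancel up to order two, leaving
     [b^2 (1 - b) (1 - t)^3 >= 0]. *)
  exists ((a - 1) ^+ 2); first by rewrite exprn_gt0// subr_gt0.
  move=> t /andP[t0 t1].
  have H := powR_bernoulli_inv t0 (_ : 0 <= a - 1 <= 1).
  have {}H : t <= t `^ (a - 1) * (t + (a - 1) * (1 - t)) by apply: H; lra.
  have -> : t `^ a = t * t `^ (a - 1).
    transitivity (t `^ 1 * t `^ (a - 1)); last by rewrite powRr1 ?ltW.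
    rewrite -powRD; last by apply/implyP => _; rewrite gt_eqF.
    by congr (_ `^ _); ring.
  have d0 : 0 < t + (a - 1) * (1 - t) by rewrite ltr_wpDr// mulr_ge0//; lra.
  rewrite -(ler_pM2r d0); set x := t `^ (a - 1) in H *.
  set b := a - 1 in H d0 *; have -> : a = 1 + b by rewrite /b; ring.
  have b0 : 0 <= b by rewrite /b; lra.
  have b1 : b <= 1 by rewrite /b; lra.
  have Hx := ler_wpM2l (ltW t0) H.
  have : 0 <= b ^+ 2 * (1 - b) * (1 - t) ^+ 3.
    by rewrite !mulr_ge0 ?exprn_ge0//; lra.
  move=> H0; rewrite -subr_ge0.
  rewrite (_ : _ - _ = (t * (x * (t + b * (1 - t))) - t * t) + b ^+ 2 * (1 - b) * (1 - t) ^+ 3).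
    by rewrite addr_ge0// subr_ge0.
  by ring.
(* For [a > 2], with [b = a - 2], the choice [c = 1] leaves [(1 - t)^2 (b^2 + b t) >= 0]. *)
exists 1 => // t /andP[t0 t1].
have H := powR_bernoulli_inv t0 (_ : 0 <= a - 2 <= 1).
have {}H : t <= t `^ (a - 2) * (t + (a - 2) * (1 - t)) by apply: H; lra.
have -> : t `^ a = t ^+ 2 * t `^ (a - 2).
  transitivity (t `^ 2 * t `^ (a - 2)); last by rewrite powR_mulrn ?ltW.
  rewrite -powRD; last by apply/implyP => _; rewrite gt_eqF.
    by congr (_ `^ _); ring.
have d0 : 0 < t + (a - 2) * (1 - t) by rewrite ltr_wpDr// mulr_ge0//; lra.
rewrite -(ler_pM2r d0); set x := t `^ (a - 2) in H *.
set b := a - 2 in H d0 *; have -> : a = 2 + b by rewrite /b; ring.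
have b0 : 0 <= b by rewrite /b; lra.
have b1 : b <= 1 by rewrite /b; lra.
have Hx := ler_wpM2l (sqr_ge0 t) H.
have H0 : 0 <= (1 - t) ^+ 2 * (b ^+ 2 + b * t).
  by rewrite mulr_ge0 ?sqr_ge0// addr_ge0 ?sqr_ge0// mulr_ge0// ltW.
rewrite -subr_ge0.
rewrite (_ : _ - _ = (t ^+ 2 * (x * (t + b * (1 - t))) - t ^+ 2 * t) + (1 - t) ^+ 2 * (b ^+ 2 + b * t)).
  by rewrite addr_ge0// subr_ge0.
by ring.
Qed.

(** Since [t - 1 = (1 - l) t] and [t - l = (1 - l) (1 + l) t], the coefficients of [a], [b] and [r]
    all contain [(1 - l)^2]. The cofactors involve powers [t^n] with [n <= 4], at most [d^-4]; the
    fourth power comes from [t^2 (t - 1)^2] in the term with [r]. *)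
Lemma remainder_le (l d a b r A B C : R) : 0 < d -> d <= l -> l <= 1 -> 0 <= C ->
  `|a| <= A -> `|b| <= B -> `|r| <= C * (l^-1 - 1) ^+ 2 ->
  - 2^-1 * (l^-1 ^+ 2 * (a + (l^-1 - 1) * b + r) - a) - (l ^+ 2 - 1) / 2 * a
    - (l ^+ 2 - 1) / 4 * b
  <= (1 - l) ^+ 2 * d^-1 ^+ 4 * (2 * A + 2 * B + 2^-1 * C).
Proof.
move=> d0 dl l1 C0 HA HB HC; have l0 : 0 < l := lt_le_trans d0 dl.
have tT : l^-1 <= d^-1 by rewrite lef_pV2.
have t1 : 1 <= l^-1 by rewrite invf_ge1.
have tl : l^-1 * l = 1 by rewrite mulVf ?gt_eqF.
set t := l^-1 in tT t1 tl HC *; set T := d^-1 in tT *.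
have [a1 a2] : - A <= a /\ a <= A by apply/andP; rewrite -ler_norml.
have [b1 b2] : - B <= b /\ b <= B by apply/andP; rewrite -ler_norml.
have [r1 r2] : - (C * (t - 1) ^+ 2) <= r /\ r <= C * (t - 1) ^+ 2 by apply/andP; rewrite -ler_norml.
have tE : t - 1 = (1 - l) * t by rewrite mulrBl mul1r mulrC tl.
have t0 : 0 <= t by lra.
have T0 : 0 <= T by lra.
have tX n : (n <= 4)%N -> t ^+ n <= T ^+ 4.
  move=> n4; apply: (@le_trans _ _ (T ^+ n)); first by rewrite lerXn2r ?nnegrE.
  by apply: ler_weXn2l => //; lra.
set D := 1 - l in tE *; have D0 : 0 <= D ^+ 2 by exact: sqr_ge0.
set T4 := T ^+ 4 in tX *.
have E1 : t - l = D * (1 + l) * t.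
  by transitivity (t - (t * l) * l); [rewrite tl mul1r|rewrite /D; ring].
have P1 : t ^+ 2 + l ^+ 2 - 2 = D ^+ 2 * (t ^+ 2 * (1 + l) ^+ 2).
  transitivity ((t - l) ^+ 2); last by rewrite E1; ring.
  by rewrite sqrrB tl; ring.
have P2 : t ^+ 2 * (t - 1) + (l ^+ 2 - 1) / 2 = D ^+ 2 * (t ^+ 3 + t ^+ 2 + t + 2^-1).
  transitivity (D * ((t - 1) * (t ^+ 2 + t + 1) + D / 2)); last by rewrite tE; field.
  rewrite [in LHS]tE (_ : (t - 1) * (t ^+ 2 + t + 1) = t ^+ 3 - 1); last by ring.
  by rewrite /D; field.
have P3 : t ^+ 2 * (C * (t - 1) ^+ 2) = D ^+ 2 * (C * t ^+ 4) by rewrite tE; ring.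
have Q1 : 0 <= t ^+ 2 + l ^+ 2 - 2 <= 4 * (D ^+ 2 * T4).
  rewrite P1 (_ : 4 * (D ^+ 2 * T4) = D ^+ 2 * (T4 * 4)); last by ring.
  apply/andP; split; first by apply: mulr_ge0 => //; apply: mulr_ge0; exact: sqr_ge0.
  apply: ler_wpM2l => //; apply: ler_pM; [exact: sqr_ge0|exact: sqr_ge0|exact: tX|].
  by rewrite (_ : 4 = 2 ^+ 2) ?lerXn2r ?nnegrE//; first lra; first lra; ring.
have Q2 : 0 <= t ^+ 2 * (t - 1) + (l ^+ 2 - 1) / 2 <= 4 * (D ^+ 2 * T4).
  rewrite P2 (_ : 4 * (D ^+ 2 * T4) = D ^+ 2 * (4 * T4)); last by ring.
  have t30 : 0 <= t ^+ 3 by exact: exprn_ge0.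
  have t20 : 0 <= t ^+ 2 by exact: sqr_ge0.
  apply/andP; split; first by apply: mulr_ge0 => //; lra.
  apply: ler_wpM2l => //.
  have := tX 3%N isT; have := tX 2%N isT; have := tX 1%N isT; have := tX 0%N isT.
  rewrite expr0 expr1; lra.
have Q3 : t ^+ 2 * (C * (t - 1) ^+ 2) <= C * (D ^+ 2 * T4).
  by rewrite P3 mulrCA ler_wpM2l// ler_wpM2l// tX.
have A0 : 0 <= A by lra.
have B0 : 0 <= B by lra.
have t20 : 0 <= t ^+ 2 by exact: sqr_ge0.
have {}r1 := ler_wpM2l t20 r1.
have -> : - 2^-1 * (t ^+ 2 * (a + (t - 1) * b + r) - a) - (l ^+ 2 - 1) / 2 * a - (l ^+ 2 - 1) / 4 * b
  = - (a * (t ^+ 2 + l ^+ 2 - 2)) / 2 - b * (t ^+ 2 * (t - 1) + (l ^+ 2 - 1) / 2) / 2 - t ^+ 2 * r / 2.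
  by field.
move: Q1 Q2 Q3 r1; rewrite mulrN.
set K := D ^+ 2 * T4; set q1 := _ + _ - 2; set q2 := t ^+ 2 * (t - 1) + _.
set q3 := t ^+ 2 * (C * _).
move=> /andP[q10 q1K] /andP[q20 q2K] q3K r1.
have H1 : - (a * q1) <= A * (4 * K).
  rewrite -mulNr; apply: (@le_trans _ _ (A * q1)); first by rewrite ler_wpM2r//; lra.
  by rewrite ler_wpM2l.
have H2 : - (b * q2) <= B * (4 * K).
  rewrite -mulNr; apply: (@le_trans _ _ (B * q2)); first by rewrite ler_wpM2r//; lra.
  by rewrite ler_wpM2l.
lra.
Qed.

End RealInequalities.

Section Difference.
Context {R : realType}.
Variables (p omega e : R) (rho : R3 R -> R) (u : R3 R -> R[i]).
Hypotheses (p0 : 0 < p + 1) (hu : H1 u) (hr : A1 rho).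

Let lu : L2C u. Proof. by case: hu. Qed.
Let lr : Lq (6 / 5) rho. Proof. by case: hr. Qed.

(** The nonlinear term is written as a power of [l^2]: the tangent that [l^2 Q(u) / 2] subtracts is
    affine in [l^2], so the convexity gap applies at the point [l^2]. *)
Lemma Ifun_scale (l : R) : 0 < l -> Ifun p omega e rho (scale l u) =
  2^-1 * (l ^+ 2 * grad2 u ^+ 2) + omega / 2 * LnormC 2 u ^+ 2
  - (p + 1)^-1 * ((l ^+ 2) `^ (3 * (p - 1) / 4) * LnormC (p + 1) u `^ (p + 1))
  + e ^+ 2 * (l * Dfun u)
  + 2 * e ^+ 2 * (- 4^-1 * (l^-1 ^+ 2 * \int[leb3]_x (S0 u x * rho (l^-1 *: x)))).
Proof.
move=> l0; rewrite /Ifun grad2_scale// LnormC2_scale// LnormC_scale// Dfun_scale//.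
rewrite E1_scale//; last exact: Lq_measurable lr.
suff -> : (l ^+ 2) `^ (3 * (p - 1) / 4) = l `^ (3 / 2 * (p + 1) - 3) by [].
by rewrite -(powR_mulrn 2 (ltW l0)) -powRrM; congr (_ `^ _); field.
Qed.

(** The gradient and mass terms cancel, and [l - 1 - (l^2 - 1)/2 = - (1 - l)^2 / 2] gives the
    coefficient of [D(u)]. *)
Lemma flambdaB (l : R) : 0 < l -> flambda p omega e rho u l - flambda p omega e rho u 1 =
  - (p + 1)^-1 * (((l ^+ 2) `^ (3 * (p - 1) / 4) - 1 - 3 * (p - 1) / 4 * (l ^+ 2 - 1))
                  * LnormC (p + 1) u `^ (p + 1))
  - e ^+ 2 * ((1 - l) ^+ 2 / 2 * Dfun u)
  + e ^+ 2 * (- 2^-1 * (l^-1 ^+ 2 * \int[leb3]_x (S0 u x * rho (l^-1 *: x))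
                         - \int[leb3]_x (S0 u x * rho x))
              - (l ^+ 2 - 1) / 2 * \int[leb3]_x (S0 u x * rho x)
              - (l ^+ 2 - 1) / 4 * \int[leb3]_x (S0 u x * xgrad rho x)).
Proof.
move=> l0; rewrite /flambda !Ifun_scale// /Qfun /E1 /E2 !expr1n powR1 invr1 expr1n.
have -> : \int[leb3]_x (S0 u x * rho (1 *: x)) = \int[leb3]_x (S0 u x * rho x).
  by apply: eq_Rintegral => x _; rewrite scale1r.
set X := LnormC (p + 1) u `^ (p + 1).
set a := \int[leb3]_x (S0 u x * rho x).
set b := \int[leb3]_x (S0 u x * xgrad rho x).
set at_ := \int[leb3]_x (S0 u x * rho (l^-1 *: x)).
set Y := (l ^+ 2) `^ _; set G := grad2 u; set D := Dfun u; set L := LnormC 2 u.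
move: X a b at_ Y G D L => X a b c Y G D L.
by field; rewrite (gt_eqF p0) (gt_eqF l0).
Qed.

End Difference.

Theorem lemma5p3 (R : realType) (p omega delta : R) (ustar : R3 R -> R[i])
    (hp : 7 / 3 < p < 5) (homega : 0 < omega)
    (hustar : H1 ustar) (hustar0 : ~ ae_zero ustar)
    (hdelta : is_delta_star p omega ustar delta) :
  exists C1 C2 : R, [/\ 0 < C1, 0 < C2 &
    forall (e : R) (rho : R3 R -> R),
      0 < e -> A1 rho -> A2 rho ->
    forall (u : R3 R -> R[i]) (l : R),
      H1 u -> delta <= l <= 1 ->
      flambda p omega e rho u l - flambda p omega e rho u 1 <=
        - C1 * (1 - l) ^+ 2 * LnormC (p + 1) u `^ (p + 1)
        + C2 * (1 - l) ^+ 2 * e ^+ 2 *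
          (Lnormr (6 / 5) rho + Lnormr (6 / 5) (xgrad rho)
           + Lnormr (6 / 5) (xHessx rho)) * H1norm2 u].
Proof.
have [/andP[d0 d1] _] := hdelta; have /andP[p1 p2] := hp.
have pp : 0 < p + 1 by lra.
have ha : 1 < 3 * (p - 1) / 4 < 3 by apply/andP; split; lra.
have [c c0 Hc] := powR_convex_gap ha.
have CS0 : 0 < S0_cst :> R.
  by apply: divr_gt0; [rewrite ltr0n|apply: mulr_gt0; [rewrite ltr0n|exact: pi_gt0]].
(* [c] is the convexity constant at exponent [3 (p - 1) / 4]. The 3 comes from [2 A + 2 B + (2 B +
   C) / 2 <= 3 (A + B + C)], where [2 B + C] is the constant of [rho_flow]. *)
exists (c / (p + 1)), (3 * S0_cst * delta^-1 ^+ 4); split.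
- by rewrite divr_gt0.
- by apply: mulr_gt0; [exact: mulr_gt0|rewrite exprn_gt0 ?invr_gt0].
move=> e rho e0 hr _ u l hu /andP[dl l1].
have l0 : 0 < l := lt_le_trans d0 dl.
have [lr _ _ _] := hr; have [lg _] := xgradP hr.
rewrite flambdaB//.
set P := LnormC _ _ `^ _; have P0 : 0 <= P by exact: powR_ge0.
set a := \int[leb3]_x (S0 u x * rho x).
set b := \int[leb3]_x (S0 u x * xgrad rho x).
set A := Lnormr _ rho; set B := Lnormr _ (xgrad rho); set C := Lnormr _ (xHessx rho).
set H := H1norm2 u.
have A0 : 0 <= A by exact: Lnormr_ge0.
have B0 : 0 <= B by exact: Lnormr_ge0.
have C0 : 0 <= C by exact: Lnormr_ge0.
have H0 : 0 <= H by exact: H1norm2_ge0.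
have D0 : 0 <= Dfun u by exact: Dfun_ge0.
have aA : `|a| <= S0_cst * (A * H) by exact: S0_pairing_le.
have bB : `|b| <= S0_cst * (B * H) by exact: S0_pairing_le.
pose r := \int[leb3]_x (S0 u x * rho (l^-1 *: x)) - a - (l^-1 - 1) * b.
have rC : `|r| <= S0_cst * ((2 * B + C) * H) * (l^-1 - 1) ^+ 2.
  (* [rho_flow] asks for [1/l > 1]; at [l = 1] the remainder is 0. *)
  move: l1; rewrite le_eqVlt => /predU1P[E|l1].
    rewrite /r E invr1 subrr mul0r subr0 expr0n mulr0.
    by under eq_Rintegral do rewrite scale1r; rewrite subrr normr0.
  by apply: rho_flow => //; rewrite invf_gt1.
have K0 : 0 <= S0_cst * ((2 * B + C) * H).
  by apply: mulr_ge0; [exact: ltW|apply: mulr_ge0 => //; lra].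
have := remainder_le d0 dl l1 K0 aA bB rC.
rewrite (_ : a + (l^-1 - 1) * b + r = \int[leb3]_x (S0 u x * rho (l^-1 *: x))); last by rewrite /r; ring.
set X := (X in X <= _) => HX.
have l21 : 0 < l ^+ 2 <= 1 by rewrite exprn_gt0//= expr_le1// ltW.
have := Hc _ l21; set Y := (X in _ <= X) => HY.
(* The gap at [l^2] is quadratic in [1 - l^2 = (1 - l) (1 + l)], and [1 + l >= 1]. *)
have HY2 : c * (1 - l) ^+ 2 <= Y.
  apply: le_trans HY; rewrite ler_pM2l//.
  rewrite (_ : 1 - l ^+ 2 = (1 - l) * (1 + l)); last by ring.
  rewrite exprMn ler_peMr ?sqr_ge0// expr_ge1//; lra.
have e2 : 0 <= e ^+ 2 by exact: sqr_ge0.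
apply: lerD.
  (* The term with [D(u) >= 0] has a negative sign and is dropped. *)
  apply: (@le_trans _ _ (- (p + 1)^-1 * (Y * P))).
    rewrite lerBlDr lerDl; apply: mulr_ge0 => //; apply: mulr_ge0 => //.
    by apply: mulr_ge0; [exact: sqr_ge0|rewrite invr_ge0].
  rewrite mulNr !mulNr lerN2.
  rewrite (_ : c / (p + 1) * _ * P = (p + 1)^-1 * (c * (1 - l) ^+ 2 * P)); last by ring.
  by rewrite ler_wpM2l ?invr_ge0 ?(ltW pp)// ler_wpM2r.
apply: (@le_trans _ _ (e ^+ 2 * ((1 - l) ^+ 2 * delta^-1 ^+ 4 *
  (2 * (S0_cst * (A * H)) + 2 * (S0_cst * (B * H)) + 2^-1 * (S0_cst * ((2 * B + C) * H)))))).
  exact: ler_wpM2l.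
set T := delta^-1 ^+ 4; have T0 : 0 <= T by rewrite exprn_ge0// invr_ge0 ltW.
have W0 : 0 <= e ^+ 2 * ((1 - l) ^+ 2 * T) * (S0_cst * H).
  by apply: mulr_ge0; [apply: mulr_ge0 => //; apply: mulr_ge0 => //; exact: sqr_ge0|apply: mulr_ge0 => //; exact: ltW].
set W := e ^+ 2 * _ * _ in W0.
have := ler_wpM2l W0 (_ : 2 * A + 3 * B + C / 2 <= 3 * A + 3 * B + 3 * C).
rewrite (_ : W * (2 * A + 3 * B + C / 2) = e ^+ 2 * ((1 - l) ^+ 2 * T *
  (2 * (S0_cst * (A * H)) + 2 * (S0_cst * (B * H)) + 2^-1 * (S0_cst * ((2 * B + C) * H))))); last by rewrite /W; field.
rewrite (_ : W * (3 * A + 3 * B + 3 * C) =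
  3 * S0_cst * T * (1 - l) ^+ 2 * e ^+ 2 * (A + B + C) * H); last by rewrite /W; ring.
by apply; lra.
Qed.
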